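(* Let $\Omega$ be a domain in $\mathbb{C}^m$, let $\Psi$ be a class of holomorphic test functions on $\Omega$, and let $\mathscr{U},\mathscr{Y}$ be Hilbert spaces. Let $z_1,\dots,z_n\in\Omega$ and $B_1,\dots,B_n\in B(\mathscr{U},\mathscr{Y})$. Suppose that $f\in \mathscr{SA}_\Psi(\mathscr{U},\mathscr{Y})$ satisfies $f(z_i)=B_i$ for $1\le i\le n$, and that $f$ is affiliated with a completely positive kernel $\Gamma:\{z_1,\dots,z_n\}\times\{z_1,\dots,z_n\}\to B(\mathcal{C}_b(\Psi),B(\mathscr{Y}))$ satisfying $I_{\mathscr{Y}}-B_iB_j^*=\Gamma(z_i,z_j)(1-E(z_i)E(z_j)^* )$ for all $i,j$. Let $\mathscr{M}_1,\mathscr{M}_2$ and $G:\Omega\to B(\mathscr{M}_2\oplus\mathscr{U},\mathscr{M}_1\oplus\mathscr{Y})$ be the Hilbert spaces and the function constructed from the data $(z_i,B_i)_{i=1}^n$ and $\Gamma$ as described in the context, and write $$G(z)=\begin{pmatrix}G_{11}(z)&G_{12}(z)\\ G_{21}(z)&G_{22}(z)\end{pmatrix}:\mathscr{M}_2\oplus\mathscr{U}\to\mathscr{M}_1\oplus\mathscr{Y}.$$ Then there exists $\mathbf{t}\in \mathscr{SA}_\Psi(\mathscr{M}_1,\mathscr{M}_2)$ such that $$f(z)=G_{22}(z)+G_{21}(z)\bigl(I_{\mathscr{M}_2}-\mathbf{t}(z)G_{11}(z)\bigr)^{-1}\mathbf{t}(z)G_{12}(z)\quad\text{for all } z\in\Omega,$$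 where the inverses exist in $B(\mathscr{M}_2)$.
   Context: Test functions. A collection $\Psi$ of $\mathbb{C}$-valued functions on a set $\Omega$ is a set of test functions if (1) $\sup\{|\psi(x)|:\psi\in\Psi\}<1$ for each $x\in\Omega$, and (2) for each finite $F\subset\Omega$, the functions $\psi|_F$, $\psi\in\Psi$, together with the constant function generate the algebra of all $\mathbb{C}$-valued functions on $F$. When $\Omega$ is a domain (open connected set) in $\mathbb{C}^m$, holomorphic test functions are test functions that are all holomorphic on $\Omega$. $\Psi$ carries the subspace topology from $\overline{\mathbb{D}}^{\,\Omega}$ with the product topology; $\mathcal{C}_b(\Psi)$ is the $C^*$-algebra of bounded continuous functions on $\Psi$ with the supremum norm; and for $x\in\Omega$, $E(x)\in\mathcal{C}_b(\Psi)$ is $E(x)(\psi)=\psi(x)$, so $\|E(x)\|<1$. Kernels. For a Hilbert space $\mathcal{E}$, a function $k:\Omega\times\Omega\to B(\mathcal{E})$ is a positive kernel if $\sum_{i,j=1}^n\langle k(x_i,x_j)e_j,e_i\rangle\ge 0$ for all $n\geq 1$, $x_i\in\Omega$, $e_i\in\mathcal{E}$. Its reproducing kernel Hilbert space $\mathcal{H}(k)$ is the Hilbert space of $\mathcal{E}$-valued functions on $\Omega$ in which the span of $\{k(\cdot,w)e:w\in\Omega,e\in\mathcal{E}\}$ is dense and $\langle h,k(\cdot,w)e\rangle_{\mathcal{H}(k)}=\langle h(w),e\rangle_{\mathcal{E}}$. The kernel $k$ is $\Psi$-admissible if for every $\psi\in\Psi$ the multiplication map $M_\psi:h\mapsto\psi\cdot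 h$ is a contraction on $\mathcal{H}(k)$; $\mathcal{K}_\Psi(\mathcal{E})$ is the set of all $\Psi$-admissible $B(\mathcal{E})$-valued kernels. Completely positive kernels. For a set $\Lambda$ and $C^*$-algebras $\mathscr{A},\mathscr{B}$, a function $\Gamma:\Lambda\times\Lambda\to B(\mathscr{A},\mathscr{B})$ (bounded linear maps) is a completely positive kernel if $\sum_{i,j=1}^n b_i^*\,\Gamma(x_i,x_j)(a_i^*a_j)\,b_j\ge0$ for all $n\ge1$, $a_i\in\mathscr{A}$, $b_i\in\mathscr{B}$, $x_i\in\Lambda$. Every completely positive kernel $\Gamma:\Lambda\times\Lambda\to B(\mathcal{C}_b(\Psi),B(\mathscr{Y}))$ has a Kolmogorov decomposition: a Hilbert space $\mathscr{X}_1$, a unital $*$-representation $\mu:\mathcal{C}_b(\Psi)\to B(\mathscr{X}_1)$ and $h:\Lambda\to B(\mathscr{X}_1,\mathscr{Y})$ with $\Gamma(x,y)(\delta)=h(x)\mu(\delta)h(y)^*$. $\Psi$-Schur-Agler class. For Hilbert spaces $\mathscr{U},\mathscr{Y}$, $\mathscr{SA}_\Psi(\mathscr{U},\mathscr{Y})$ is the set of $S:\Omega\to B(\mathscr{U},\mathscr{Y})$ such that $(x,y)\mapsto(I_{\mathscr{Y}}-S(x)S(y)^* )\otimes k(x,y)$ is a positive $B(\mathscr{Y}\otimes\mathscr{Y})$-valued kernel for every $k\in\mathcal{K}_\Psi(\mathscr{Y})$. Affiliation. Let $\Gamma$ be a completely positive kernel on $\{z_1,\dots,z_n\}$ with $I_{\mathscr{Y}}-B_iB_j^*=\Gamma(z_i,z_j)(1-E(z_i)E(z_j)^*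 )$ for all $i,j$. A solution $f$ of the interpolation problem $z_i\mapsto B_i$ is affiliated with $\Gamma$ if there is a completely positive kernel $\Delta:\Omega\times\Omega\to B(\mathcal{C}_b(\Psi),B(\mathscr{Y}))$ with $I_{\mathscr{Y}}-f(z)f(w)^*=\Delta(z,w)(1-E(z)E(w)^* )$ for all $z,w\in\Omega$ and $\Delta(z_i,z_j)=\Gamma(z_i,z_j)$ for all $i,j=1,\dots,n$. Construction of $\mathscr{M}_1,\mathscr{M}_2,G$. Fix a Kolmogorov decomposition $(\mathscr{X}_1,\mu,h)$ of $\Gamma$ on $\{z_1,\dots,z_n\}$. Let $\mathscr{L}_1=\overline{\mathrm{span}}\{\mu(\delta)h(z_i)^*y:1\le i\le n,\ \delta\in\mathcal{C}_b(\Psi),\ y\in\mathscr{Y}\}$, which reduces $\mu$; operators $\mu(\delta)$ below are restricted to $\mathscr{L}_1$. Let $$\mathscr{N}_2=\overline{\mathrm{span}}\{\mu(E(z_i))^*h(z_i)^*y\oplus y:\ y\in\mathscr{Y},1\le i\le n\}\subset\mathscr{L}_1\oplus\mathscr{Y},$$ $$\mathscr{N}_1=\overline{\mathrm{span}}\{h(z_i)^*y\oplus B_i^*y:\ y\in\mathscr{Y},1\le i\le n\}\subset\mathscr{L}_1\oplus\mathscr{U}.$$ There is a unitary $V:\mathscr{N}_2\to\mathscr{N}_1$ sending $\mu(E(z_i))^*h(z_i)^*y\oplus y$ to $h(z_i)^*y\oplus B_i^*y$ for all $i$ and $y$. Put $\mathscr{M}_1=(\mathscr{L}_1\oplus\mathscr{U})\ominus\mathscr{N}_1$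 and $\mathscr{M}_2=(\mathscr{L}_1\oplus\mathscr{Y})\ominus\mathscr{N}_2$. Let $\mathcal{Q}:\mathscr{N}_2\oplus\mathscr{M}_2\oplus\mathscr{M}_1\to\mathscr{N}_1\oplus\mathscr{M}_1\oplus\mathscr{M}_2$ be the unitary $n_2\oplus m_2\oplus m_1\mapsto Vn_2\oplus m_1\oplus m_2$. Identifying $\mathscr{N}_2\oplus\mathscr{M}_2\oplus\mathscr{M}_1$ with $\mathscr{L}_1\oplus(\mathscr{M}_1\oplus\mathscr{Y})$ and $\mathscr{N}_1\oplus\mathscr{M}_1\oplus\mathscr{M}_2$ with $\mathscr{L}_1\oplus(\mathscr{M}_2\oplus\mathscr{U})$, write $$\mathcal{Q}=\begin{pmatrix}\mathcal{Q}_{11}&\mathcal{Q}_{12}\\ \mathcal{Q}_{21}&\mathcal{Q}_{22}\end{pmatrix}:\mathscr{L}_1\oplus(\mathscr{M}_1\oplus\mathscr{Y})\to\mathscr{L}_1\oplus(\mathscr{M}_2\oplus\mathscr{U}),$$ and define, for $z\in\Omega$, $$G(z)=\mathcal{Q}_{22}^*+\mathcal{Q}_{12}^*\bigl(I_{\mathscr{L}_1}-\mu(E(z))\mathcal{Q}_{11}^*\bigr)^{-1}\mu(E(z))\mathcal{Q}_{21}^*\in B(\mathscr{M}_2\oplus\mathscr{U},\mathscr{M}_1\oplus\mathscr{Y}).$$ *)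

(* Defs.v *)
From HB Require Import structures.
From mathcomp Require Import all_boot all_order all_algebra.
From mathcomp Require Import all_classical all_reals all_analysis.
From mathcomp Require Import complex.

Set Implicit Arguments.
Unset Strict Implicit.
Unset Printing Implicit Defensive.

Import Order.TTheory GRing.Theory Num.Theory.
Import numFieldNormedType.Exports.

Local Open Scope classical_set_scope.
Local Open Scope ring_scope.

HB.instance Definition _ (R : realType) :=
  PseudoPointedMetric.copy R[i] R[i]^o.
HB.instance Definition _ (R : realType) := NormedModule.copy R[i] R[i]^o.

(* Inner products are linear in the first variable.  The
   norms of complex normed modules take their (nonnegative) values in R[i];
   in R[i], 0 <= x means that x is real and nonnegative. *)
HB.mixin Record isHilbert (R : realType) V & CompleteNormedModule R[i] V := {
  hdot : V -> V -> R[i] ;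
  hdotPl : forall (a : R[i]) (u v w : V),
    hdot (a *: u + v) w = a * hdot u w + hdot v w ;
  hdotC : forall u v : V, hdot u v = (hdot v u)^* ;
  hdotxx : forall u : V, hdot u u = `|u| ^+ 2 }.

#[short(type="hilbertType")]
HB.structure Definition Hilbert (R : realType) :=
  {V of isHilbert R V & CompleteNormedModule R[i] V}.

Section DotTheory.
Variables (C : numClosedFieldType) (V : lmodType C) (dot : V -> V -> C).
Hypothesis dotPl : forall (a : C) (u v w : V),
  dot (a *: u + v) w = a * dot u w + dot v w.
Hypothesis dotC : forall u v : V, dot u v = (dot v u)^*.
Hypothesis dot_ge0 : forall u : V, 0 <= dot u u.
Hypothesis dot_eq0 : forall u : V, dot u u = 0 -> u = 0.

Lemma dot0l w : dot 0 w = 0.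
Proof.
have := dotPl 1 0 0 w; rewrite scale1r addr0 mul1r => /eqP.
by rewrite -subr_eq subrr eq_sym => /eqP.
Qed.

Lemma dotDl u v w : dot (u + v) w = dot u w + dot v w.
Proof. by have := dotPl 1 u v w; rewrite scale1r mul1r. Qed.

Lemma dotZl a u w : dot (a *: u) w = a * dot u w.
Proof. by have := dotPl a u 0 w; rewrite addr0 dot0l addr0. Qed.

Lemma dotBl u v w : dot (u - v) w = dot u w - dot v w.
Proof. by rewrite dotDl -scaleN1r dotZl mulN1r. Qed.

Lemma dotDr u v w : dot w (u + v) = dot w u + dot w v.
Proof. by rewrite dotC dotDl rmorphD /= -!dotC. Qed.

Lemma dotZr a u w : dot w (a *: u) = a^* * dot w u.
Proof. by rewrite dotC dotZl rmorphM /= -dotC. Qed.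

Lemma dotBr u v w : dot w (u - v) = dot w u - dot w v.
Proof. by rewrite dotC dotBl rmorphB /= -!dotC. Qed.

Lemma dot_CS u v : `|dot u v| ^+ 2 <= dot u u * dot v v.
Proof.
have [v0|v0] := eqVneq v 0.
  by rewrite v0 [dot u 0]dotC dot0l conjC0 normr0 expr0n mulr_ge0.
have vv : 0 < dot v v.
  rewrite lt_neqAle dot_ge0 andbT eq_sym.
  by apply: contra v0 => /eqP /dot_eq0 ->.
set a := dot u v / dot v v.
have := dot_ge0 (u - a *: v).
have -> : dot (u - a *: v) (u - a *: v) =
    dot u u - `|dot u v| ^+ 2 / dot v v.
  have sv : (dot v v)^* = dot v v by rewrite -dotC.
  have av : a^* * dot v v = dot v u.
    by rewrite [dot v u]dotC -{1}sv -rmorphM /= /a divfK// gt_eqF.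
  rewrite dotBl !dotBr !dotZl !dotZr av subrr subr0.
  by rewrite normCK /a rmorphM /= fmorphV /= sv mulrC mulrA.
by rewrite subr_ge0 ler_pdivrMr.
Qed.

Lemma dot_triangle u v :
  sqrtC (dot (u + v) (u + v)) <= sqrtC (dot u u) + sqrtC (dot v v).
Proof.
rewrite -ler_sqr ?nnegrE ?addr_ge0 ?sqrtC_ge0// sqrrD !sqrtCK.
have -> : dot (u + v) (u + v) = dot u u + (dot u v + dot v u) + dot v v.
  by rewrite dotDl !dotDr !addrA.
rewrite lerD2r lerD2l.
have uvR : dot u v + dot v u \is Num.real.
  by apply/CrealP; rewrite rmorphD /= -!dotC addrC.
rewrite (le_trans (real_ler_norm uvR))//.
rewrite (le_trans (ler_normD _ _))// [dot v u]dotC norm_conjC -mulr2n.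
rewrite lerMn2r /=.
rewrite -ler_sqr ?nnegrE ?mulr_ge0 ?sqrtC_ge0// exprMn !sqrtCK.
exact: dot_CS.
Qed.

End DotTheory.

Section HilbertTheory.
Variables (R : realType) (V : hilbertType R).
Implicit Types x y z : V.

Lemma hdot_ge0 x : 0 <= hdot x x. Proof. by rewrite hdotxx exprn_ge0. Qed.

Lemma hdot_eq0 x : hdot x x = 0 -> x = 0.
Proof. by rewrite hdotxx => /eqP; rewrite sqrf_eq0 normr_eq0 => /eqP. Qed.

Lemma hdot_CS x y : `|hdot x y| <= `|x| * `|y|.
Proof.
rewrite -ler_sqr ?nnegrE ?mulr_ge0// exprMn -!hdotxx.
exact: (dot_CS hdotPl hdotC hdot_ge0 hdot_eq0).
Qed.

End HilbertTheory.

(* Orthogonal direct sum; an alias of the product type, whose own norm is the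
   maximum norm. *)
Definition hsum (U V : Type) : Type := (U * V)%type.

Section HSum.
Variables (R : realType) (U V : hilbertType R).
Local Notation W := (hsum U V).

HB.instance Definition _ := GRing.Lmodule.copy W (U * V)%type.

Definition hsum_dot (p q : W) : R[i] := hdot p.1 q.1 + hdot p.2 q.2.

Lemma hsum_dotPl (a : R[i]) (u v w : W) :
  hsum_dot (a *: u + v) w = a * hsum_dot u w + hsum_dot v w.
Proof. by rewrite /hsum_dot /= !hdotPl mulrDr addrACA. Qed.

Lemma hsum_dotC (u v : W) : hsum_dot u v = (hsum_dot v u)^*.
Proof. by rewrite /hsum_dot rmorphD /= -!hdotC. Qed.

Lemma hsum_dot_ge0 (u : W) : 0 <= hsum_dot u u.
Proof. by rewrite addr_ge0 ?hdot_ge0. Qed.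

Lemma hsum_dot_eq0 (u : W) : hsum_dot u u = 0 -> u = 0.
Proof.
case: u => u v /eqP; rewrite /hsum_dot paddr_eq0 ?hdot_ge0//=.
by move=> /andP[/eqP/hdot_eq0-> /eqP/hdot_eq0->].
Qed.

Definition hsum_norm (p : W) : R[i] := sqrtC (hsum_dot p p).

Lemma hsum_normD (p q : W) : hsum_norm (p + q) <= hsum_norm p + hsum_norm q.
Proof. exact: (dot_triangle hsum_dotPl hsum_dotC hsum_dot_ge0 hsum_dot_eq0). Qed.

Lemma hsum_normZ (a : R[i]) (p : W) : hsum_norm (a *: p) = `|a| * hsum_norm p.
Proof.
rewrite /hsum_norm (dotZl hsum_dotPl) (dotZr hsum_dotPl hsum_dotC) mulrA -normCK.
by rewrite sqrtCM ?nnegrE ?exprn_ge0 ?hsum_dot_ge0// sqrCK.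
Qed.

Lemma hsum_norm0 (p : W) : hsum_norm p = 0 -> p = 0.
Proof. by move=> /eqP; rewrite sqrtC_eq0 => /eqP /hsum_dot_eq0. Qed.

HB.instance Definition _ :=
  Lmodule_isNormed.Build R[i] W hsum_normD hsum_normZ hsum_norm0.

Lemma hsum_normE (p : W) : `|p| ^+ 2 = `|p.1| ^+ 2 + `|p.2| ^+ 2.
Proof. by rewrite [`|p|]/(hsum_norm p) sqrtCK /hsum_dot !hdotxx. Qed.

Lemma hsum_norm_fst (p : W) : `|p.1| <= `|p|.
Proof. by rewrite -ler_sqr ?nnegrE// hsum_normE lerDl exprn_ge0. Qed.

Lemma hsum_norm_snd (p : W) : `|p.2| <= `|p|.
Proof. by rewrite -ler_sqr ?nnegrE// hsum_normE lerDr exprn_ge0. Qed.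

Lemma hsum_norm_le (p : W) : `|p| <= `|p.1| + `|p.2|.
Proof.
rewrite -ler_sqr ?nnegrE ?addr_ge0// hsum_normE sqrrD -addrA lerD2l.
by rewrite lerDr mulrn_wge0 ?mulr_ge0.
Qed.

Lemma hsum_complete (F : set_system W) : ProperFilter F -> cauchy F -> cvg F.
Proof.
move=> FF /cauchy_ballP cF.
have proj (X : hilbertType R) (g : W -> X) :
    (forall p q, `|g p - g q| <= `|p - q|) -> cvg (g @ F).
  move=> gle; apply: cauchy_cvg; apply/cauchy_ballP => e e0.
  have [[A B] [/= FA FB] AB] := cF e e0.
  exists (g @` A, g @` B) => /=.
    by split; [apply: filterS FA|apply: filterS FB] => p Ap; exists p.
  move=> [_ _] /= [[p Ap <-] [q Bq <-]].
  have := AB (p, q) (conj Ap Bq); rewrite -!ball_normE /=.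
  exact/le_lt_trans/gle.
have /cvg_ex[/= l1 c1] : cvg (fst @ F).
  by apply: (proj U fst) => p q; exact: (hsum_norm_fst (p - q)).
have /cvg_ex[/= l2 c2] : cvg (snd @ F).
  by apply: (proj V snd) => p q; exact: (hsum_norm_snd (p - q)).
apply/cvg_ex; exists ((l1, l2) : W); apply/cvgrPdist_lt => e e0.
have e2 : 0 < e / 2 by rewrite divr_gt0.
move/cvgrPdist_lt : c1 => /(_ _ e2) c1; move/cvgrPdist_lt : c2 => /(_ _ e2) c2.
near=> p; rewrite (le_lt_trans (hsum_norm_le _))// (splitr e) ltrD//.
- by near: p; exact: c1.
- by near: p; exact: c2.
Unshelve. all: by end_near. Qed.

HB.instance Definition _ := Uniform_isComplete.Build W hsum_complete.
HB.instance Definition _ := isHilbert.Build R W hsum_dotPl hsum_dotC (fun u => esym (sqrtCK (hsum_dot u u))).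

End HSum.

Definition subspace_pred (R : realType) (H : hilbertType R) (A : set H) : Prop :=
  A 0 /\ forall (a : R[i]) u v, A u -> A v -> A (a *: u + v).

Record csubspace (R : realType) (H : hilbertType R) := CSubspace {
  csub_set :> set H ;
  csub_subspace : subspace_pred csub_set ;
  csub_closed : closed csub_set }.

Definition csub_pred (R : realType) (H : hilbertType R) (W : csubspace H) :
  {pred H} := mem (csub_set W).

Record csub (R : realType) (H : hilbertType R) (W : csubspace H) := CSub {
  csub_val : H ;
  csub_valP : csub_val \in csub_pred W }.

Section CSub.
Variables (R : realType) (H : hilbertType R) (W : csubspace H).

Lemma csub_submod : GRing.subsemimod_closed (csub_pred W).
Proof.
have [W0 WP] := csub_subspace W; split; first split.
- exact/mem_set.
- move=> u v /set_mem Wu /set_mem Wv; apply/mem_set.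
  by rewrite -[u]scale1r; exact: WP.
- move=> a u /set_mem Wu; apply/mem_set.
  by rewrite -[a *: u]addr0; exact: WP.
Qed.

HB.instance Definition _ := [isSub of csub W for @csub_val R H W].
HB.instance Definition _ := [Choice of csub W by <:].
HB.instance Definition _ := GRing.isSubmodClosed.Build R[i] H (@csub_pred R H W) csub_submod.
HB.instance Definition _ := [SubChoice_isSubLmodule of csub W by <:].

Local Notation T := (csub W).

Lemma csub_normD (u v : T) : `|val (u + v)| <= `|val u| + `|val v|.
Proof. exact: ler_normD. Qed.

Lemma csub_normZ (a : R[i]) (u : T) : `|val (a *: u)| = `|a| * `|val u|.
Proof. exact: normrZ. Qed.

Lemma csub_norm0 (u : T) : `|val u| = 0 -> u = 0.
Proof. by move=> /eqP; rewrite normr_eq0 => /eqP u0; apply/val_inj. Qed.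

HB.instance Definition _ :=
  Lmodule_isNormed.Build R[i] T csub_normD csub_normZ csub_norm0.

Lemma csub_normE (u : T) : `|u| = `|val u|. Proof. by []. Qed.

Lemma csub_complete (F : set_system T) : ProperFilter F -> cauchy F -> cvg F.
Proof.
move=> FF /cauchy_ballP cF.
have /cvg_ex[/= l cl] : cvg (@csub_val R H W @ F).
  apply: cauchy_cvg; apply/cauchy_ballP => e e0.
  have [[A B] [/= FA FB] AB] := cF e e0.
  exists (@csub_val R H W @` A, @csub_val R H W @` B) => /=.
    by split; [apply: filterS FA|apply: filterS FB] => p Ap; exists p.
  move=> [_ _] /= [[p Ap <-] [q Bq <-]].
  by have := AB (p, q) (conj Ap Bq); rewrite -!ball_normE.
have Wl : csub_set W l.
  have FW : \forall p \near F, csub_set W (@csub_val R H W p).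
    by apply: nearW => p; exact: set_mem (csub_valP p).
  exact: (@closed_cvg _ _ F _ (@csub_val R H W) _ (@csub_closed _ _ W) FW _ cl).
apply/cvg_ex; exists (CSub (mem_set Wl)); apply/cvgrPdist_lt => e e0.
move/cvgrPdist_lt : cl => /(_ _ e0); exact: filterS.
Qed.

HB.instance Definition _ := Uniform_isComplete.Build T csub_complete.

Definition csub_dot (u v : T) : R[i] := hdot (val u) (val v).

Lemma csub_dotPl (a : R[i]) (u v w : T) :
  csub_dot (a *: u + v) w = a * csub_dot u w + csub_dot v w.
Proof. exact: hdotPl. Qed.

Lemma csub_dotC (u v : T) : csub_dot u v = (csub_dot v u)^*.
Proof. exact: hdotC. Qed.

Lemma csub_dotxx (u : T) : csub_dot u u = `|u| ^+ 2.
Proof. exact: hdotxx. Qed.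

HB.instance Definition _ := isHilbert.Build R T csub_dotPl csub_dotC csub_dotxx.

End CSub.

Section Spans.
Variables (R : realType) (H : hilbertType R).

Lemma closure_subspace (A : set H) : subspace_pred A -> subspace_pred (closure A).
Proof.
move=> [A0 AP]; split; first exact: subset_closure.
move=> a u v cu cv B Bauv.
have cont : {for (u, v), continuous (fun p : H * H => a *: p.1 + p.2)}.
  apply: cvgD; last exact: cvg_snd.
  by apply: cvgZr; exact: cvg_fst.
have [[P Q] /= [Pu Qv] PQ] := cont _ Bauv.
have [x [Ax Px]] := cu _ Pu; have [y [Ay Qy]] := cv _ Qv.
by exists (a *: x + y); split; [exact: AP | exact: (PQ (x, y))].
Qed.

Definition lspan (S : set H) : set H := smallest (@subspace_pred R H) S.

Lemma lspan_subspace (S : set H) : subspace_pred (lspan S).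
Proof.
split=> [A [[A0 _] _]//|a u v Su Sv A SA].
have [[_ AP] _] := SA; apply: AP; [exact: (Su A SA)|exact: (Sv A SA)].
Qed.

Definition cspan (S : set H) : csubspace H :=
  CSubspace (closure_subspace (lspan_subspace S)) (@closed_closure _ _).

Lemma sub_cspan (S : set H) : S `<=` cspan S.
Proof. by move=> x Sx; apply: subset_closure => A [_]; exact. Qed.

Lemma ortho_subspace (S : set H) :
  subspace_pred [set x | forall s, S s -> hdot x s = 0].
Proof.
split=> [s _|a u v Su Sv s Ss]; first exact: (dot0l (@hdotPl R H)).
by rewrite hdotPl Su// Sv// mulr0 addr0.
Qed.

Lemma ortho_closed (S : set H) : closed [set x | forall s, S s -> hdot x s = 0].
Proof.
move=> x cx s Ss; apply/eqP; rewrite -normr_le0; apply/ler_addgt0Pl => e e0.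
rewrite addr0.
have d0 : 0 < e / (`|s| + 1) by rewrite divr_gt0// ltr_wpDl.
have [y [Sy]] := cx _ (nbhsx_ballx x _ d0).
rewrite -ball_normE /= => xy.
have -> : hdot x s = hdot (x - y) s.
  by rewrite (dotBl (@hdotPl R H)) Sy// subr0.
rewrite (le_trans (hdot_CS _ _))//.
rewrite (@le_trans _ _ (e / (`|s| + 1) * (`|s| + 1)))//.
  by apply: ler_pM => //; [exact: ltW|rewrite lerDl].
by rewrite divfK// gt_eqF// ltr_wpDl.
Qed.

(* Orthogonal complement of S *)
Definition ortho (S : set H) : csubspace H :=
  CSubspace (ortho_subspace S) (@ortho_closed S).

End Spans.

Section BoundedOperators.
Variables (R : realType).

(* Bounded operators, as continuous linear maps *)
Definition bop_pred (U V : hilbertType R) : {pred U -> V} :=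
  fun f => `[< linear f /\ continuous f >].

Record bop (U V : hilbertType R) := Bop {
  bop_fun :> U -> V ;
  bop_funP : bop_fun \in @bop_pred U V }.

End BoundedOperators.
Notation "''B' ( U , V )" := (bop U V) (at level 8, U, V at level 200) : type_scope.

Section BopModule.
Variables (R : realType) (U V : hilbertType R).

Lemma bop_submod : GRing.subsemimod_closed (@bop_pred R U V).
Proof.
split; first split.
- apply/asboolP; split; last exact: cst_continuous.
  by move=> a u v; rewrite scaler0 addr0.
- move=> f g /asboolP[lf cf] /asboolP[lg cg]; apply/asboolP; split.
    move=> a u v; rewrite -[(f + g) _]/(f _ + g _) lf lg scalerDr addrACA.
    by [].
  by move=> x; apply: continuousD; [exact: cf|exact: cg].
- move=> a f /asboolP[lf cf]; apply/asboolP; split.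
    move=> b u v; rewrite -[(a *: f) _]/(a *: f _) lf scalerDr !scalerA mulrC.
    by rewrite -scalerA.
  by move=> x; apply: continuousZr; exact: cf.
Qed.

HB.instance Definition _ := [isSub of 'B(U, V) for @bop_fun R U V].
HB.instance Definition _ := [Choice of 'B(U, V) by <:].
HB.instance Definition _ :=
  GRing.isSubmodClosed.Build R[i] (U -> V) (@bop_pred R U V) bop_submod.
HB.instance Definition _ := [SubChoice_isSubLmodule of 'B(U, V) by <:].

Lemma bop_linear (T : 'B(U, V)) : linear T.
Proof. by have /asboolP[] := bop_funP T. Qed.

Lemma bop_continuous (T : 'B(U, V)) : continuous T.
Proof. by have /asboolP[] := bop_funP T. Qed.

HB.instance Definition _ (T : 'B(U, V)) :=
  GRing.isLinear.Build R[i] U V *:%R T (@bop_linear T).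

Lemma mkbop_subproof (f : U -> V) :
  linear f -> continuous f -> f \in @bop_pred R U V.
Proof. by move=> lf cf; apply/asboolP. Qed.

Definition mkbop (f : U -> V) (lf : linear f) (cf : continuous f) : 'B(U, V) :=
  Bop (mkbop_subproof lf cf).

Lemma lipschitz_continuous (f : U -> V) (M : R[i]) :
  0 <= M -> (forall x y, `|f x - f y| <= M * `|x - y|) -> continuous f.
Proof.
move=> M0 fM x; apply/cvgrPdist_lt => e e0.
have M1 : 0 < M + 1 by rewrite ltr_wpDl.
have d0 : 0 < e / (M + 1) by rewrite divr_gt0.
near=> y; rewrite (le_lt_trans (fM _ _))//.
rewrite (@le_lt_trans _ _ ((M + 1) * `|x - y|))//.
  by rewrite ler_wpM2r// lerDl.
rewrite -ltr_pdivlMl// mulrC; near: y.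
by have /cvgrPdist_lt := @cvg_id _ (nbhs x); exact.
Unshelve. all: by end_near. Qed.

End BopModule.

Section Operators.
Variable (R : realType).
Implicit Types U V W : hilbertType R.

Lemma bid_linear U : linear (@idfun U). Proof. by []. Qed.
Lemma bid_continuous U : continuous (@idfun U).
Proof. by move=> x; exact: cvg_id. Qed.
Definition bid U : 'B(U, U) := mkbop (@bid_linear U) (@bid_continuous U).

Lemma bcomp_linear U V W (S : 'B(V, W)) (T : 'B(U, V)) : linear (S \o T).
Proof. by move=> a u v /=; rewrite !linearP. Qed.
Lemma bcomp_continuous U V W (S : 'B(V, W)) (T : 'B(U, V)) :
  continuous (S \o T).
Proof. by move=> x; apply: continuous_comp; exact: bop_continuous. Qed.
Definition bcomp U V W (S : 'B(V, W)) (T : 'B(U, V)) : 'B(U, W) :=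
  mkbop (bcomp_linear S T) (@bcomp_continuous _ _ _ S T).

Lemma bfst_linear U V : linear (fst : hsum U V -> U). Proof. by []. Qed.
Lemma bfst_continuous U V : continuous (fst : hsum U V -> U).
Proof.
apply: (lipschitz_continuous ler01) => p q; rewrite mul1r.
exact: (hsum_norm_fst (p - q)).
Qed.
Definition bfst U V : 'B(hsum U V, U) :=
  mkbop (@bfst_linear U V) (@bfst_continuous U V).

Lemma bsnd_linear U V : linear (snd : hsum U V -> V). Proof. by []. Qed.
Lemma bsnd_continuous U V : continuous (snd : hsum U V -> V).
Proof.
apply: (lipschitz_continuous ler01) => p q; rewrite mul1r.
exact: (hsum_norm_snd (p - q)).
Qed.
Definition bsnd U V : 'B(hsum U V, V) :=
  mkbop (@bsnd_linear U V) (@bsnd_continuous U V).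

Lemma bpair_linear U V W (S : 'B(U, V)) (T : 'B(U, W)) :
  linear (fun x => (S x, T x) : hsum V W).
Proof. by move=> a u v; rewrite !linearP. Qed.
Lemma bpair_continuous U V W (S : 'B(U, V)) (T : 'B(U, W)) :
  continuous (fun x => (S x, T x) : hsum V W).
Proof.
move=> x; apply/cvgrPdist_lt => e e0.
have e2 : 0 < e / 2 by rewrite divr_gt0.
near=> y; rewrite (le_lt_trans (hsum_norm_le _))// (splitr e) ltrD//=.
- by near: y; have /cvgrPdist_lt := @bop_continuous _ _ _ S x; exact.
- by near: y; have /cvgrPdist_lt := @bop_continuous _ _ _ T x; exact.
Unshelve. all: by end_near. Qed.
Definition bpair U V W (S : 'B(U, V)) (T : 'B(U, W)) : 'B(U, hsum V W) :=
  mkbop (bpair_linear S T) (@bpair_continuous _ _ _ S T).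

Definition binl U V : 'B(U, hsum U V) := bpair (bid U) 0.
Definition binr U V : 'B(V, hsum U V) := bpair 0 (bid V).

Lemma bincl_linear U (W : csubspace U) : linear (@csub_val R U W).
Proof. by []. Qed.
Lemma bincl_continuous U (W : csubspace U) : continuous (@csub_val R U W).
Proof.
by apply: (lipschitz_continuous ler01) => p q; rewrite mul1r.
Qed.
Definition bincl U (W : csubspace U) : 'B(csub W, U) :=
  mkbop (@bincl_linear U W) (@bincl_continuous U W).

Section Corestriction.
Variables (U V : hilbertType R) (W : csubspace V) (T : 'B(U, V)).
Hypothesis TW : forall x, csub_set W (T x).
Let g (x : U) : csub W := CSub (mem_set (TW x)).
Lemma bcorestr_linear : linear g.
Proof. by move=> a u v; apply/val_inj; rewrite /= linearP. Qed.
Lemma bcorestr_continuous : continuous g.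
Proof.
move=> x; apply/cvgrPdist_lt => e e0.
by have /cvgrPdist_lt := @bop_continuous _ _ _ T x; exact.
Qed.
Definition bcorestr : 'B(U, csub W) :=
  mkbop bcorestr_linear bcorestr_continuous.
End Corestriction.

(* The Hilbert-space adjoint; it exists (uniquely) by the Riesz theorem. *)
Definition adj U V (T : 'B(U, V)) : 'B(V, U) :=
  xget 0 [set S : 'B(V, U) | forall x y, hdot (T x) y = hdot x (S y)].

Definition is_binv U V (T : 'B(U, V)) (S : 'B(V, U)) : Prop :=
  bcomp S T = bid U /\ bcomp T S = bid V.

Definition binvertible U V (T : 'B(U, V)) : Prop := exists S, is_binv T S.

(* 0 when T is not invertible *)
Definition binv U V (T : 'B(U, V)) : 'B(V, U) := xget 0 [set S | is_binv T S].

Definition unitary U V (T : 'B(U, V)) : Prop := is_binv T (adj T).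

Definition bpos U (T : 'B(U, U)) : Prop := forall x, 0 <= hdot (T x) x.

End Operators.
Notation "S \oB T" := (bcomp S T) (at level 40, left associativity).
Notation "T ^†" := (adj T) (at level 2, format "T ^†").

Section Cb.
Variables (R : realType) (X : topologicalType).

(* Bounded continuous functions X -> R[i] *)
Definition Cb_pred : {pred X -> R[i]} := fun f =>
  `[< continuous f /\ exists M : R[i], forall x, `|f x| <= M >].

Record Cb := MkCb { Cb_fun :> X -> R[i] ; Cb_funP : Cb_fun \in Cb_pred }.

Lemma Cb_subring : GRing.subring_closed Cb_pred.
Proof.
split.
- apply/asboolP; split; first exact: cst_continuous.
  by exists 1 => x; rewrite normr1.
- move=> f g /asboolP[cf [M fM]] /asboolP[cg [N gN]]; apply/asboolP; split.
    by move=> x; apply: continuousB; [exact: cf|exact: cg].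
  by exists (M + N) => x; rewrite (le_trans (ler_normB _ _))// lerD.
- move=> f g /asboolP[cf [M fM]] /asboolP[cg [N gN]]; apply/asboolP; split.
    by move=> x; apply: continuousM; [exact: cf|exact: cg].
  exists (M * N) => x; rewrite -[(f * g) x]/(f x * g x) normrM.
  by apply: ler_pM.
Qed.

Lemma Cb_scale : GRing.scaler_closed Cb_pred.
Proof.
move=> a f /asboolP[cf [M fM]]; apply/asboolP; split.
  by move=> x; apply: continuousZr; exact: cf.
by exists (`|a| * M) => x; rewrite normrZ ler_wpM2l.
Qed.

HB.instance Definition _ := [isSub of Cb for Cb_fun].
HB.instance Definition _ := [Choice of Cb by <:].
HB.instance Definition _ :=
  GRing.isSubringClosed.Build (X -> R[i]) Cb_pred Cb_subring.
HB.instance Definition _ :=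
  GRing.isScaleClosed.Build R[i] (X -> R[i]) Cb_pred Cb_scale.
HB.instance Definition _ :=
  GRing.SubChoice_isSubPzRing.Build (X -> R[i]) Cb_pred Cb Cb_subring.
HB.instance Definition _ := [SubZmodule_isSubLmodule of Cb by <:].

Lemma Cb_star_subproof (f : Cb) : (fun x => (f x)^* : R[i]) \in Cb_pred.
Proof.
have /asboolP[cf [M fM]] := Cb_funP f; apply/asboolP; split; last first.
  by exists M => x; rewrite norm_conjC.
move=> x; apply/cvgrPdist_lt => e e0; have /cvgrPdist_lt/(_ _ e0) := cf x.
by apply: filterS => y; rewrite -rmorphB norm_conjC.
Qed.

Definition Cb_star (f : Cb) : Cb := MkCb (Cb_star_subproof f).

End Cb.

Section TestFunctions.
Variable (R : realType).

Definition subalgebra (X : Type) (A : set (X -> R[i])) : Prop :=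
  [/\ A 0, forall (a : R[i]) f g, A f -> A g -> A (a *: f + g) &
      forall f g, A f -> A g -> A (f * g)].

(* The second condition: the algebra generated by the restrictions to F of
   the test functions and by the constant 1 contains every function on F. *)
Record testFunctions (T : Type) := TestFunctions {
  tf_set :> set (T -> R[i]) ;
  tf_sup : forall x,
    (ereal_sup [set (complex.Re `|psi x|)%:E | psi in tf_set] < 1%:E)%E ;
  tf_generate : forall F : set T, finite_set F ->
    smallest (@subalgebra F)
      ([set cst 1] `|` [set psi \o val | psi in tf_set]) = setT }.

Variables (T : Type) (Psi : testFunctions T).

(* The set of test functions, with the topology of pointwise convergence *)
Definition tf_space : topologicalType :=
  initial_topology (fun psi : tf_set Psi => val psi : {ptws T -> R[i]}).

Definition tf_fun (psi : tf_space) : T -> R[i] := val (psi : tf_set Psi).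

Lemma tf_le1 (psi : tf_space) x : `|tf_fun psi x| <= 1.
Proof.
have n0 := normr_ge0 (tf_fun psi x).
have : ((complex.Re `|tf_fun psi x|)%:E <= 1%:E)%E.
  apply: le_trans (ltW (tf_sup Psi x)); apply: ereal_sup_ubound.
  by exists (tf_fun psi) => //; exact: set_mem (valP (psi : tf_set Psi)).
rewrite lee_fin => n1; rewrite -[leLHS]RRe_real ?ger0_real//.
by rewrite -[1]/(1%:C)%C lecR.
Qed.

Lemma ev_subproof (x : T) :
  (fun psi : tf_space => tf_fun psi x) \in @Cb_pred R tf_space.
Proof.
apply/asboolP; split; last by exists 1 => psi; exact: tf_le1.
move=> psi; apply: (@continuous_comp tf_space {ptws T -> R[i]} R[i]
  tf_fun (fun f => f x)); first exact: initial_continuous.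
exact: (@proj_continuous {classic T} (fun=> R[i])).
Qed.

(* The function E x *)
Definition ev (x : T) : Cb R tf_space := MkCb (ev_subproof x).

End TestFunctions.

(* A psi : D -> C is only defined on D; differentiability needs an extension. *)
Definition holomorphic (R : realType) (m : nat) (D : set 'rV[R[i]]_m)
    (psi : D -> R[i]) : Prop :=
  exists2 g : 'rV[R[i]]_m -> R[i], forall x : D, g (val x) = psi x &
    forall x, D x -> differentiable g x.

Section Kernels.
Variables (R : realType) (T : Type).

Definition positive_kernel (E : hilbertType R) (k : T -> T -> 'B(E, E)) : Prop :=
  forall (n : nat) (x : 'I_n -> T) (e : 'I_n -> E),
    0 <= \sum_(i < n) \sum_(j < n) hdot (k (x i) (x j) (e j)) (e i).

(* H, together with the injection fn into the functions T -> E, is the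
   reproducing kernel Hilbert space of k; it is unique up to a unitary that
   commutes with the injections. *)
Definition is_rkhs (E : hilbertType R) (k : T -> T -> 'B(E, E))
    (H : hilbertType R) (fn : H -> T -> E) : Prop :=
  [/\ linear fn, injective fn &
      exists K : T -> E -> H,
        [/\ forall w e, fn (K w e) = fun x => k x w e,
            forall h w e, hdot h (K w e) = hdot (fn h w) e &
            csub_set (cspan [set h | exists w e, h = K w e]) = setT]].

(* Every positive kernel has a reproducing kernel Hilbert space, so the
   existential over the models of H(k) only names it. *)
Definition admissible (Psi : testFunctions R T) (E : hilbertType R)
    (k : T -> T -> 'B(E, E)) : Prop :=
  positive_kernel k /\
  exists (H : hilbertType R) (fn : H -> T -> E), is_rkhs k fn /\
    forall psi, tf_set Psi psi -> forall h : H,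
      exists2 g : H, fn g = (fun x => psi x *: fn h x) & `|g| <= `|h|.

End Kernels.

(* W, with the map t of elementary tensors, is the Hilbert tensor product of U
   and V; it exists and is unique up to a unitary that fixes the tensors. *)
Definition is_tensor (R : realType) (U V W : hilbertType R) (t : U -> V -> W) :
    Prop :=
  [/\ forall v, linear (t^~ v), forall u, linear (t u),
      forall u v u' v', hdot (t u v) (t u' v') = hdot u u' * hdot v v' &
      csub_set (cspan [set w | exists u v, w = t u v]) = setT].

(* K x y is the operator (I - S x (S y)^†) (x) k x y, which is determined by
   its values on elementary tensors; W is (any model of) the tensor product of
   Y with itself. *)
Definition schur_agler (R : realType) (T : Type) (Psi : testFunctions R T)
    (U Y : hilbertType R) (S : T -> 'B(U, Y)) : Prop :=
  forall k : T -> T -> 'B(Y, Y), admissible Psi k ->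
  forall (W : hilbertType R) (t : Y -> Y -> W), is_tensor t ->
  forall K : T -> T -> 'B(W, W),
    (forall x y u v,
      K x y (t u v) = t ((bid Y - S x \oB (S y)^†) u) (k x y v)) ->
  positive_kernel K.

Section CPKernels.
Variables (R : realType) (X : topologicalType) (Y : hilbertType R).
Local Notation A := (Cb R X).

(* A bounded linear map from Cb X, with the supremum norm, to B(Y). *)
Definition Cb_bounded_linear (G : A -> 'B(Y, Y)) : Prop :=
  linear G /\ exists M : R[i], forall (d : A) (c : R[i]) (y : Y),
    0 <= c -> (forall x, `|d x| <= c) -> `|G d y| <= M * c * `|y|.

Definition cp_kernel (L : Type) (G : L -> L -> A -> 'B(Y, Y)) : Prop :=
  (forall x y, Cb_bounded_linear (G x y)) /\
  forall (n : nat) (x : 'I_n -> L) (a : 'I_n -> A) (b : 'I_n -> 'B(Y, Y)),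
    bpos (\sum_(i < n) \sum_(j < n)
      (b i)^† \oB G (x i) (x j) (Cb_star (a i) * a j) \oB b j).

Record star_rep (H : hilbertType R) := StarRep {
  rep_fun :> A -> 'B(H, H) ;
  rep_linear : linear rep_fun ;
  rep1 : rep_fun 1 = bid H ;
  repM : forall d e, rep_fun (d * e) = rep_fun d \oB rep_fun e ;
  rep_star : forall d, rep_fun (Cb_star d) = (rep_fun d)^† }.

Record kolmogorov (L : Type) (G : L -> L -> A -> 'B(Y, Y)) := Kolmogorov {
  kol_space : hilbertType R ;
  kol_rep : star_rep kol_space ;
  kol_h : L -> 'B(kol_space, Y) ;
  kol_eq : forall x y d,
    G x y d = kol_h x \oB kol_rep d \oB (kol_h y)^† }.

End CPKernels.

Section Invariance.
Variables (R : realType) (H : hilbertType R).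

Lemma cspan_min (S : set H) (W : csubspace H) :
  S `<=` csub_set W -> csub_set (cspan S) `<=` csub_set W.
Proof.
move=> SW; rewrite ((closure_id (csub_set W)).1 (@csub_closed _ _ W)).
by apply: closureS => x; apply; split => //; exact: csub_subspace.
Qed.

Lemma bop_preimage_subspace (K : hilbertType R) (T : 'B(K, H)) (W : csubspace H) :
  subspace_pred (T @^-1` csub_set W).
Proof.
have [W0 WP] := csub_subspace W; split; first by rewrite /preimage /= linear0.
by move=> a u v Wu Wv; rewrite /preimage /= linearP; exact: WP.
Qed.

Lemma bop_preimage_closed (K : hilbertType R) (T : 'B(K, H)) (W : csubspace H) :
  closed (T @^-1` csub_set W).
Proof.
apply: preimage_closed; last exact: csub_closed.
by move=> x _; exact: bop_continuous.
Qed.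

Lemma cspan_stable (S : set H) (T : 'B(H, H)) :
  (forall x, S x -> S (T x)) ->
  forall x, csub_set (cspan S) x -> csub_set (cspan S) (T x).
Proof.
move=> ST; apply: (@cspan_min S (CSubspace (@bop_preimage_subspace _ T (cspan S))
  (@bop_preimage_closed _ T (cspan S)))) => x Sx.
by apply: sub_cspan; exact: ST.
Qed.

End Invariance.

Section Blocks.
Variables (R : realType) (A1 A2 C1 C2 : hilbertType R).
Variable T : 'B(hsum A1 A2, hsum C1 C2).
Definition b11 : 'B(A1, C1) := bfst C1 C2 \oB T \oB binl A1 A2.
Definition b12 : 'B(A2, C1) := bfst C1 C2 \oB T \oB binr A1 A2.
Definition b21 : 'B(A1, C2) := bsnd C1 C2 \oB T \oB binl A1 A2.
Definition b22 : 'B(A2, C2) := bsnd C1 C2 \oB T \oB binr A1 A2.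
End Blocks.

(* For N a closed subspace of A (+) C, the identification of
   N (+) N^perp (+) M with A (+) (M (+) C). *)
Definition regroup (R : realType) (A C M : hilbertType R)
    (N : csubspace (hsum A C)) :
    'B(hsum (csub N) (hsum (csub (ortho N)) M), hsum A (hsum M C)) :=
  let s := bincl N \oB bfst _ _ +
           bincl (ortho N) \oB (bfst _ _ \oB bsnd _ _) in
  bpair (bfst _ _ \oB s) (bpair (bsnd _ _ \oB bsnd _ _) (bsnd _ _ \oB s)).

(* z i as an element of the set {z_1, ..., z_n} *)
Definition node (T : Type) (n : nat) (z : 'I_n -> T) (i : 'I_n) : range z :=
  SigSub (mem_set (imageT z i)).

Section Construction.
Variables (R : realType) (T : Type) (Psi : testFunctions R T).
Variables (U Y : hilbertType R) (n : nat) (z : 'I_n -> T) (B : 'I_n -> 'B(U, Y)).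
Variable (Gam : range z -> range z -> Cb R (tf_space Psi) -> 'B(Y, Y)).
Variable (K : kolmogorov Gam).

Let X1 := kol_space K.
Let mu := kol_rep K.
Let h i := kol_h K (node z i).

Definition L1_gen : set X1 :=
  [set x | exists i d y, x = mu d ((h i)^† y)].
Definition L1 : csubspace X1 := cspan L1_gen.

Lemma mu_L1 d (x : csub L1) : csub_set L1 ((mu d \oB bincl L1) x).
Proof.
apply: cspan_stable; last exact: set_mem (csub_valP x).
move=> _ [i [e [y ->]]]; exists i, (d * e), y.
by rewrite repM.
Qed.

Lemma h_L1 i y : csub_set L1 ((h i)^† y).
Proof. by apply: sub_cspan; exists i, 1, y; rewrite rep1. Qed.

(* The restriction of mu d to L1, and (h i)^† as a map into L1 *)
Definition muL d : 'B(csub L1, csub L1) := bcorestr (@mu_L1 d).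
Definition hL i : 'B(Y, csub L1) := bcorestr (@h_L1 i).

Definition gen2 i y : hsum (csub L1) Y := ((muL (ev Psi (z i)))^† (hL i y), y).
Definition gen1 i y : hsum (csub L1) U := (hL i y, (B i)^† y).

Definition N2 := cspan [set p | exists i y, p = gen2 i y].
Definition N1 := cspan [set p | exists i y, p = gen1 i y].

(* The unique unitary operator taking gen2 i y to gen1 i y *)
Definition Vop : 'B(csub N2, csub N1) :=
  xget 0 [set V | unitary V /\
    forall i y (p : csub N2), csub_val p = gen2 i y -> csub_val (V p) = gen1 i y].

Definition M1 := ortho N1.
Definition M2 := ortho N2.

(* n2 (+) (m2 (+) m1) |-> V n2 (+) (m1 (+) m2) *)
Definition Qsum :
    'B(hsum (csub N2) (hsum (csub M2) (csub M1)),
       hsum (csub N1) (hsum (csub M1) (csub M2))) :=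
  bpair (Vop \oB bfst _ _)
    (bpair (bsnd _ _ \oB bsnd _ _) (bfst _ _ \oB bsnd _ _)).

(* regroup is unitary: its adjoint is its inverse *)
Definition Qop :
    'B(hsum (csub L1) (hsum (csub M1) Y), hsum (csub L1) (hsum (csub M2) U)) :=
  regroup (csub M2) N1 \oB Qsum \oB (regroup (csub M1) N2)^†.

Definition Gfun (x : T) : 'B(hsum (csub M2) U, hsum (csub M1) Y) :=
  let E := muL (ev Psi x) in
  (b22 Qop)^† +
  (b12 Qop)^† \oB binv (bid (csub L1) - E \oB (b11 Qop)^†) \oB E \oB (b21 Qop)^†.

Definition cp_interpolation : Prop := forall i j,
  bid Y - B i \oB (B j)^† =
  Gam (node z i) (node z j) (1 - ev Psi (z i) * Cb_star (ev Psi (z j))).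

(* That f interpolates, f (z i) = B i, is not part of this predicate. *)
Definition affiliated (f : T -> 'B(U, Y)) : Prop :=
  exists D : T -> T -> Cb R (tf_space Psi) -> 'B(Y, Y),
    [/\ cp_kernel D,
        forall x y, bid Y - f x \oB (f y)^† =
          D x y (1 - ev Psi x * Cb_star (ev Psi y)) &
        forall i j, D (z i) (z j) = Gam (node z i) (node z j)].

End Construction.

(* Main.v *)
(* Write I - f(z) f(w)^† = Delta(z,w)(1 - E(z) E(w)^†) and take a Kolmogorov
   decomposition (X, rho, h) of Delta. The map
     rho(E(z))^† h(z)^† y (+) y |-> h(z)^† y (+) f(z)^† y
   is isometric; extended by 0 it is a partial isometry, and its adjoint S realises
   f as a transfer function: f(z) u = y if S (rho(E(z)) c, u) = (c, y) for some c.
   As Delta extends Gamma, there is an isometry J from L_1 to X that intertwines mu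
   and rho, and S extends V^-1; hence S is the direct sum of V^-1 and of a contraction
   S' from X' (+) M_1 to X' (+) M_2, where X' is the orthogonal complement of J L_1.
   The transfer function t of S' is a solution, because S is obtained by closing
   the feedback loop between Q^† and S'; the inverse of I - t(z) G_11(z) is read
   off the same loop, where rho(E(z)) is a strict contraction.
   No unitary extension is needed: S' being a contraction, I - t(z) t(w)^† is the sum
   of a positive kernel and of Delta'(z,w)(1 - E(z) E(w)^†) with Delta' completely
   positive, and multiplying by an admissible kernel preserves positivity of both
   because positive maps on commutative C^*-algebras are completely positive. *)

Require Import Defs.
From HB Require Import structures.
From mathcomp Require Import all_boot all_order all_algebra.
From mathcomp Require Import all_classical all_reals all_analysis.
From mathcomp Require Import complex.
From mathcomp Require Import ring.
Import Order.TTheory GRing.Theory Num.Theory.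
Import numFieldNormedType.Exports.
Local Open Scope classical_set_scope.
Local Open Scope ring_scope.

Set Implicit Arguments.
Unset Strict Implicit.
Unset Printing Implicit Defensive.

(** * Complex scalars and Hilbert spaces *)

(** The function [t] and the block G_11 take contractive values, but neither is known to be strictly
    contractive, so I - t G_11 cannot be inverted by a norm estimate. Strictness is available only
    for the state operators: at each point the supremum over the test functions is below 1.
    Invertibility is therefore split into injectivity and a right inverse, and both are transported
    to the loop of S, where the state equation is uniquely solvable. All isometries (V, J and the
    map attached to f) come from equalities of Gram matrices. It matters that the adjoint is known
    on the image vectors as well: S and its adjoint must both respect the copies of N_1 and N_2,
    otherwise S would not split as a direct sum. The map attached to f realises the adjoint of f(z),
    whereas G and the solution are transfer functions of Q^† and of S'; hence the passage from a
    loop to the adjoint loop. The operators [adj], [binv] and [Vop] are chosen values with default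
    0, so their defining properties rest on existence proofs. *)

Section ComplexNumbers.
Variable R : realType.
Implicit Types (a b e l : R[i]).

Lemma complex_archi e : 0 < e -> exists n : nat, n.+1%:R^-1 < e.
Proof.
move=> e0; have eR : e = (complex.Re e)%:C%C by rewrite RRe_real// gtr0_real.
have : 0 < complex.Re e by move: e0; rewrite eR ltcR.
move=> /ltr_add_invr[n]; rewrite add0r => h; exists n.
rewrite eR -[X in X < _]/(n.+1%:R^-1 : R[i]).
by rewrite -(rmorph_nat (@real_complex R)) -fmorphV ltcR.
Qed.

(** Since |r| = r, the number l - |l| is a difference of two small terms. Positivity of forms is
    later passed to limits in this way. *)
Lemma ge0_approx l :
  (forall e, 0 < e -> exists2 r, 0 <= r & `|l - r| <= e) -> 0 <= l.
Proof.
move=> h; suff -> : l = `|l| by [].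
apply/eqP; rewrite -subr_eq0 -normr_le0; apply/ler_addgt0Pl => e e0.
rewrite addr0; have [r r0 lr] := h _ (divr_gt0 e0 (ltr0n _ 2)).
rewrite (_ : l - `|l| = (l - r) - (`|l| - `|r|)); last first.
  by rewrite (ger0_norm r0) opprB addrA subrK.
rewrite (le_trans (ler_normB _ _))// (splitr e) lerD//.
by rewrite (le_trans (ler_dist_dist _ _)).
Qed.

Lemma normc_real (x : R) : `|x%:C%C : R[i]| = `|x|%:C%C.
Proof. by rewrite normc_def /= expr0n addr0 sqrtr_sqr. Qed.

(** Real and imaginary parts are 1-Lipschitz, so both converge. The resulting completeness of [R[i]]
    lets inner products and point values be defined as limits. *)
Lemma complex_cauchy_cvg (F : set_system R[i]) : ProperFilter F -> cauchy F -> cvg F.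
Proof.
move=> FF /cauchy_ballP cF.
have proj (g : R[i] -> R) :
    (forall p q, (`|g p - g q|)%:C%C <= `|p - q|) -> cvg (g @ F).
  move=> gle; apply: cauchy_cvg; apply/cauchy_ballP => e e0.
  have e0' : 0 < e%:C%C :> R[i] by rewrite ltcR.
  have [[A B] [/= FA FB] AB] := cF _ e0'.
  exists (g @` A, g @` B) => /=.
    by split; [apply: filterS FA|apply: filterS FB] => p Ap; exists p.
  move=> [_ _] /= [[p Ap <-] [q Bq <-]].
  have := AB (p, q) (conj Ap Bq); rewrite -!ball_normE /= => h.
  by rewrite -ltcR; exact: le_lt_trans (gle _ _) h.
have n0 (z : R[i]) : `|complex.Re z|%:C%C <= `|z|.
  case: z => x y; rewrite normc_def lecR -sqrtr_sqr ler_sqrt ?lerDl ?sqr_ge0//.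
  by rewrite addr_ge0 ?sqr_ge0.
have n1 (z : R[i]) : `|complex.Im z|%:C%C <= `|z|.
  case: z => x y; rewrite normc_def lecR -sqrtr_sqr ler_sqrt ?lerDr ?sqr_ge0//.
  by rewrite addr_ge0 ?sqr_ge0.
have /cvg_ex[/= l1 c1] : cvg (@complex.Re R @ F).
  by apply: proj => -[a b] [c d]; exact: (n0 ((a +i* b)%C - (c +i* d)%C)).
have /cvg_ex[/= l2 c2] : cvg (@complex.Im R @ F).
  by apply: proj => -[a b] [c d]; exact: (n1 ((a +i* b)%C - (c +i* d)%C)).
apply/cvg_ex; exists (l1 +i* l2)%C; apply/cvgrPdist_lt => e e0.
have eR : e = (complex.Re e)%:C%C by rewrite RRe_real// gtr0_real.
have e2 : 0 < complex.Re e / 2 by rewrite divr_gt0//; move: e0; rewrite {1}eR ltcR.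
move/cvgrPdist_lt : c1 => /(_ _ e2) c1; move/cvgrPdist_lt : c2 => /(_ _ e2) c2.
have dec p : (l1 +i* l2)%C - p =
    (l1 - complex.Re p)%:C%C + 'i%C * (l2 - complex.Im p)%:C%C.
  by case: p => x y; simpc.
near=> p; rewrite dec.
rewrite (le_lt_trans (ler_normD _ _))// normrM complexiE normCi mul1r !normc_real eR.
rewrite (splitr (complex.Re e)) rmorphD ltrD// ltcR.
- by near: p; exact: c1.
- by near: p; exact: c2.
Unshelve. all: by end_near. Qed.

Lemma semidefinite_CS (a b x : R[i]) : 0 <= a -> 0 <= b ->
  (forall c : R[i], 0 <= a - c^* * x - c * x^* + `|c| ^+ 2 * b) ->
  `|x| ^+ 2 <= a * b.
Proof.
move=> a0 b0 h; apply/ler_addgt0Pr => e e0.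
have a1 : 0 < a + 1 by rewrite ltr_wpDl.
(* The optimal c would be x / b, but b may vanish; b + d replaces it, and d is small enough that a d
   <= e. *)
pose d := e / (a + 1).
have d0 : 0 < d by rewrite divr_gt0.
have bd : 0 < b + d by rewrite ltr_wpDl.
have dR : (b + d)^* = b + d by apply/CrealP/gtr0_real.
have := h (x / (b + d)).
have -> : a - (x / (b + d))^* * x - x / (b + d) * x^* + `|x / (b + d)| ^+ 2 * b
   = a - `|x| ^+ 2 / (b + d) * (2 - b / (b + d)).
  have nx : `|x| ^+ 2 = x * x^* by rewrite normCK.
  have -> : (x / (b + d))^* = x^* / (b + d) by rewrite rmorphM fmorphV /= dR.
  rewrite normrM exprMn nx normrV ?unitfE ?gt_eqF// (gtr0_norm bd).
  by field; rewrite gt_eqF.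
rewrite subr_ge0 => h1.
have : `|x| ^+ 2 / (b + d) <= a.
  apply: le_trans h1; rewrite ler_peMr ?divr_ge0 ?exprn_ge0 ?(ltW bd)//.
  by rewrite lerBrDr [2]mulr2n lerD2l ler_pdivrMr// mul1r lerDl ltW.
rewrite ler_pdivrMr// mulrDr => h2; apply: le_trans h2 _; rewrite lerD2l.
by rewrite /d mulrCA ler_piMr ?(ltW e0)// ler_pdivrMr// mul1r lerDl.
Qed.

End ComplexNumbers.

HB.instance Definition _ (R : realType) :=
  Uniform_isComplete.Build R[i] (@complex_cauchy_cvg R).

Section InnerProduct.
Variables (R : realType) (V : hilbertType R).
Implicit Types (u v w x y : V) (a : R[i]).

Lemma hdot0l w : hdot 0 w = 0.
Proof. exact: (dot0l (@hdotPl R V)). Qed.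
Lemma hdot0r w : hdot w 0 = 0.
Proof. by rewrite hdotC hdot0l conjC0. Qed.
Lemma hdotDl u v w : hdot (u + v) w = hdot u w + hdot v w.
Proof. exact: (dotDl (@hdotPl R V)). Qed.
Lemma hdotDr u v w : hdot w (u + v) = hdot w u + hdot w v.
Proof. exact: (dotDr (@hdotPl R V) (@hdotC R V)). Qed.
Lemma hdotZl a u w : hdot (a *: u) w = a * hdot u w.
Proof. exact: (dotZl (@hdotPl R V)). Qed.
Lemma hdotZr a u w : hdot w (a *: u) = a^* * hdot w u.
Proof. exact: (dotZr (@hdotPl R V) (@hdotC R V)). Qed.
Lemma hdotBl u v w : hdot (u - v) w = hdot u w - hdot v w.
Proof. exact: (dotBl (@hdotPl R V)). Qed.
Lemma hdotBr u v w : hdot w (u - v) = hdot w u - hdot w v.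
Proof. exact: (dotBr (@hdotPl R V) (@hdotC R V)). Qed.

Lemma hdot_suml I (r : seq I) (F : I -> V) w :
  hdot (\sum_(i <- r) F i) w = \sum_(i <- r) hdot (F i) w.
Proof. by apply: (big_morph (hdot^~ w)) => [u v|]; rewrite ?hdotDl ?hdot0l. Qed.

Lemma hdot_sumr I (r : seq I) (F : I -> V) w :
  hdot w (\sum_(i <- r) F i) = \sum_(i <- r) hdot w (F i).
Proof. by apply: (big_morph (hdot w)) => [u v|]; rewrite ?hdotDr ?hdot0r. Qed.

Lemma hdot_inj u v : (forall w, hdot u w = hdot v w) -> u = v.
Proof.
move=> uv; apply/eqP; rewrite -subr_eq0; apply/eqP/hdot_eq0.
by rewrite hdotBl uv subrr.
Qed.

Lemma ler_hnorm (U W : hilbertType R) (p : U) (q : W) :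
  (`|p| <= `|q|) = (hdot p p <= hdot q q).
Proof. by rewrite !hdotxx ler_sqr ?nnegrE. Qed.

Lemma hdotBB u v : hdot (u - v) (u - v) =
  hdot u u + hdot v v - (hdot u v + hdot v u).
Proof. by rewrite hdotBl !hdotBr; ring. Qed.

Lemma minimal_dist_orth v w :
  (forall a, `|v| <= `|v - a *: w|) -> hdot v w = 0.
Proof.
move=> h; have [->|w0] := eqVneq w 0; first exact: hdot0r.
have ww : 0 < hdot w w by rewrite hdotxx exprn_gt0// normr_gt0.
set a := hdot v w / hdot w w.
have := h a; rewrite ler_hnorm.
have -> : hdot (v - a *: w) (v - a *: w) =
    hdot v v - `|hdot v w| ^+ 2 / hdot w w.
  have sv : (hdot w w)^* = hdot w w by rewrite -hdotC.
  have av : a^* * hdot w w = hdot w v.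
    by rewrite [hdot w v]hdotC -{1}sv -rmorphM /= /a divfK// gt_eqF.
  rewrite hdotBl !hdotBr !hdotZl !hdotZr av subrr subr0.
  by rewrite normCK /a rmorphM /= fmorphV /= sv mulrC mulrA.
rewrite lerBrDr gerDl pmulr_lle0 ?invr_gt0// => h0.
apply/eqP; rewrite -normr_eq0 -sqrf_eq0 eq_le exprn_ge0// andbT.
exact: h0.
Qed.

End InnerProduct.

Section Completeness.
Variables (R : realType).
Local Notation eps n := (n.+1%:R^-1 : R[i]).

Lemma eps_le (n N : nat) : (N <= n)%N -> eps n <= eps N.
Proof. by move=> Nn; rewrite lef_pV2 ?posrE ?ltr0n// ler_nat ltnS. Qed.

Lemma seq_cauchy_cvg (V : completeNormedModType R[i]) (u : nat -> V) (c : R[i]) :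
  (forall n m, `|u n - u m| <= c * (eps n + eps m)) ->
  exists l : V, u @ \oo --> l.
Proof.
move=> h; apply/cvg_ex; apply: cauchy_cvg; apply/cauchy_ballP => e e0.
have c0 : 0 <= c.
  by move: (le_trans (normr_ge0 _) (h 0 0)%N); rewrite pmulr_lge0// addr_gt0.
have [N Ne] := complex_archi (divr_gt0 e0 (mulr_gt0 (ltr0n R[i] 2) (ltr_wpDl c0 ltr01))).
pose A := u @` [set n | (N <= n)%N].
exists (A, A) => /=.
  by split; exists N => // n /= Nn; exists n.
move=> [_ _] /= [[n /= Nn <-] [m /= Nm <-]]; rewrite -ball_normE /=.
rewrite (le_lt_trans (h n m))//.
rewrite (@le_lt_trans _ _ ((c + 1) * (2 * eps N)))//.
  rewrite mulr_natl mulr2n ler_pM ?addr_ge0 ?lerDl//.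
  by rewrite lerD// eps_le.
by rewrite mulrCA mulrA -ltr_pdivlMl ?mulr_gt0 ?ltr_wpDl// mulrC.
Qed.

Lemma small_eq0 (V : normedModType R[i]) (x : V) (c : R[i]) :
  (forall n, `|x| <= c * eps n) -> x = 0.
Proof.
move=> h; apply/eqP; rewrite -normr_le0; apply/ler_addgt0Pl => e e0.
have c0 : 0 <= c by move: (le_trans (normr_ge0 _) (h 0)%N); rewrite invr1 mulr1.
have c1 : 0 < c + 1 by rewrite ltr_wpDl.
have [N Ne] := complex_archi (divr_gt0 e0 c1).
rewrite addr0 (le_trans (h N))// (@le_trans _ _ ((c + 1) * eps N))//.
  by rewrite ler_wpM2r// lerDl.
by rewrite mulrC -ler_pdivlMr// ltW.
Qed.

Lemma cvg_seq_norm (V : completeNormedModType R[i]) (u : nat -> V) (l : V) :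
  u @ \oo --> l -> forall e : R[i], 0 < e ->
  forall N, exists2 n, (N <= n)%N & `|l - u n| < e.
Proof.
move=> /cvgrPdist_lt ul e e0 N; have [M _ h] := ul e e0.
by exists (maxn N M); [exact: leq_maxl|apply: h; rewrite /= leq_maxr].
Qed.

Lemma seq_cauchy_lim (V : completeNormedModType R[i]) (u : nat -> V) (c : R[i]) :
  (forall n m, `|u n - u m| <= c * (eps n + eps m)) ->
  exists l : V, forall n, `|l - u n| <= c * 2 * eps n.
Proof.
move=> h; have [l ul] := seq_cauchy_cvg h; exists l => n.
have c0 : 0 <= c.
  by move: (le_trans (normr_ge0 _) (h 0 0)%N); rewrite pmulr_lge0// addr_gt0.
apply/ler_addgt0Pl => e e0; have [m nm lm] := cvg_seq_norm ul e0 n.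
rewrite -(subrKA (u m)) (le_trans (ler_normD _ _))// lerD ?(ltW lm)//.
rewrite (le_trans (h _ _))// -mulrA ler_wpM2l// mulr_natl mulr2n lerD2r.
exact: eps_le.
Qed.

End Completeness.

Section Projection.
Variables (R : realType) (V : hilbertType R).
Local Notation eps n := (n.+1%:R^-1 : R[i]).

Lemma subspaceZ (A : set V) a u : subspace_pred A -> A u -> A (a *: u).
Proof. by move=> [A0 AP] Au; rewrite -[a *: u]addr0; exact: AP. Qed.

Lemma subspaceD (A : set V) u v : subspace_pred A -> A u -> A v -> A (u + v).
Proof. by move=> [_ AP] Au Av; rewrite -[u]scale1r; exact: AP. Qed.

Lemma projection_ex (W : csubspace V) (x : V) :
  exists p : csub W, forall w : csub W, hdot (x - csub_val p) (csub_val w) = 0.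
Proof.
have Wsub := csub_subspace W.
pose A := [set complex.Re (`|x - w| ^+ 2) | w in csub_set W].
have ReE (w : V) : `|x - w| ^+ 2 = (complex.Re (`|x - w| ^+ 2))%:C%C.
  by rewrite RRe_real// ger0_real// exprn_ge0.
have lbA : has_lbound A.
  by exists 0 => _ [w _ <-]; rewrite -lecR -ReE exprn_ge0.
have hA : has_inf A.
  by split => //; exists (complex.Re (`|x - 0| ^+ 2)), 0 => //; exact: Wsub.1.
pose d : R[i] := (inf A)%:C%C.
have dle w : csub_set W w -> d <= `|x - w| ^+ 2.
  by move=> Ww; rewrite ReE lecR; apply: ge_inf => //; exists w.
have d0 : 0 <= d.
  rewrite ler0c; apply: lb_le_inf; first exact: hA.1.
  by move=> _ [w _ <-]; rewrite -lecR -ReE exprn_ge0.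
(* The tolerance is squared so that the parallelogram law yields a Cauchy rate linear in [eps n]. *)
have wex n : exists2 w, csub_set W w & `|x - w| ^+ 2 <= d + eps n ^+ 2.
  have eR : eps n ^+ 2 = (n.+1%:R^-1 ^+ 2)%:C%C.
    by rewrite rmorphXn fmorphV rmorph_nat.
  have e0 : 0 < (n.+1%:R^-1 ^+ 2 : R) by rewrite exprn_gt0// invr_gt0.
  have [_ [w Ww <-] h] := inf_adherent e0 hA.
  by exists w => //; rewrite ReE eR -rmorphD lecR; exact: ltW.
pose u n := projT1 (cid2 (wex n)).
have Wu n : csub_set W (u n) by rewrite /u; case: cid2.
have ud n : `|x - u n| ^+ 2 <= d + eps n ^+ 2 by rewrite /u; case: cid2.
(* Parallelogram law: the midpoint of u n and u m lies in W, so its squared distance to x is at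
   least d, and the terms in d cancel. *)
have par n m : `|u n - u m| ^+ 2 <= 2 * eps n ^+ 2 + 2 * eps m ^+ 2.
  have Wm : csub_set W (2^-1 *: (u n + u m)).
    by apply: subspaceZ => //; exact: subspaceD.
  have P : `|u n - u m| ^+ 2 = 2 * `|x - u n| ^+ 2 + 2 * `|x - u m| ^+ 2
      - 4 * `|x - 2^-1 *: (u n + u m)| ^+ 2.
    rewrite -!hdotxx; set a := x - u n; set b := x - u m.
    have -> : u n - u m = b - a by rewrite /a /b opprB [RHS]addrC subrKA.
    have -> : x - 2^-1 *: (u n + u m) = 2^-1 *: (a + b).
      have -> : a + b = 2%:R *: x - (u n + u m).
        by rewrite scaler_nat mulr2n opprD addrACA.
      by rewrite scalerBr scalerA mulVf ?scale1r.
    rewrite hdotZl hdotZr fmorphV rmorph_nat hdotBB !hdotDl !hdotDr.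
    by field.
  rewrite P lerBlDr; apply: (le_trans (lerD _ _)).
  - by apply: ler_wpM2l (ud n).
  - by apply: ler_wpM2l (ud m).
  - have := dle _ Wm; rewrite -(ler_pM2l (ltr0n _ 4)) => h.
    rewrite !mulrDr addrACA addrC lerD2l; apply: le_trans h.
    by rewrite le_eqVlt; apply/orP; left; apply/eqP; ring.
have [l ul] : exists l : V, u @ \oo --> l.
  apply: (@seq_cauchy_cvg _ _ _ 2) => n m.
  rewrite -ler_sqr ?nnegrE ?mulr_ge0 ?addr_ge0//.
  apply: (le_trans (par n m)); rewrite -subr_ge0.
  have -> : (2 * (eps n + eps m)) ^+ 2 - (2 * eps n ^+ 2 + 2 * eps m ^+ 2) =
      2 * eps n ^+ 2 + 2 * eps m ^+ 2 + 8 * (eps n * eps m) by ring.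
  by rewrite !addr_ge0 ?mulr_ge0 ?exprn_ge0.
have Wl : csub_set W l.
  have uW : \forall n \near \oo, csub_set W (u n) by apply: nearW.
  exact: (@closed_cvg _ _ \oo _ u _ (@csub_closed _ _ W) uW _ ul).
exists (CSub (mem_set Wl)) => w /=; apply: minimal_dist_orth => a.
have Ww : csub_set W (l + a *: csub_val w).
  rewrite addrC; apply: Wsub.2 => //; exact: set_mem (csub_valP w).
rewrite -addrA -opprD; apply: (@le_trans _ _ (sqrtC d)); last first.
  by rewrite -ler_sqr ?nnegrE ?sqrtC_ge0// sqrtCK dle.
apply/ler_addgt0Pr => e e0.
have e2 : 0 < e / 2 by rewrite divr_gt0.
have [N Ne] := complex_archi e2.
have [n Nn ln] := cvg_seq_norm ul e2 N.
rewrite -(subrK (u n) x) -addrA (le_trans (ler_normD _ _))//.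
rewrite (splitr e) addrA lerD//; last by rewrite distrC ltW.
apply: (@le_trans _ _ (sqrtC d + eps n)).
  rewrite -ler_sqr ?nnegrE ?addr_ge0 ?sqrtC_ge0//.
  apply: (le_trans (ud n)); rewrite sqrrD sqrtCK -addrA lerD2l lerDr.
  by rewrite mulrn_wge0// mulr_ge0 ?sqrtC_ge0.
by rewrite lerD2l (le_trans (eps_le _ Nn))// ltW.
Qed.

End Projection.

(** * Adjoints and inverses *)

Section Operators.
Variables (R : realType).
Implicit Types U V W : hilbertType R.

Lemma bopext U V (S T : 'B(U, V)) : (forall x, S x = T x) -> S = T.
Proof. by move=> ST; apply/val_inj/funext. Qed.

Lemma bopDE U V (S T : 'B(U, V)) x : (S + T) x = S x + T x. Proof. by []. Qed.
Lemma bopBE U V (S T : 'B(U, V)) x : (S - T) x = S x - T x. Proof. by []. Qed.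
Lemma bopZE U V a (T : 'B(U, V)) x : (a *: T) x = a *: T x. Proof. by []. Qed.
Lemma bcompE U V W (S : 'B(V, W)) (T : 'B(U, V)) x : (S \oB T) x = S (T x).
Proof. by []. Qed.

Lemma bop_sub U V (T : 'B(U, V)) x y : T (x - y) = T x - T y.
Proof. exact: linearB. Qed.
Lemma bop_add U V (T : 'B(U, V)) x y : T (x + y) = T x + T y.
Proof. exact: linearD. Qed.
Lemma bop_scale U V (T : 'B(U, V)) a x : T (a *: x) = a *: T x.
Proof. exact: linearZ. Qed.
Lemma bop_zero U V (T : 'B(U, V)) : T 0 = 0.
Proof. exact: linear0. Qed.

Lemma hdot_injr V (u v : V) : (forall w, hdot w u = hdot w v) -> u = v.
Proof. by move=> uv; apply: hdot_inj => w; rewrite hdotC uv -hdotC. Qed.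

Lemma bop_bounded U V (T : 'B(U, V)) :
  exists2 M : R[i], 0 <= M & forall x, `|T x| <= M * `|x|.
Proof.
have /cvgrPdist_lt/(_ 1 ltr01) := @bop_continuous _ _ _ T 0.
move=> /nbhs_ballP[d /= d0 dT].
exists (2 / d); first by rewrite divr_ge0// ltW.
move=> x; have [->|x0] := eqVneq x 0; first by rewrite linear0 !normr0 mulr0.
have nx : 0 < `|x| by rewrite normr_gt0.
have := dT ((d / 2 / `|x|) *: x); rewrite -ball_normE /= sub0r normrN normrZ.
have -> : `|d / 2 / `|x| | = d / 2 / `|x| by rewrite ger0_norm// !divr_ge0// ltW.
rewrite divfK ?gt_eqF// ltr_pdivrMr// ltr_pMr// ltr1n => /(_ isT).
rewrite linear0 sub0r normrN linearZ normrZ.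
have -> : `|d / 2 / `|x| | = d / 2 / `|x| by rewrite ger0_norm// !divr_ge0// ltW.
move=> /ltW; rewrite -ler_pdivlMl ?divr_gt0// mulr1 !invf_div mulrC => h.
by apply: le_trans h _; rewrite mulrC.
Qed.

Lemma linear_subE U V (f : U -> V) : linear f -> forall x y, f (x - y) = f x - f y.
Proof. by move=> lf x y; rewrite [x - y]addrC -scaleN1r lf addrC scaleN1r. Qed.

(** The two sides differ by a vector of W that is also a combination of vectors orthogonal to W,
    hence orthogonal to itself. *)
Lemma hproj_subproof U (W : csubspace U) :
  linear (fun x => projT1 (cid (projection_ex W x))).
Proof.
move=> a u v; apply/val_inj => /=; apply/eqP; rewrite -subr_eq0.
case: cid => p hp; case: cid => q hq; case: cid => r hr /=.
have -> : csub_val p - (a *: csub_val q + csub_val r) = csub_val (p - (a *: q + r)) by [].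
set w := p - _; apply/eqP; apply: hdot_eq0.
rewrite {1}(_ : csub_val w = a *: (u - csub_val q) + (v - csub_val r) -
  (a *: u + v - csub_val p)); last first.
  by rewrite scalerBr [X in _ = X - _]addrACA -opprD opprB [RHS]addrC subrKA.
by rewrite hdotBl hp hdotPl hq hr mulr0 addr0 subr0.
Qed.

Lemma norm_proj_le U (u p : U) : hdot (u - p) p = 0 -> `|p| <= `|u|.
Proof.
rewrite ler_hnorm -{2 3}(subrK p u); move: (u - p) => v h.
rewrite hdotDl !hdotDr h.
by rewrite [hdot p v]hdotC h conjC0 addr0 add0r lerDr hdot_ge0.
Qed.

Lemma hproj_continuous U (W : csubspace U) :
  continuous (fun x => projT1 (cid (projection_ex W x))).
Proof.
apply: (lipschitz_continuous ler01) => x y; rewrite mul1r.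
rewrite -(linear_subE (@hproj_subproof U W)).
by case: cid => p hp /=; rewrite csub_normE norm_proj_le ?hp.
Qed.

Definition hproj U (W : csubspace U) : 'B(U, csub W) :=
  mkbop (@hproj_subproof U W) (@hproj_continuous U W).

Lemma hprojP U (W : csubspace U) x (w : csub W) :
  hdot (x - csub_val (hproj W x)) (csub_val w) = 0.
Proof. by rewrite /hproj /=; case: cid => p hp /=. Qed.

Lemma hproj_eq U (W : csubspace U) x (p : csub W) :
  (forall w : csub W, hdot (x - csub_val p) (csub_val w) = 0) -> hproj W x = p.
Proof.
move=> hp; apply: hdot_inj => w; rewrite /hdot /= /csub_dot.
apply/eqP; rewrite -subr_eq0 -hdotBl.
rewrite (_ : val _ - val _ = (x - csub_val p) - (x - csub_val (hproj W x))).
  by rewrite hdotBl hp hprojP subrr.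
by rewrite opprB [RHS]addrC subrKA.
Qed.

Lemma csub_mem U (W : csubspace U) (w : csub W) : csub_set W (csub_val w).
Proof. exact: set_mem (csub_valP w). Qed.

Lemma csub_lift U (W : csubspace U) x : csub_set W x ->
  exists w : csub W, csub_val w = x.
Proof. by move=> Wx; exists (CSub (mem_set Wx)). Qed.

Lemma hproj_id U (W : csubspace U) (w : csub W) : hproj W (csub_val w) = w.
Proof. by apply: hproj_eq => v; rewrite subrr hdot0l. Qed.

Lemma csub_full U (W : csubspace U) :
  (forall x, (forall w : csub W, hdot x (csub_val w) = 0) -> x = 0) ->
  forall x, csub_set W x.
Proof.
move=> h x; rewrite -(subrK (csub_val (hproj W x)) x) (h (x - _)) ?add0r.
  exact: csub_mem.
exact: hprojP.
Qed.

Lemma riesz_ex U V (T : 'B(U, V)) y : exists b, forall x, hdot (T x) y = hdot x b.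
Proof.
(* Kernel of the functional x |-> <T x, y>, closed as the preimage under T of the complement of y.
   The representing vector is a multiple of the component w of v orthogonal to it. *)
pose Ker := CSubspace (@bop_preimage_subspace _ _ _ T (Defs.ortho [set y]))
  (@bop_preimage_closed _ _ _ T (Defs.ortho [set y])).
have [h|] := pselect (forall x, hdot (T x) y = 0).
  by exists 0 => x; rewrite h hdot0r.
move=> /existsNP[v /eqP v0].
pose w := v - csub_val (hproj Ker v).
have wK x : hdot (T x) y = 0 -> hdot x w = 0.
  move=> Tx; have Kx : csub_set Ker x by move=> _ ->.
  have [k <-] := csub_lift Kx.
  by rewrite hdotC hprojP conjC0.
have w0 : hdot (T w) y != 0.
  rewrite linearB hdotBl (_ : hdot (T (csub_val _)) y = 0) ?subr0//.
  exact: (csub_mem (hproj Ker v)).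
have ww : hdot w w != 0.
  by apply: contra w0 => /eqP/hdot_eq0 ->; rewrite linear0 hdot0l.
exists (((hdot (T w) y) / hdot w w)^* *: w) => x.
rewrite hdotZr conjCK mulrAC -mulrA.
(* This combination lies in the kernel, hence is orthogonal to w; solving for <T x, y> explains the
   coefficient of w above. *)
have : hdot (hdot (T x) y *: w - hdot (T w) y *: x) w = 0.
  by apply: wK; rewrite bop_sub !bop_scale hdotBl !hdotZl mulrC subrr.
rewrite hdotBl !hdotZl => /eqP; rewrite subr_eq0 => /eqP h.
by rewrite mulrA -h mulfK.
Qed.

Lemma adj_ex U V (T : 'B(U, V)) :
  exists S : 'B(V, U), forall x y, hdot (T x) y = hdot x (S y).
Proof.
pose f y := projT1 (cid (riesz_ex T y)).
have fP x y : hdot (T x) y = hdot x (f y) by rewrite /f; case: cid.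
have lf : linear f.
  move=> a u v; apply: hdot_injr => w.
  by rewrite -fP !hdotDr !hdotZr !fP.
have [M M0 TM] := bop_bounded T.
have cf : continuous f.
  apply: (lipschitz_continuous M0) => x y.
  rewrite -(linear_subE lf).
  have [->|n0] := eqVneq (f (x - y)) 0; first by rewrite normr0 mulr_ge0.
  rewrite -(ler_pM2l (_ : 0 < `|f (x - y)|)) ?normr_gt0// -expr2 -hdotxx -fP.
  rewrite -[leLHS]ger0_norm; last by rewrite fP hdot_ge0.
  apply: le_trans (hdot_CS _ _) _.
  by rewrite mulrA ler_wpM2r// mulrC TM.
by exists (mkbop lf cf) => x y; rewrite fP.
Qed.

Lemma adjP U V (T : 'B(U, V)) x y : hdot (T x) y = hdot x (T^† y).
Proof. exact: (xgetPex 0 (adj_ex T)). Qed.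

Lemma adjPr U V (T : 'B(U, V)) x y : hdot (T^† x) y = hdot x (T y).
Proof. by rewrite hdotC -adjP -hdotC. Qed.

Lemma adj_eq U V (T : 'B(U, V)) (S : 'B(V, U)) :
  (forall x y, hdot (T x) y = hdot x (S y)) -> T^† = S.
Proof.
by move=> h; apply: bopext => y; apply: hdot_injr => x; rewrite -adjP h.
Qed.

Lemma adjK U V (T : 'B(U, V)) : T^†^† = T.
Proof. by apply: adj_eq => x y; rewrite adjPr. Qed.

Lemma adj_comp U V W (S : 'B(V, W)) (T : 'B(U, V)) : (S \oB T)^† = T^† \oB S^†.
Proof. by apply: adj_eq => x y; rewrite /= !adjP. Qed.

Lemma hsumE U V (p q : hsum U V) : hdot p q = hdot p.1 q.1 + hdot p.2 q.2.
Proof. by []. Qed.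

Lemma adj_bfst U V : (bfst U V)^† = binl U V.
Proof.
by apply: adj_eq => x y; rewrite [RHS]hsumE [X in _ + X]hdot0r addr0.
Qed.

Lemma adj_bsnd U V : (bsnd U V)^† = binr U V.
Proof.
by apply: adj_eq => x y; rewrite [RHS]hsumE [X in X + _]hdot0r add0r.
Qed.

Lemma adj_binl U V : (binl U V)^† = bfst U V.
Proof. by rewrite -adj_bfst adjK. Qed.

Lemma adj_binr U V : (binr U V)^† = bsnd U V.
Proof. by rewrite -adj_bsnd adjK. Qed.

Lemma csubE U (W : csubspace U) (p q : csub W) :
  hdot p q = hdot (csub_val p) (csub_val q).
Proof. by []. Qed.

Lemma adj_bincl U (W : csubspace U) : (bincl W)^† = hproj W.
Proof.
apply: adj_eq => x y; rewrite csubE hdotC [RHS]hdotC -[hdot _ _]subr0.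
by rewrite -(hprojP y x) -hdotBl opprB addrC subrK.
Qed.

Lemma norm_adj U V (T : 'B(U, V)) (c : R[i]) : 0 <= c ->
  (forall x, `|T x| <= c * `|x|) -> forall y, `|T^† y| <= c * `|y|.
Proof.
move=> c0 h y; have [->|n0] := eqVneq (T^† y) 0; first by rewrite normr0 mulr_ge0.
rewrite -(ler_pM2l (_ : 0 < `|T^† y|)) ?normr_gt0// -expr2 -hdotxx -adjP.
rewrite -[leLHS]ger0_norm; last by rewrite adjP hdot_ge0.
apply: le_trans (hdot_CS _ _) _.
by rewrite mulrA ler_wpM2r// mulrC h.
Qed.

Lemma norm_adj1 U V (T : 'B(U, V)) : 
  (forall x, `|T x| <= `|x|) -> forall y, `|T^† y| <= `|y|.
Proof.
by move=> h y; rewrite -[leRHS]mul1r; apply: norm_adj => // x; rewrite mul1r.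
Qed.

Lemma binvP U V (T : 'B(U, V)) : binvertible T -> is_binv T (binv T).
Proof. by move=> h; exact: (xgetPex 0 h). Qed.

Local Notation eps n := (n.+1%:R^-1 : R[i]).

(* The range of bid V - T is closed because this operator is bounded below, and its
   orthogonal complement is 0 because Re <(1 - T) x, x> >= (1 - c) |x|^2. *)
Lemma binvertible_sub1 V (T : 'B(V, V)) (c : R[i]) : c < 1 ->
  (forall x, `|T x| <= c * `|x|) -> binvertible (bid V - T).
Proof.
move=> c1 Tc; pose A : 'B(V, V) := bid V - T.
have d0 : 0 < 1 - c by rewrite subr_gt0.
have lb x : (1 - c) * `|x| <= `|A x|.
  rewrite mulrBl mul1r lerBlDr; apply: le_trans (lerD (lexx _) (Tc x)).
  by rewrite -{1}(subrK (T x) x) (le_trans (ler_normD _ _)).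
have lb' x : `|x| <= (1 - c)^-1 * `|A x| by rewrite ler_pdivlMl.
have Rsub : subspace_pred (range A).
  split; first by exists 0 => //; rewrite linear0.
  by move=> a _ _ [x _ <-] [y _ <-]; exists (a *: x + y) => //; rewrite linearP.
have Rcl : closed (range A).
  move=> y cy.
  have xex n : exists x, `|y - A x| < eps n.
    have e0 : 0 < eps n by rewrite invr_gt0.
    have [_ [[x _ <-]]] := cy _ (nbhsx_ballx y _ e0).
    by rewrite -ball_normE /= => yx; exists x.
  pose u n := projT1 (cid (xex n)).
  have uP n : `|y - A (u n)| < eps n by rewrite /u; case: cid.
  have [l ul] : exists l : V, u @ \oo --> l.
    apply: (@seq_cauchy_cvg _ _ _ (1 - c)^-1) => n m.
    apply: le_trans (lb' _) _; rewrite ler_wpM2l ?invr_ge0 ?(ltW d0)//.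
    rewrite bop_sub -(subrKA y) (le_trans (ler_normD _ _))// lerD//.
      by rewrite distrC ltW.
    by rewrite ltW.
  exists l => //; apply/eqP; rewrite -subr_eq0 -normr_le0.
  apply/ler_addgt0Pl => e e0; rewrite addr0.
  have [M M0 AM] := bop_bounded A.
  have e2 : 0 < e / 2 by rewrite divr_gt0.
  have [N Ne] := complex_archi e2.
  have e3 : 0 < e / 2 / (M + 1) by rewrite divr_gt0// ltr_wpDl.
  have [n Nn ln] := cvg_seq_norm ul e3 N.
  rewrite -(subrKA (A (u n))) (le_trans (ler_normD _ _))// (splitr e) lerD//.
    rewrite -bop_sub (le_trans (AM _))//.
    apply: (@le_trans _ _ ((M + 1) * (e / 2 / (M + 1)))).
      by apply: ler_pM => //; [rewrite lerDl|exact: ltW].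
    by rewrite mulrC divfK// gt_eqF// ltr_wpDl.
  by rewrite distrC (le_trans (ltW (uP n)))// (le_trans (eps_le _ Nn))// ltW.
have surj y : exists x, A x = y.
  suff : csub_set (CSubspace Rsub Rcl) y by move=> [x _ <-]; exists x.
  apply: csub_full => x hx; apply/eqP; rewrite -normr_le0.
  have Rx : csub_set (CSubspace Rsub Rcl) (A x) by exists x.
  have [w wE] := csub_lift Rx.
  have := hx w; rewrite wE /A bopBE hdotBr => /eqP; rewrite subr_eq0 => /eqP xx.
  have [//|n0] := eqVneq `|x| 0; first by move=> ->.
  have nx : 0 < `|x| by rewrite lt_neqAle eq_sym n0 /=.
  have : `|hdot x x| <= c * `|x| * `|x|.
    rewrite (xx : hdot x x = _) (le_trans (hdot_CS _ _))// mulrC.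
    by rewrite ler_wpM2r.
  rewrite hdotxx ger0_norm ?exprn_ge0// expr2 ler_pM2r// -subr_le0.
  by rewrite -{1}[`|x|]mul1r -mulrBl pmulr_rle0.
pose f y := projT1 (cid (surj y)).
have fK y : A (f y) = y by rewrite /f; case: cid.
have inj x y : A x = A y -> x = y.
  move=> xy; apply/eqP; rewrite -subr_eq0 -normr_le0.
  by apply: le_trans (lb' _) _; rewrite bop_sub xy subrr normr0 mulr0.
have lf : linear f by move=> a u v; apply: inj; rewrite bop_add bop_scale !fK.
have cf : continuous f.
  apply: (@lipschitz_continuous _ _ _ _ (1 - c)^-1); first by rewrite invr_ge0 ltW.
  by move=> x y; apply: le_trans (lb' _) _; rewrite bop_sub !fK.
exists (mkbop lf cf); split; apply: bopext => x; last exact: fK.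
by apply: inj; exact: fK.
Qed.

End Operators.

Section Spans.
Variables (R : realType) (V : hilbertType R).

Lemma cspan_orth (S : set V) x : (forall s, S s -> hdot x s = 0) ->
  forall w, csub_set (cspan S) w -> hdot x w = 0.
Proof.
move=> h w /(@cspan_min _ _ _ (Defs.ortho [set x])) wx.
rewrite hdotC wx ?conjC0// => s Ss _ ->.
by rewrite hdotC h// conjC0.
Qed.

Lemma csub_fullP (S : set V) (W : csubspace V) :
  csub_set W `<=` csub_set (cspan S) ->
  forall w : csub W, (forall v, S v -> hdot (csub_val w) v = 0) -> w = 0.
Proof.
move=> WS w h; apply: hdot_eq0; rewrite csubE; apply: (cspan_orth h).
by apply: WS; exact: csub_mem.
Qed.

End Spans.

(** * Partial isometries *)

Section PartialIsometry.
Variables (R : realType) (A B : hilbertType R) (I : Type) (p : I -> A) (q : I -> B).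
Hypothesis gram : forall i j, hdot (p i) (p j) = hdot (q i) (q j).

Let gens : set (hsum A B) := [set w | exists i, w = (p i, q i)].
Let P : 'B(hsum A B, hsum A B) := bincl (cspan gens) \oB hproj (cspan gens).

Let P_adj : P^† = P.
Proof. by rewrite adj_comp adj_bincl -{1}adj_bincl adjK. Qed.

(** By [gram] the vector (p i, - q i) is orthogonal to every generator of the graph, hence to its
    closed span. *)
Let isoG i (g : hsum A B) : csub_set (cspan gens) g -> hdot g.1 (p i) = hdot g.2 (q i).
Proof.
move=> Gg; apply/eqP; rewrite -subr_eq0.
have : hdot ((p i, - q i) : hsum A B) g = 0.
  apply: cspan_orth Gg => _ [j ->]; rewrite hsumE /=.
  by rewrite -scaleN1r hdotZl mulN1r gram subrr.
rewrite hsumE /= hdotC [X in _ + X]hdotC -rmorphD /= -scaleN1r hdotZr.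
by rewrite rmorphN1 mulN1r => /eqP; rewrite conjC_eq0.
Qed.

Let isoGG (g h : hsum A B) : csub_set (cspan gens) g -> csub_set (cspan gens) h ->
  hdot g.1 h.1 = hdot g.2 h.2.
Proof.
move=> Gg Gh; apply/eqP; rewrite -subr_eq0.
have : hdot ((g.1, - g.2) : hsum A B) h = 0.
  apply: cspan_orth Gh => _ [j ->]; rewrite hsumE /=.
  by rewrite -scaleN1r hdotZl mulN1r isoG// subrr.
by rewrite hsumE /= -scaleN1r hdotZl mulN1r => ->.
Qed.

(* Since the graph G of p i |-> q i is isometric, the orthogonal projection of
   (a, 0) on G is (a', b') where 2 a' is the projection of a on the span of the
   p i, so that 2 b' is the image of a. *)
Lemma partial_isometry_ex : exists T : 'B(A, B),
  [/\ forall i, T (p i) = q i, forall i, T^† (q i) = p i & forall x, `|T x| <= `|x|].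
Proof.
pose T := 2%:R *: (bsnd A B \oB P \oB binl A B).
(* As P is self-adjoint, exchanging the two coordinates gives the adjoint. *)
pose T' := 2%:R *: (bfst A B \oB P \oB binr A B).
have Tadj : T^† = T'.
  apply: adj_eq => x y; rewrite !bopZE hdotZl hdotZr rmorph_nat; congr (_ * _).
  by rewrite adjP 2!adj_comp P_adj adj_bsnd adj_binl.
have Pp i : P (p i, 0) = 2^-1 *: ((p i, q i) : hsum A B).
  have Gg : csub_set (cspan gens) (2^-1 *: ((p i, q i) : hsum A B)).
    by apply: (subspaceZ _ (csub_subspace (cspan gens))); apply: sub_cspan; exists i.
  have [g gE] := csub_lift Gg.
  rewrite -gE; congr csub_val; apply: hproj_eq => w.
  have Gw := csub_mem w.
  rewrite gE [LHS](_ : _ = hdot (p i - 2^-1 *: p i) (csub_val w).1 +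
    hdot (0 - 2^-1 *: q i) (csub_val w).2)// !hdotBl hdot0l !hdotZl.
  by rewrite [hdot (q i) _]hdotC -isoG// -hdotC; field.
have Pq i : P (0, q i) = 2^-1 *: ((p i, q i) : hsum A B).
  have Gg : csub_set (cspan gens) (2^-1 *: ((p i, q i) : hsum A B)).
    by apply: (subspaceZ _ (csub_subspace (cspan gens))); apply: sub_cspan; exists i.
  have [g gE] := csub_lift Gg.
  rewrite -gE; congr csub_val; apply: hproj_eq => w.
  have Gw := csub_mem w.
  rewrite gE [LHS](_ : _ = hdot (0 - 2^-1 *: p i) (csub_val w).1 +
    hdot (q i - 2^-1 *: q i) (csub_val w).2)// !hdotBl hdot0l !hdotZl.
  by rewrite [hdot (q i) _]hdotC -isoG// -hdotC; field.
exists T; split => [i|i|x].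
- have -> : T (p i) = 2%:R *: (P (p i, 0)).2 by [].
  by rewrite Pp -[_.2]/(2^-1 *: q i) scalerA mulfV ?scale1r.
- have -> : T^† (q i) = 2%:R *: (P (0, q i)).1 by rewrite Tadj.
  by rewrite Pq -[_.1]/(2^-1 *: p i) scalerA mulfV ?scale1r.
pose g := P (x, 0).
have Gg : csub_set (cspan gens) g by exact: csub_mem.
have Tx : T x = 2%:R *: g.2 by [].
(* Because |g.1| = |g.2|, orthogonality of (x, 0) - g to g reads <x, g.1> = 2 |g.1|^2. So 2 g.1 is
   orthogonal to x - 2 g.1, and |T x| = |2 g.2| = |2 g.1| <= |x|. *)
have gn : hdot (x - 2%:R *: g.1) (2%:R *: g.1) = 0.
  have : hdot (x - g.1) g.1 + hdot (0 - g.2) g.2 = 0.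
    exact: (@hprojP _ _ _ ((x, 0) : hsum A B) (hproj (cspan gens) _)).
  rewrite !hdotBl hdot0l -(isoGG Gg Gg) sub0r => h.
  rewrite !hdotZr !hdotZl -mulrBr.
  by rewrite -[RHS](mulr0 (2%:R^*)) -h; ring.
rewrite Tx ler_hnorm hdotZl hdotZr -(isoGG Gg Gg) -hdotZr -hdotZl -ler_hnorm.
exact: norm_proj_le.
Qed.

End PartialIsometry.

(** * The Hilbert space of a positive kernel *)

Section KernelSums.
Variables (R : realType) (P : Type).
Implicit Types (s t : seq (R[i] * P)) (g h : P -> R[i]).
Local Notation eps n := (n.+1%:R^-1 : R[i]).

(** For g in the future Hilbert space this is the inner product of g with [ksum t], see
    [rkhs_dot_sum]; it makes sense for every function g, which allows distances to be measured
    before the space exists. *)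
Definition sesq g t : R[i] := \sum_(b <- t) b.1^* * g b.2.
Definition scale_seq (a : R[i]) t := [seq (a * b.1, b.2) | b <- t].

Lemma sesq_cat g s t : sesq g (s ++ t) = sesq g s + sesq g t.
Proof. by rewrite /sesq big_cat. Qed.

Lemma sesq_scale g a t : sesq g (scale_seq a t) = a^* * sesq g t.
Proof.
rewrite /sesq big_map mulr_sumr; apply: eq_bigr => b _ /=.
by rewrite rmorphM mulrA.
Qed.

Lemma sesqP a g h t : sesq (a *: g + h) t = a * sesq g t + sesq h t.
Proof.
rewrite /sesq mulr_sumr -big_split; apply: eq_bigr => b _ /=.
rewrite -[(a *: g + h) b.2]/(a * g b.2 + h b.2) mulrDr; congr (_ + _).
by rewrite mulrCA.
Qed.

Lemma sesqB g h t : sesq (g - h) t = sesq g t - sesq h t.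
Proof. by rewrite addrC -scaleN1r sesqP mulN1r addrC. Qed.

Lemma sesq1 g p : sesq g [:: (1, p)] = g p.
Proof. by rewrite /sesq big_seq1 conjC1 mul1r. Qed.

Lemma sesq0 t : sesq 0 t = 0.
Proof. by rewrite /sesq big1// => b _; rewrite mulr0. Qed.

Record psd_kernel := PsdKernel {
  psd_fun :> P -> P -> R[i] ;
  psd_ge0 : forall s : seq (R[i] * P),
    0 <= \sum_(a <- s) \sum_(b <- s) a.1 * b.1^* * psd_fun a.2 b.2 }.

Variable k : psd_kernel.

Definition ksum s : P -> R[i] := fun p => \sum_(a <- s) a.1 * k a.2 p.

Lemma sesq_ksum s t : sesq (ksum s) t =
  \sum_(a <- s) \sum_(b <- t) a.1 * b.1^* * k a.2 b.2.
Proof.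
rewrite exchange_big; apply: eq_bigr => b _; rewrite /ksum mulr_sumr.
by apply: eq_bigr => a _; rewrite mulrA [b.1^* * _]mulrC.
Qed.

Lemma ksum_cat s t : ksum (s ++ t) = ksum s + ksum t.
Proof. by apply/funext => p; rewrite /ksum big_cat. Qed.

Lemma ksum_scale a s : ksum (scale_seq a s) = a *: ksum s.
Proof.
apply/funext => p; rewrite -[RHS]/(a * _) /ksum big_map mulr_sumr.
by apply: eq_bigr => b _; rewrite mulrA.
Qed.

(** Polarisation: the form is nonnegative, hence real, at the coefficient vectors (1, 1) and (i, 1).
    The two resulting equations determine k p q. *)
Lemma psd_herm p q : k p q = (k q p)^*.
Proof.
have kpp x : 0 <= k x x.
  by have := psd_ge0 k [:: (1, x)]; rewrite !big_seq1 conjC1 !mul1r.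
have h1 := psd_ge0 k [:: (1, p); (1, q)].
have h2 := psd_ge0 k [:: ('i, p); (1, q)].
rewrite !big_cons !big_nil /= in h1 h2.
have /CrealP r1 := ger0_real h1; have /CrealP r2 := ger0_real h2.
have /CrealP rp := ger0_real (kpp p); have /CrealP rq := ger0_real (kpp q).
rewrite !(rmorphD, rmorphM, conjC1, conjCi, rmorph0, conjCK, rmorphN) /= rp rq in r1.
rewrite !(rmorphD, rmorphM, conjC1, conjCi, rmorph0, conjCK, rmorphN) /= in r2.
rewrite rp rq !conjCi in r2.
have e1 : k p q + k q p = (k p q)^* + (k q p)^*.
  apply/eqP; rewrite -subr_eq0 -oppr_eq0; apply/eqP.
  by move/eqP: r1; rewrite -subr_eq0 => /eqP r1; rewrite -[RHS]r1; ring.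
have e2 : k p q - k q p = (k q p)^* - (k p q)^*.
  apply: (mulfI (neq0Ci R[i])).
  apply/eqP; rewrite -subr_eq0 -oppr_eq0; apply/eqP.
  by move/eqP: r2; rewrite -subr_eq0 => /eqP r2; rewrite -[RHS]r2; ring.
have : (k p q + k q p) + (k p q - k q p) =
    ((k p q)^* + (k q p)^*) + ((k q p)^* - (k p q)^*) by rewrite e1 e2.
rewrite (_ : _ + (k p q - k q p) = 2 * k p q); last by ring.
rewrite (_ : _ + (_ - (k p q)^*) = 2 * (k q p)^*); last by ring.
by apply: mulfI.
Qed.

Lemma sesq_ksumC s t : sesq (ksum s) t = (sesq (ksum t) s)^*.
Proof.
rewrite !sesq_ksum rmorph_sum exchange_big; apply: eq_bigr => a _ /=.
rewrite rmorph_sum; apply: eq_bigr => b _ /=.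
by rewrite psd_herm !rmorphM /= conjCK [b.1 * _]mulrC.
Qed.

Definition kq s := sesq (ksum s) s.

Lemma kq_ge0 s : 0 <= kq s.
Proof. by rewrite /kq sesq_ksum psd_ge0. Qed.

Definition knorm s := sqrtC (kq s).

Lemma knorm_ge0 s : 0 <= knorm s.
Proof. by rewrite sqrtC_ge0 kq_ge0. Qed.

Lemma kCS s t : `|sesq (ksum s) t| <= knorm s * knorm t.
Proof.
rewrite -ler_sqr ?nnegrE ?mulr_ge0 ?knorm_ge0// exprMn !sqrtCK.
apply: semidefinite_CS; rewrite ?kq_ge0// => c.
have := kq_ge0 (s ++ scale_seq (- c) t).
rewrite /kq ksum_cat ksum_scale sesq_cat !sesq_scale.
have addE (g h : P -> R[i]) r : sesq (g + h) r = sesq g r + sesq h r.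
  by have := sesqP 1 g h r; rewrite scale1r mul1r.
have scE (g : P -> R[i]) a r : sesq (a *: g) r = a * sesq g r.
  by have := sesqP a g 0 r; rewrite addr0 sesq0 addr0.
rewrite !addE !scE rmorphN [sesq (ksum t) s]sesq_ksumC.
congr (0 <= _); rewrite normCK; ring.
Qed.

Definition sdiff s t := s ++ scale_seq (-1) t.

Lemma sesq_sdiff g s t : sesq g (sdiff s t) = sesq g s - sesq g t.
Proof. by rewrite sesq_cat sesq_scale rmorphN1 mulN1r. Qed.

Lemma ksum_sdiff s t : ksum (sdiff s t) = ksum s - ksum t.
Proof. by rewrite ksum_cat ksum_scale scaleN1r. Qed.

Lemma knorm_le s (e : R[i]) : 0 <= e ->
  (forall t, `|sesq (ksum s) t| <= e * knorm t) -> knorm s <= e.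
Proof.
move=> e0 h; have [->//|n0] := eqVneq (knorm s) 0.
have np : 0 < knorm s by rewrite lt_neqAle eq_sym n0 knorm_ge0.
by rewrite -(ler_pM2r np) -expr2 sqrtCK -[kq s]ger0_norm ?kq_ge0// h.
Qed.

(* The distance from g to ksum s in the dual norm is at most e. *)
Definition kapprox g s (e : R[i]) :=
  forall t, `|sesq g t - sesq (ksum s) t| <= e * knorm t.

Lemma kapprox_dist g s t e d : 0 <= e -> 0 <= d -> kapprox g s e -> kapprox g t d ->
  knorm (sdiff s t) <= e + d.
Proof.
move=> e0 d0 gs gt; apply: knorm_le; first exact: addr_ge0.
move=> r; rewrite ksum_sdiff sesqB -(subrKA (sesq g r)) mulrDl.
by rewrite (le_trans (ler_normD _ _))// lerD ?gt// distrC gs.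
Qed.

(* The completion is realised inside the functions P -> R[i], so that no quotient
   has to be taken: its elements are the limits of the ksum s in the dual norm. *)
Definition rkhs_pred : {pred P -> R[i]} := fun g =>
  `[< forall n, exists s, kapprox g s (eps n) >].

End KernelSums.

Record rkhs (R : realType) (P : Type) (k : psd_kernel R P) := Rkhs {
  rkhs_fun :> P -> R[i] ;
  rkhs_funP : rkhs_fun \in rkhs_pred k }.

Section Rkhs.
Variables (R : realType) (P : Type) (k : psd_kernel R P).
Local Notation eps n := (n.+1%:R^-1 : R[i]).
Local Notation H := (rkhs k).

Lemma rkhs_submod : GRing.subsemimod_closed (rkhs_pred k).
Proof.
have lin a g h : g \in rkhs_pred k -> h \in rkhs_pred k -> a *: g + h \in rkhs_pred k.
  move=> /asboolP gP /asboolP hP; apply/asboolP => n.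
  have e0 : 0 < eps n / (`|a| + 1) by rewrite divr_gt0 ?invr_gt0// ltr_wpDl.
  have [N Ne] := complex_archi (divr_gt0 e0 (ltr0n _ 2)).
  have [s gs] := gP N; have [t ht] := hP N.
  exists (scale_seq a s ++ t) => r; rewrite sesqP ksum_cat ksum_scale sesqP.
  rewrite opprD addrACA -mulrBr (le_trans (ler_normD _ _))// normrM.
  apply: (@le_trans _ _ ((`|a| * eps N + eps N) * knorm k r)).
    by rewrite mulrDl -mulrA lerD ?ler_wpM2l.
  rewrite ler_wpM2r ?knorm_ge0// -[X in _ + X]mul1r -mulrDl mulrC.
  rewrite -ler_pdivlMr ?ltr_wpDl// (le_trans (ltW Ne))//.
  by rewrite ler_pdivrMr// ler_peMr ?ler1n// ltW.
have z : 0 \in rkhs_pred k.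
  apply/asboolP => n; exists [::] => t.
  have -> : ksum k [::] = 0 by apply/funext => p; rewrite /ksum big_nil.
  by rewrite subrr normr0 mulr_ge0 ?knorm_ge0.
split; first by split => // g h gP hP; rewrite -[g]scale1r; exact: lin.
by move=> a g gP; rewrite -[a *: g]addr0; exact: lin.
Qed.

HB.instance Definition _ := [isSub of H for @rkhs_fun R P k].
HB.instance Definition _ := [Choice of H by <:].
HB.instance Definition _ :=
  GRing.isSubmodClosed.Build R[i] (P -> R[i]) (rkhs_pred k) rkhs_submod.
HB.instance Definition _ := [SubChoice_isSubLmodule of H by <:].

Implicit Types (g h : H).

Lemma rkhs_approx_ex g n : exists s, kapprox k g s (eps n).
Proof. by have /asboolP := rkhs_funP g. Qed.

Definition kapp g n := projT1 (cid (rkhs_approx_ex g n)).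

Lemma kappP g n : kapprox k g (kapp g n) (eps n).
Proof. by rewrite /kapp; case: cid. Qed.

Lemma eps_ge0 n : 0 <= eps n. Proof. by rewrite invr_ge0. Qed.

Lemma sesq_bound_ex g : exists M : R[i], 0 <= M /\ forall t, `|sesq g t| <= M * knorm k t.
Proof.
exists (1 + knorm k (kapp g 0)); split; first by rewrite addr_ge0 ?knorm_ge0.
move=> t; rewrite -(subrK (sesq (ksum k (kapp g 0)) t) (sesq g t)) mulrDl.
rewrite (le_trans (ler_normD _ _))// lerD ?kCS//.
by have := kappP g 0 t; rewrite invr1.
Qed.

Definition kbound g := projT1 (cid (sesq_bound_ex g)).

Lemma kbound_ge0 g : 0 <= kbound g.
Proof. by rewrite /kbound; case: cid => M []. Qed.

Lemma kboundP g t : `|sesq g t| <= kbound g * knorm k t.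
Proof. by rewrite /kbound; case: cid => M []. Qed.

Lemma sesq_kapprox_dist g h s t e d : 0 <= e -> 0 <= d ->
  kapprox k h s e -> kapprox k h t d ->
  `|sesq g s - sesq g t| <= kbound g * (e + d).
Proof.
move=> e0 d0 hs ht; rewrite -sesq_sdiff (le_trans (kboundP _ _))//.
by rewrite ler_wpM2l ?kbound_ge0// (kapprox_dist e0 d0 hs ht).
Qed.

Lemma rkhs_dot_ex g h : exists l, forall n,
  `|l - sesq g (kapp h n)| <= kbound g * 2 * eps n.
Proof.
apply: seq_cauchy_lim => n m.
by apply: sesq_kapprox_dist; rewrite ?eps_ge0//; exact: kappP.
Qed.

(** Only the second argument is approximated by formal sums. The choice made in [kapp] does not
    matter, by [rkhs_dot_approx]. *)
Definition rkhs_dot g h : R[i] := projT1 (cid (rkhs_dot_ex g h)).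

Lemma rkhs_dot_approx g h s e : 0 <= e -> kapprox k h s e ->
  `|rkhs_dot g h - sesq g s| <= kbound g * e.
Proof.
move=> e0 hs; apply/ler_addgt0Pr => d d0.
have B0 := kbound_ge0 g.
have [N Ne] := complex_archi (divr_gt0 d0 (ltr_wpDl (mulr_ge0 B0 (ler0n _ 3)) ltr01)).
rewrite -(subrKA (sesq g (kapp h N))) (le_trans (ler_normD _ _))//.
have h1 : `|rkhs_dot g h - sesq g (kapp h N)| <= kbound g * 2 * eps N.
  by rewrite /rkhs_dot; case: cid.
have h2 := sesq_kapprox_dist g (eps_ge0 N) e0 (@kappP h N) hs.
apply: (le_trans (lerD h1 h2)).
rewrite (_ : _ + _ = kbound g * e + kbound g * 3 * eps N); last by ring.
rewrite lerD2l.
apply: (@le_trans _ _ ((kbound g * 3 + 1) * eps N)).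
  rewrite -subr_ge0 (_ : _ - _ = eps N); first exact: eps_ge0.
  by ring.
by rewrite mulrC -ler_pdivlMr ?ltW// ltr_wpDl// mulr_ge0.
Qed.

Lemma rkhs_dotPl (a : R[i]) g1 g2 h :
  rkhs_dot (a *: g1 + g2) h = a * rkhs_dot g1 h + rkhs_dot g2 h.
Proof.
apply/eqP; rewrite -subr_eq0; apply/eqP.
apply: (@small_eq0 _ _ _ (kbound (a *: g1 + g2) + `|a| * kbound g1 + kbound g2)) => n.
have A g := @rkhs_dot_approx g h _ _ (eps_ge0 n) (@kappP h n).
set s := kapp h n in A.
have E : sesq (a *: g1 + g2 : H) s = a * sesq g1 s + sesq g2 s by exact: sesqP.
have -> : rkhs_dot (a *: g1 + g2) h - (a * rkhs_dot g1 h + rkhs_dot g2 h) =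
  (rkhs_dot (a *: g1 + g2) h - sesq (a *: g1 + g2 : H) s)
  + (- (a * (rkhs_dot g1 h - sesq g1 s)) - (rkhs_dot g2 h - sesq g2 s)).
  by rewrite E; ring.
rewrite 2!mulrDl -[leRHS]addrA (le_trans (ler_normD _ _))// lerD ?A//.
rewrite (le_trans (ler_normB _ _))// lerD ?A//.
by rewrite normrN normrM -mulrA ler_wpM2l ?A.
Qed.

Lemma knorm_kapp g n : knorm k (kapp g n) <= kbound g + 1.
Proof.
apply: knorm_le; first by rewrite addr_ge0 ?kbound_ge0.
move=> t; rewrite -(subrK (sesq g t) (sesq (ksum k _) t)) mulrDl addrC.
rewrite (le_trans (ler_normD _ _))// lerD ?kboundP//.
rewrite distrC (le_trans (kappP _ _ _))// ler_wpM2r ?knorm_ge0//.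
by rewrite invf_le1 ?ler1n.
Qed.

(** Approximating both arguments by formal sums transfers symmetry and positivity from the kernel to
    [rkhs_dot]. *)
Lemma rkhs_dot_ksum g h n :
  `|rkhs_dot g h - sesq (ksum k (kapp g n)) (kapp h n)| <=
  (kbound g + (kbound h + 1)) * eps n.
Proof.
rewrite -(subrKA (sesq g (kapp h n))) (le_trans (ler_normD _ _))// mulrDl lerD//.
  by apply: rkhs_dot_approx; [exact: eps_ge0|exact: kappP].
rewrite mulrC (le_trans (kappP _ _ _))// mulrC [leRHS]mulrC.
by rewrite mulrC [leRHS]mulrC ler_wpM2l ?eps_ge0// knorm_kapp.
Qed.

Lemma rkhs_dotC g h : rkhs_dot g h = (rkhs_dot h g)^*.
Proof.
apply/eqP; rewrite -subr_eq0; apply/eqP.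
apply: (@small_eq0 _ _ _ (kbound g + (kbound h + 1) + (kbound h + (kbound g + 1)))) => n.
rewrite mulrDl -(subrKA (sesq (ksum k (kapp g n)) (kapp h n))).
rewrite (le_trans (ler_normD _ _))// lerD ?rkhs_dot_ksum//.
by rewrite sesq_ksumC -rmorphB norm_conjC distrC rkhs_dot_ksum.
Qed.

Lemma rkhs_dot_ge0 g : 0 <= rkhs_dot g g.
Proof.
apply: ge0_approx => e e0.
have B0 : 0 < kbound g + (kbound g + 1) + 1 by rewrite ltr_wpDl// !addr_ge0 ?kbound_ge0.
have [n Ne] := complex_archi (divr_gt0 e0 B0).
exists (kq k (kapp g n)); first exact: kq_ge0.
rewrite (le_trans (rkhs_dot_ksum _ _ _))//.
rewrite (@le_trans _ _ ((kbound g + (kbound g + 1) + 1) * eps n))//.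
  by rewrite ler_wpM2r ?eps_ge0// lerDl.
by rewrite mulrC -ler_pdivlMr// ltW.
Qed.

Lemma ksum_rkhs s : ksum k s \in rkhs_pred k.
Proof.
apply/asboolP => n; exists s => t.
by rewrite subrr normr0 mulr_ge0 ?eps_ge0 ?knorm_ge0.
Qed.

Definition rkhs_ksum s : H := Rkhs (ksum_rkhs s).

Lemma rkhs_dot_sum g s : rkhs_dot g (rkhs_ksum s) = sesq g s.
Proof.
apply/eqP; rewrite -subr_eq0 -normr_le0 -(mulr0 (kbound g)).
by apply: rkhs_dot_approx => // t; rewrite subrr normr0 mul0r.
Qed.

(** Cauchy-Schwarz against formal sums, proved for a form that is still only semidefinite.
    Definiteness follows from it: for t a single point it bounds the value of g there. *)
Lemma sesq_le g t : `|sesq g t| <= sqrtC (rkhs_dot g g) * knorm k t.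
Proof.
rewrite -ler_sqr ?nnegrE ?mulr_ge0 ?sqrtC_ge0 ?rkhs_dot_ge0 ?kq_ge0//.
rewrite exprMn !sqrtCK -rkhs_dot_sum.
have -> : kq k t = rkhs_dot (rkhs_ksum t) (rkhs_ksum t) by rewrite rkhs_dot_sum.
apply: semidefinite_CS; rewrite ?rkhs_dot_ge0// => c.
have := rkhs_dot_ge0 (g - c *: rkhs_ksum t).
rewrite (dotBl rkhs_dotPl) !(dotBr rkhs_dotPl rkhs_dotC) !(dotZl rkhs_dotPl).
rewrite !(dotZr rkhs_dotPl rkhs_dotC) [rkhs_dot (rkhs_ksum t) g]rkhs_dotC.
by congr (0 <= _); rewrite normCK; ring.
Qed.

Lemma rkhs_dot_eq0 g : rkhs_dot g g = 0 -> g = 0.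
Proof.
move=> g0; apply/val_inj/funext => p; apply/eqP; rewrite -normr_le0 /=.
by rewrite -(sesq1 g p) (le_trans (sesq_le _ _))// g0 sqrtC0 mul0r.
Qed.

Definition rkhs_norm g := sqrtC (rkhs_dot g g).

Lemma rkhs_normD g h : rkhs_norm (g + h) <= rkhs_norm g + rkhs_norm h.
Proof. exact: (dot_triangle rkhs_dotPl rkhs_dotC rkhs_dot_ge0 rkhs_dot_eq0). Qed.

Lemma rkhs_normZ a g : rkhs_norm (a *: g) = `|a| * rkhs_norm g.
Proof.
rewrite /rkhs_norm (dotZl rkhs_dotPl) (dotZr rkhs_dotPl rkhs_dotC) mulrA -normCK.
by rewrite sqrtCM ?nnegrE ?exprn_ge0 ?rkhs_dot_ge0// sqrCK.
Qed.

Lemma rkhs_norm0 g : rkhs_norm g = 0 -> g = 0.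
Proof. by move=> /eqP; rewrite sqrtC_eq0 => /eqP /rkhs_dot_eq0. Qed.

HB.instance Definition _ :=
  Lmodule_isNormed.Build R[i] H rkhs_normD rkhs_normZ rkhs_norm0.

(** The norm is the dual norm. For s close to g, up to small errors r <= c |s| and |s|^2 <= r, while
    2 c |s| <= c^2 + |s|^2; eliminating |s| leaves r <= c^2. *)
Lemma rkhs_norm_le g (c : R[i]) : 0 <= c ->
  (forall t, `|sesq g t| <= c * knorm k t) -> `|g| <= c.
Proof.
move=> c0 h; rewrite -ler_sqr ?nnegrE// sqrtCK.
set r := rkhs_dot g g; have r0 : 0 <= r by exact: rkhs_dot_ge0.
have C0 : 0 <= kbound g * 2 + (kbound g + (kbound g + 1)) + 1.
  by rewrite !addr_ge0 ?mulr_ge0 ?kbound_ge0.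
apply/ler_addgt0Pr => e e0.
have [n Ne] := complex_archi (divr_gt0 e0 (ltr_wpDl C0 ltr01)).
set s := kapp g n.
have h1 : r <= c * knorm k s + kbound g * eps n.
  rewrite -[r](ger0_norm r0) -(subrK (sesq g s) r) addrC.
  rewrite (le_trans (ler_normD _ _))// lerD//.
  by apply: rkhs_dot_approx; [exact: eps_ge0|exact: kappP].
have h2 : knorm k s ^+ 2 <= r + (kbound g + (kbound g + 1)) * eps n.
  rewrite sqrtCK -[kq k s]ger0_norm ?kq_ge0// -(subrK r (kq k s)) addrC.
  rewrite (le_trans (ler_normD _ _))// lerD ?(ger0_norm r0)// distrC.
  exact: rkhs_dot_ksum.
have h3 : 2 * (c * knorm k s) <= c ^+ 2 + knorm k s ^+ 2.
  rewrite -subr_ge0 (_ : _ - _ = (c - knorm k s) ^+ 2); last by ring.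
  rewrite -real_normK ?exprn_ge0// rpredB ?ger0_real ?knorm_ge0//.
have h4 : r <= c ^+ 2 + (kbound g * 2 + (kbound g + (kbound g + 1))) * eps n.
  have : 2 * r <= c ^+ 2 + r + (kbound g * 2 + (kbound g + (kbound g + 1))) * eps n.
    apply: (le_trans (ler_wpM2l (ler0n _ 2) h1)); rewrite mulrDr.
    apply: (le_trans (lerD (le_trans h3 (lerD (lexx _) h2)) (lexx _))).
    by rewrite le_eqVlt; apply/orP; left; apply/eqP; ring.
  by rewrite mulr_natl mulr2n addrAC lerD2r.
apply: (le_trans h4); rewrite lerD2l.
apply: (@le_trans _ _ ((kbound g * 2 + (kbound g + (kbound g + 1)) + 1 + 1) * eps n)).
  by rewrite ler_wpM2r ?eps_ge0// -addrA lerDl.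
by rewrite mulrC -ler_pdivlMr ?ltr_wpDl// ltW.
Qed.

Lemma rkhs_val_le g p : `|g p| <= `|g| * knorm k [:: (1, p)].
Proof. by rewrite -(sesq1 g p); exact: sesq_le. Qed.

(** Point evaluations are bounded, so a Cauchy filter converges pointwise. Passing to the limit in
    the Cauchy estimate tested against each t gives convergence in the dual norm, whence both
    membership of the limit and convergence in norm. *)
Lemma rkhs_complete (F : set_system H) : ProperFilter F -> cauchy F -> cvg F.
Proof.
move=> FF /cauchy_ballP cF.
have small e : 0 < e -> exists2 A, F A & forall g h, A g -> A h -> `|g - h| < e.
  move=> e0; have [[A B] [/= FA FB] AB] := cF e e0.
  exists (A `&` B); first exact: filterI.
  move=> g h [Ag _] [_ Bh]; have := AB (g, h) (conj Ag Bh).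
  by rewrite -ball_normE.
have lim_ex p : exists l : R[i], (fun g : H => g p) @ F --> l.
  apply/cvg_ex; apply: cauchy_cvg; apply/cauchy_ballP => e e0.
  have d0 : 0 < e / (knorm k [:: (1, p)] + 1) by rewrite divr_gt0// ltr_wpDl ?knorm_ge0.
  have [A FA Ae] := small _ d0.
  pose I := [set g p | g in A].
  have FI : F [set g : H | I (g p)] by apply: filterS FA => g Ag; exists g.
  exists (I, I) => //=.
  move=> [_ _] /= [[g Ag <-] [h Ah <-]]; rewrite -ball_normE /=.
  have -> : g p - h p = (g - h : H) p by [].
  rewrite (le_lt_trans (rkhs_val_le _ _))//.
  apply: (@le_lt_trans _ _ (`|g - h| * (knorm k [:: (1, p)] + 1))).
    by rewrite ler_wpM2l// lerDl.
  by rewrite -ltr_pdivlMr ?ltr_wpDl ?knorm_ge0// Ae.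
pose l p := projT1 (cid (lim_ex p)).
have lP p : (fun g : H => g p) @ F --> l p by rewrite /l; case: cid.
have sl t : (fun g : H => sesq g t) @ F --> sesq l t.
  elim: t => [|b t IH].
    have -> : (fun g : H => sesq g [::]) = cst 0.
      by apply/funext => g; rewrite /sesq big_nil.
    by rewrite /sesq big_nil; exact: cvg_cst.
  have -> : (fun g : H => sesq g (b :: t)) = (fun g : H => b.1^* *: g b.2 + sesq g t).
    by apply/funext => g; rewrite /sesq big_cons.
  rewrite /sesq big_cons; apply: cvgD; last exact: IH.
  apply: cvgZr; exact: lP.
have lim_le e (A : set H) : F A -> (forall g h, A g -> A h -> `|g - h| < e) ->
    forall g, A g -> forall t, `|sesq g t - sesq l t| <= e * knorm k t.
  move=> FA Ae g Ag t; apply/ler_addgt0Pr => d d0.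
  have /cvgrPdist_lt/(_ _ d0) nd := sl t.
  have [h [Ah hd]] := filter_ex (filterI FA nd).
  rewrite -(subrKA (sesq h t)) (le_trans (ler_normD _ _))// lerD//; last first.
    by rewrite distrC ltW.
  rewrite -sesqB (le_trans (sesq_le (g - h) t))//.
  by rewrite ler_wpM2r ?knorm_ge0// ltW// Ae.
have lH : l \in rkhs_pred k.
  apply/asboolP => n.
  have e0 : 0 < eps n / 2 by rewrite divr_gt0// invr_gt0.
  have [A FA Ae] := small _ e0; have [g Ag] := filter_ex FA.
  have [N Ne] := complex_archi e0.
  exists (kapp g N) => t; rewrite -(subrKA (sesq g t)) (splitr (eps n)) mulrDl.
  rewrite (le_trans (ler_normD _ _))// lerD//.
    by rewrite distrC (lim_le _ A).
  by rewrite (le_trans (kappP _ _ _))// ler_wpM2r ?knorm_ge0// ltW.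
apply/cvg_ex; exists (Rkhs lH); apply/cvgrPdist_lt => e e0.
have e2 : 0 < e / 2 by rewrite divr_gt0.
have [A FA Ae] := small _ e2; apply: (filterS _ (FA)) => g Ag.
apply: (@le_lt_trans _ _ (e / 2)); last by rewrite gtr_pMr// invf_lt1// ltr1n.
apply: rkhs_norm_le; first exact: ltW.
by move=> t; rewrite [sesq _ _]sesqB distrC (lim_le _ A).
Qed.

HB.instance Definition _ := Uniform_isComplete.Build H rkhs_complete.
HB.instance Definition _ := isHilbert.Build R H rkhs_dotPl rkhs_dotC
  (fun u => esym (sqrtCK (rkhs_dot u u))).

Definition rkhs_pt p : H := rkhs_ksum [:: (1, p)].

Lemma rkhs_repro g p : hdot g (rkhs_pt p) = g p.
Proof. by rewrite [LHS]rkhs_dot_sum sesq1. Qed.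

Lemma rkhs_ptE p q : rkhs_pt p q = k p q.
Proof. by rewrite /= /ksum big_seq1 mul1r. Qed.

End Rkhs.

Lemma double_eq0 (V : zmodType) (x : V) : x = x + x -> x = 0.
Proof. by move=> /eqP; rewrite -subr_eq0 opprD addrA subrr sub0r oppr_eq0 => /eqP. Qed.

(** * Complete positivity over a commutative algebra *)

Section CbFacts.
Variables (R : realType) (X : topologicalType).
Local Notation A := (Cb R X).
Implicit Types (d e : A).

Lemma Cb_ext d e : (forall x, d x = e x) -> d = e.
Proof. by move=> de; apply/val_inj/funext. Qed.

Lemma Cb_mulE d e x : (d * e) x = d x * e x. Proof. by []. Qed.
Lemma Cb_addE d e x : (d + e) x = d x + e x. Proof. by []. Qed.
Lemma Cb_subE d e x : (d - e) x = d x - e x. Proof. by []. Qed.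
Lemma Cb_scaleE a d x : (a *: d) x = a * d x. Proof. by []. Qed.
Lemma Cb_1E x : (1 : A) x = 1. Proof. by []. Qed.
Lemma Cb_starE d x : Cb_star d x = (d x)^*. Proof. by []. Qed.

Lemma Cb_mulC d e : d * e = e * d.
Proof. by apply: Cb_ext => x; rewrite !Cb_mulE mulrC. Qed.

Lemma Cb_starM d e : Cb_star (d * e) = Cb_star d * Cb_star e.
Proof. by apply: Cb_ext => x; rewrite Cb_mulE !Cb_starE -rmorphM. Qed.

Lemma Cb_starK d : Cb_star (Cb_star d) = d.
Proof. by apply: Cb_ext => x; rewrite !Cb_starE conjCK. Qed.

Lemma Cb_starP a d e : Cb_star (a *: d + e) = a^* *: Cb_star d + Cb_star e.
Proof.
apply: Cb_ext => x.
by rewrite Cb_addE Cb_scaleE !Cb_starE Cb_addE Cb_scaleE rmorphD rmorphM.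
Qed.

Lemma Cb_star1 : Cb_star (1 : A) = 1.
Proof. by apply: Cb_ext => x; rewrite Cb_starE Cb_1E conjC1. Qed.

Lemma Cb_bounded d : exists2 M : R[i], 0 <= M & forall x, `|d x| <= M.
Proof.
have /asboolP[_ [M dM]] := Cb_funP d; exists `|M| => // x.
by rewrite (le_trans (dM x))// real_ler_norm// ger0_real// (le_trans _ (dM x)).
Qed.

Lemma Cb_inv_ex d (e : R[i]) : 0 < e -> (forall x, e <= d x) ->
  exists2 i : A, d * i = 1 & Cb_star i = i.
Proof.
move=> e0 de; have d0 x : 0 < d x by exact: lt_le_trans (de x).
have iP : (fun x => (d x)^-1) \in @Cb_pred R X.
  have /asboolP[cd _] := Cb_funP d; apply/asboolP; split.
    by move=> x; apply: cvgV; [rewrite gt_eqF|exact: cd].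
  exists e^-1 => x; rewrite ger0_norm ?invr_ge0 ?(ltW (d0 x))//.
  by rewrite lef_pV2 ?posrE.
exists (MkCb iP); apply: Cb_ext => x; first by rewrite Cb_mulE /= mulfV ?gt_eqF.
by rewrite Cb_starE; apply/CrealP; rewrite /= gtr0_real ?invr_gt0.
Qed.

Lemma Cb_sqrt_ex d : (forall x, 0 <= d x) ->
  exists2 s : A, s * s = d & Cb_star s = s.
Proof.
move=> d0; have dE x : d x = (complex.Re (d x))%:C%C.
  by rewrite RRe_real// ger0_real.
pose f x : R[i] := (Num.sqrt (complex.Re (d x)))%:C%C.
have R0 x : 0 <= complex.Re (d x) by rewrite -lecR -dE.
have ff x : f x * f x = d x by rewrite /f -rmorphM -expr2 sqr_sqrtr// -dE.
have f0 x : 0 <= f x by rewrite ler0c sqrtr_ge0.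
have /asboolP[cd _] := Cb_funP d; have [M M0 dM] := Cb_bounded d.
have fP : f \in @Cb_pred R X.
  apply/asboolP; split.
    have creal : continuous (fun r : R => r%:C%C : R[i]).
      move=> r; apply/cvgrPdist_lt => e e0.
      have eE : e = (complex.Re e)%:C%C by rewrite RRe_real// gtr0_real.
      have er : 0 < complex.Re e by move: e0; rewrite {1}eE ltcR.
      near=> t; rewrite -rmorphB normc_real eE ltcR.
      by near: t; have /cvgrPdist_lt := @cvg_id _ (nbhs r); exact.
    have cRe : continuous (@complex.Re R : R[i] -> R).
      move=> r; have FF : Filter (nbhs r) by typeclasses eauto.
      apply/cvgrPdist_lt => e e0.
      have ec : 0 < e%:C%C :> R[i] by rewrite ltcR.
      near=> t; rewrite -ltcR.
      have -> : complex.Re r - complex.Re t = complex.Re (r - t) by case: (r); case: (t).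
      apply: le_lt_trans (normc_ge_Re _) _.
      by near: t; have /cvgrPdist_lt := @cvg_id _ (nbhs r); exact.
    move=> x; apply: (continuous_comp (f := fun x => complex.Re (d x))
      (g := fun r => (Num.sqrt r)%:C%C)).
      by apply: continuous_comp; [exact: cd|exact: cRe].
    by apply: continuous_comp; [exact: sqrt_continuous|exact: creal].
  (* M + 1 bounds the square root because M <= (M + 1)^2. *)
  exists (M + 1) => x; rewrite ger0_norm//.
  rewrite -ler_sqr ?nnegrE ?addr_ge0// expr2 ff sqrrD expr1n mulr1.
  apply: (@le_trans _ _ (M *+ 2 + 1)); last first.
    by rewrite lerD2r lerDr exprn_ge0.
  rewrite (le_trans _ (_ : M <= _))//.
    by have := dM x; rewrite ger0_norm.
  by rewrite mulr2n -addrA lerDl addr_ge0.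
exists (MkCb fP); apply: Cb_ext => x; first by rewrite Cb_mulE /= ff.
by rewrite Cb_starE; apply/CrealP; rewrite /= ger0_real.
Unshelve. all: by end_near. Qed.

End CbFacts.

Section CompletePositivity.
Variables (R : realType) (X : topologicalType).
Local Notation A := (Cb R X).

(* Representations on a space with a merely semidefinite form: point evaluations,
   representations by operators and forms <B u, v> all are instances. *)
Record form_rep := FormRep {
  fr_space : lmodType R[i] ;
  fr_form : fr_space -> fr_space -> R[i] ;
  fr_act : A -> fr_space -> fr_space ;
  fr_formPl : forall (a : R[i]) u v w,
    fr_form (a *: u + v) w = a * fr_form u w + fr_form v w ;
  fr_formC : forall u v, fr_form u v = (fr_form v u)^* ;
  fr_form_ge0 : forall u, 0 <= fr_form u u ;
  fr_actP : forall (a : R[i]) d e u,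
    fr_act (a *: d + e) u = a *: fr_act d u + fr_act e u ;
  fr_act1 : forall u, fr_act 1 u = u ;
  fr_actM : forall d e u, fr_act (d * e) u = fr_act d (fr_act e u) ;
  fr_actl : forall d, linear (fr_act d) ;
  fr_adj : forall d u v, fr_form (fr_act d u) v = fr_form u (fr_act (Cb_star d) v) }.

Section Form.
Variable M : form_rep.
Local Notation H := (fr_space M).
Local Notation beta := (@fr_form M).
Local Notation rho := (@fr_act M).

Lemma fr_formDl u v w : beta (u + v) w = beta u w + beta v w.
Proof. exact: (dotDl (@fr_formPl M)). Qed.
Lemma fr_formDr u v w : beta w (u + v) = beta w u + beta w v.
Proof. exact: (dotDr (@fr_formPl M) (@fr_formC M)). Qed.
Lemma fr_form0l w : beta 0 w = 0.
Proof. exact: (dot0l (@fr_formPl M)). Qed.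
Lemma fr_form0r w : beta w 0 = 0.
Proof. by rewrite fr_formC fr_form0l conjC0. Qed.
Lemma fr_formZl a u w : beta (a *: u) w = a * beta u w.
Proof. exact: (dotZl (@fr_formPl M)). Qed.
Lemma fr_form_suml I (r : seq I) (F : I -> H) w :
  beta (\sum_(i <- r) F i) w = \sum_(i <- r) beta (F i) w.
Proof. by apply: (big_morph (beta^~ w)) => [u v|]; rewrite ?fr_formDl ?fr_form0l. Qed.
Lemma fr_form_sumr I (r : seq I) (F : I -> H) w :
  beta w (\sum_(i <- r) F i) = \sum_(i <- r) beta w (F i).
Proof. by apply: (big_morph (beta w)) => [u v|]; rewrite ?fr_formDr ?fr_form0r. Qed.

Lemma fr_act_add d u v : rho d (u + v) = rho d u + rho d v.
Proof. by have := fr_actl d 1 u v; rewrite !scale1r. Qed.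
Lemma fr_act_zero d : rho d 0 = 0.
Proof. by apply: double_eq0; rewrite -fr_act_add addr0. Qed.
Lemma fr_act_sum d I (r : seq I) (F : I -> H) :
  rho d (\sum_(i <- r) F i) = \sum_(i <- r) rho d (F i).
Proof. by apply: (big_morph (rho d)) => [u v|]; rewrite ?fr_act_add ?fr_act_zero. Qed.
Lemma fr_actD d e u : rho (d + e) u = rho d u + rho e u.
Proof. by have := fr_actP 1 d e u; rewrite !scale1r. Qed.
Lemma fr_actB d e u : rho (d - e) u = rho d u - rho e u.
Proof. by have := fr_actP (-1) e d u; rewrite !scaleN1r addrC => ->; rewrite addrC. Qed.

Lemma fr_act_pos (d : A) u : (forall x, 0 <= d x) -> 0 <= beta (rho d u) u.
Proof.
move=> d0; have [s <- ss] := Cb_sqrt_ex d0.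
by rewrite fr_actM fr_adj ss fr_form_ge0.
Qed.

Definition rho_form N (F : 'I_N -> 'I_N -> A) (h : 'I_N -> H) : R[i] :=
  \sum_p \sum_q beta (rho (F p q) (h q)) (h p).

Definition schur_compl N (F : 'I_N.+1 -> 'I_N.+1 -> A) (i : A) (p q : 'I_N) : A :=
  F (lift ord0 p) (lift ord0 q) - F (lift ord0 p) ord0 * i * F ord0 (lift ord0 q).

(** With a the corner, i its inverse and g the remainder of the first row applied to h, w is h_0 + i
    g. The cross terms of <a w, w> are those of the first row and column ([e1]), and its surplus <g,
    i g> is what the Schur complement subtracts ([e2], [e3]). *)
Lemma complete_square N (F : 'I_N.+1 -> 'I_N.+1 -> A) (i : A) (h : 'I_N.+1 -> H) :
  (forall p q, Cb_star (F p q) = F q p) -> F ord0 ord0 * i = 1 -> Cb_star i = i ->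
  let w := h ord0 + rho i (\sum_q rho (F ord0 (lift ord0 q)) (h (lift ord0 q))) in
  rho_form F h = beta (rho (F ord0 ord0) w) w +
    rho_form (schur_compl F i) (h \o lift ord0).
Proof.
move=> Fs Fi is_ /=; set g := \sum_q _; set a := F ord0 ord0.
have e1 : beta (rho a (h ord0)) (rho i g) = beta (h ord0) g.
  by rewrite fr_adj /a Fs -fr_actM Fi fr_act1.
have e2 : \sum_p \sum_q
    beta (rho (F (lift ord0 p) ord0 * i * F ord0 (lift ord0 q)) (h (lift ord0 q)))
      (h (lift ord0 p)) = beta g (rho i g).
  rewrite -[in RHS]is_ -fr_adj /g fr_form_sumr -/g; apply: eq_bigr => p _.
  rewrite -fr_form_suml -[F ord0 (lift ord0 p)]Fs -fr_adj; congr beta.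
  by rewrite /g !fr_act_sum; apply: eq_bigr => q _; rewrite -!fr_actM ?mulrA.
have e3 : rho_form (schur_compl F i) (h \o lift ord0) =
    \sum_p \sum_q
      beta (rho (F (lift ord0 p) (lift ord0 q)) (h (lift ord0 q))) (h (lift ord0 p))
    - beta g (rho i g).
  rewrite -e2 -sumrB; apply: eq_bigr => p _; rewrite -sumrB; apply: eq_bigr => q _.
  by rewrite fr_actB fr_formDl -scaleN1r fr_formZl mulN1r.
have -> : rho_form F h =
    beta (rho a (h ord0)) (h ord0) + beta g (h ord0) + beta (h ord0) g +
    \sum_p \sum_q
      beta (rho (F (lift ord0 p) (lift ord0 q)) (h (lift ord0 q))) (h (lift ord0 p)).
  rewrite /rho_form big_ord_recl big_ord_recl -!addrA; congr (_ + _).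
  rewrite -fr_form_suml -/g; congr (_ + _).
  under eq_bigr do rewrite big_ord_recl.
  rewrite big_split /=; congr (_ + _).
  by rewrite /g fr_form_sumr; apply: eq_bigr => p _; rewrite -Fs fr_adj Cb_starK.
rewrite e3 fr_act_add fr_formDl !fr_formDr e1 -fr_actM Fi fr_act1.
by ring.
Qed.

End Form.

Lemma eval_adj (x : X) (d : A) (u v : R[i]) : d x * u * v^* = u * (Cb_star d x * v)^*.
Proof. by rewrite Cb_starE rmorphM /= conjCK; ring. Qed.

(** Kept transparent so that [rho_form] at [eval_rep x] computes to the quadratic form of the scalar
    matrix F p q x. *)
Definition eval_rep (x : X) : form_rep.
Proof.
refine (@FormRep R[i]^o (fun u v => u * v^*) (fun d u => d x * u) _ _ _ _ _ _ _ _).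
- by move=> a u v w; rewrite mulrDl mulrA.
- by move=> u v; rewrite rmorphM /= conjCK mulrC.
- by move=> u; rewrite -normCK exprn_ge0.
- by move=> a d e u; rewrite Cb_addE Cb_scaleE mulrDl -mulrA.
- by move=> u; rewrite Cb_1E mul1r.
- by move=> d e u; rewrite Cb_mulE mulrA.
- by move=> d a u v; rewrite mulrDr; congr (_ + _); exact: mulrCA.
- exact: eval_adj.
Defined.

(* Induction by Schur complements: the corner of a uniformly positive matrix is
   invertible, and completing the square splits it off. *)
Lemma rho_form_ge0_strict (M : form_rep) N (F : 'I_N -> 'I_N -> A)
    (h : 'I_N -> fr_space M) (e : R[i]) :
  0 < e -> (forall p q, Cb_star (F p q) = F q p) ->
  (forall x (c : 'I_N -> R[i]), e * \sum_p `|c p| ^+ 2 <= @rho_form (eval_rep x) N F c) ->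
  0 <= rho_form F h.
Proof.
move=> e0; elim: N F h => [|N IH] F h Fs Fpos.
  by rewrite /rho_form big_ord0.
have a_ge x : e <= F ord0 ord0 x.
  have := Fpos x (fun p => (p == ord0)%:R).
  rewrite big_ord_recl big1 ?addr0 ?eqxx ?normr1 ?expr1n ?mulr1; last first.
    by move=> p _; rewrite eq_sym (negPf (neq_lift _ _)) normr0 expr0n.
  rewrite /rho_form big_ord_recl [X in _ + X]big1 ?addr0; last first.
    move=> p _; rewrite big1// => q _ /=.
    by rewrite conjC0 mulr0.
  rewrite big_ord_recl [X in _ + X]big1 ?addr0; last first.
    by move=> p _ /=; rewrite mulr0 mul0r.
  by rewrite /= conjC1 !mulr1.
have [i ai is_] := Cb_inv_ex e0 a_ge.
rewrite (complete_square h Fs ai is_) addr_ge0//.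
  by apply: fr_act_pos => x; rewrite (le_trans (ltW e0) (a_ge x)).
apply: IH => [p q|x c].
  rewrite /schur_compl addrC -scaleN1r Cb_starP rmorphN1 scaleN1r addrC Fs; congr (_ - _).
  by rewrite !Cb_starM !Fs is_ [LHS]Cb_mulC -mulrA; congr (_ * _); rewrite Cb_mulC.
(* This first entry makes the completed square vanish, so the form of F at c' equals that of the
   Schur complement at c, which inherits the bound e. *)
pose c0 := - (i x * \sum_q F ord0 (lift ord0 q) x * c q).
pose c' (p : 'I_N.+1) := if unlift ord0 p is Some q then c q else c0.
have c'l q : c' (lift ord0 q) = c q by rewrite /c' liftK.
have c'0 : c' ord0 = c0 by rewrite /c' unlift_none.
have w0 : c' ord0 + @fr_act (eval_rep x) i (\sum_q
    @fr_act (eval_rep x) (F ord0 (lift ord0 q)) (c' (lift ord0 q))) = 0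
    :> fr_space (eval_rep x).
  rewrite c'0 /c0 /=; under [X in _ + _ * X]eq_bigr do rewrite c'l.
  by rewrite addNr.
have := Fpos x c'; rewrite (@complete_square (eval_rep x) N F i c' Fs ai is_) => h1.
have -> : @rho_form (eval_rep x) N (schur_compl F i) c =
    @rho_form (eval_rep x) N (schur_compl F i) (c' \o lift ord0).
  by apply: eq_bigr => p _; apply: eq_bigr => q _; rewrite /= !c'l.
apply: le_trans (le_trans h1 _).
  rewrite ler_wpM2l ?(ltW e0)// big_ord_recl.
  under [X in _ <= _ + X]eq_bigr do rewrite c'l.
  by rewrite lerDr exprn_ge0.
by rewrite w0 fr_form0r add0r.
Qed.

(* Positive maps on a commutative C*-algebra are completely positive. *)
Lemma rho_form_ge0 (M : form_rep) N (F : 'I_N -> 'I_N -> A) (h : 'I_N -> fr_space M) :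
  (forall p q, Cb_star (F p q) = F q p) ->
  (forall x (c : 'I_N -> R[i]), 0 <= @rho_form (eval_rep x) N F c) ->
  0 <= rho_form F h.
Proof.
move=> Fs Fpos; apply: ge0_approx => e e0.
set S := \sum_p fr_form (h p) (h p).
have S0 : 0 <= S by rewrite sumr_ge0// => p _; exact: fr_form_ge0.
have d0 : 0 < e / (S + 1) by rewrite divr_gt0// ltr_wpDl.
set d := e / (S + 1) in d0.
have dR : d^* = d by apply/CrealP/gtr0_real.
(* Adding d to the diagonal makes the matrix uniformly positive; it changes the form at h by d S, at
   most e by the choice of d. *)
pose I : A := d *: (1 : A).
pose G p q : A := F p q + (if p == q then I else 0).
have GE (K : form_rep) (u : 'I_N -> fr_space K) :
    rho_form G u = rho_form F u + d * \sum_p fr_form (u p) (u p).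
  rewrite /rho_form mulr_sumr -big_split; apply: eq_bigr => p _ /=.
  have -> : d * fr_form (u p) (u p) =
      \sum_q fr_form (fr_act (if p == q then I else 0) (u q)) (u p).
    have z v : @fr_act K 0 v = 0.
      by apply: double_eq0; rewrite -fr_actD addr0.
    rewrite (bigD1 p)//= eqxx big1 ?addr0.
      have := fr_actP d 1 0 (u p); rewrite addr0 fr_act1 z addr0 => ->.
      by rewrite fr_formZl.
    by move=> q qp; rewrite eq_sym (negPf qp) z fr_form0l.
  by rewrite -big_split; apply: eq_bigr => q _; rewrite /G fr_actD fr_formDl.
exists (rho_form G h).
  apply: (@rho_form_ge0_strict M N G h d d0) => [p q|x c].
    rewrite /G -[F p q]scale1r Cb_starP conjC1 !scale1r Fs eq_sym; congr (_ + _).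
    case: ifP => _; apply: Cb_ext => x; rewrite /I Cb_starE ?Cb_scaleE ?Cb_1E ?mulr1//.
    by rewrite conjC0.
  rewrite (GE (eval_rep x)) [leRHS](_ : _ = @rho_form (eval_rep x) N F c +
      d * \sum_p `|c p| ^+ 2); last first.
    by congr (_ + d * _); apply: eq_bigr => p _; rewrite normCK.
  by rewrite lerDr Fpos.
rewrite GE opprD addNKr normrN ger0_norm; last exact: mulr_ge0 (ltW d0) S0.
by rewrite /d mulrAC ler_pdivrMr ?ltr_wpDl// mulrDr mulr1 lerDl ltW.
Qed.

End CompletePositivity.

(** * Kolmogorov decompositions *)

Section Kolmogorov.
Variables (R : realType) (X : topologicalType) (Y : hilbertType R) (T : Type).
Local Notation A := (Cb R X).
Variable D : T -> T -> A -> 'B(Y, Y).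
Hypothesis Dcp : cp_kernel D.
Local Notation eps n := (n.+1%:R^-1 : R[i]).

Lemma bop_sumE (U V : hilbertType R) I (r : seq I) (F : I -> 'B(U, V)) x :
  (\sum_(i <- r) F i) x = \sum_(i <- r) F i x.
Proof. by apply: (big_morph (fun S : 'B(U, V) => S x)). Qed.

Lemma rank1_linear (v y : Y) : linear (fun u : Y => hdot u v *: y).
Proof. by move=> a u w; rewrite hdotPl scalerDl scalerA. Qed.

Lemma rank1_continuous (v y : Y) : continuous (fun u : Y => hdot u v *: y).
Proof.
apply: (@lipschitz_continuous _ _ _ _ (`|v| * `|y|)); first exact: mulr_ge0.
move=> u w; rewrite -scalerBl -hdotBl normrZ mulrC -mulrA mulrCA ler_wpM2l//.
by rewrite mulrC mulrC (le_trans (hdot_CS _ _))// mulrC.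
Qed.

Definition rank1 v y := mkbop (@rank1_linear v y) (@rank1_continuous v y).

(** The coefficients in [cp_kernel] are operators. Rank-one operators sending a fixed unit vector u
    to the given vectors turn positivity at u into the claim; if Y = 0 there is no u, and the sum is
    0. *)
Lemma cp_kernel_vec (s : seq (T * A * Y)) :
  0 <= \sum_(a <- s) \sum_(b <- s)
    hdot (D a.1.1 b.1.1 (Cb_star a.1.2 * b.1.2) b.2) a.2.
Proof.
have [[v v0]|nv] := pselect (exists v : Y, v != 0); last first.
  have y0 (y : Y) : y = 0 by apply: contra_notP nv => /eqP; exists y.
  by rewrite big1// => a _; rewrite big1// => b _; rewrite (y0 a.2) hdot0r.
pose u := `|v|^-1 *: v.
have uu : hdot u u = 1.
  by rewrite hdotxx normrZ ger0_norm ?invr_ge0// mulVf ?expr1n// normr_eq0.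
pose x i := (tnth (in_tuple s) i).1.1.
pose a i := (tnth (in_tuple s) i).1.2.
pose b i := rank1 u (tnth (in_tuple s) i).2.
have := Dcp.2 _ x a b u.
rewrite bop_sumE hdot_suml [X in _ -> 0 <= X]big_tnth; congr (0 <= _).
apply: eq_bigr => i _.
rewrite bop_sumE hdot_suml [RHS]big_tnth; apply: eq_bigr => j _.
by rewrite !bcompE adjPr /b /= uu !scale1r.
Qed.

(** The data of q come first in D because the kernel must be linear in p and conjugate-linear in
    q. *)
Definition gns_fun (p q : T * A * Y) : R[i] :=
  hdot (D q.1.1 p.1.1 (Cb_star q.1.2 * p.1.2) p.2) q.2.

Lemma gns_psd (s : seq (R[i] * (T * A * Y))) :
  0 <= \sum_(a <- s) \sum_(b <- s) a.1 * b.1^* * gns_fun a.2 b.2.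
Proof.
have := cp_kernel_vec [seq (a.2.1, a.1 *: a.2.2) | a <- s].
congr (0 <= _); rewrite exchange_big big_map; apply: eq_bigr => a _.
rewrite big_map; apply: eq_bigr => b _ /=.
by rewrite bop_scale hdotZl hdotZr mulrA.
Qed.

Definition gns_kernel := PsdKernel gns_psd.
Local Notation k := gns_kernel.
Local Notation H := (rkhs k).

Lemma cp_kernel_lin x y a d e : D x y (a *: d + e) = a *: D x y d + D x y e.
Proof. by have [Dl _] := Dcp.1 x y; exact: Dl. Qed.

Lemma cp_kernel_zero x y : D x y 0 = 0.
Proof. by apply: double_eq0; have := cp_kernel_lin x y 1 0 0; rewrite !scale1r addr0. Qed.

Definition gns_mul (e : A) (p : T * A * Y) : T * A * Y := (p.1.1, e * p.1.2, p.2).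
Definition gns_mul_seq (e : A) (s : seq (R[i] * (T * A * Y))) :=
  [seq (b.1, gns_mul e b.2) | b <- s].

Lemma gns_mulE e p q : k (gns_mul e p) q = k p (gns_mul (Cb_star e) q).
Proof.
rewrite /= /gns_fun /=; congr (hdot (D _ _ _ _) _).
by rewrite Cb_starM Cb_starK mulrA [X in X * _]Cb_mulC.
Qed.

Lemma sesq_gns_mul g e s : sesq (g \o gns_mul e) s = sesq g (gns_mul_seq e s).
Proof. by rewrite /sesq big_map. Qed.

Lemma ksum_gns_mul e s : ksum k (gns_mul_seq e s) = ksum k s \o gns_mul (Cb_star e).
Proof.
apply/funext => p; rewrite /ksum big_map; apply: eq_bigr => a _.
by congr (_ * _); exact: gns_mulE.
Qed.

(* M^2 - e^* e has a continuous square root r, and the difference of the two sides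
   (squared) is the positive form at r s. *)
Lemma knorm_gns_mul (e : A) (M : R[i]) s : 0 <= M -> (forall x, `|e x| <= M) ->
  knorm k (gns_mul_seq e s) <= M * knorm k s.
Proof.
move=> M0 eM; rewrite -ler_sqr ?nnegrE ?mulr_ge0 ?knorm_ge0// exprMn !sqrtCK.
have pos x : 0 <= (M ^+ 2 *: (1 : A) - Cb_star e * e) x.
  rewrite Cb_subE Cb_scaleE Cb_1E Cb_mulE Cb_starE mulr1 mulrC -normCK subr_ge0.
  by rewrite ler_sqr ?nnegrE.
have [r rr rs] := Cb_sqrt_ex pos.
rewrite -subr_ge0; apply: le_trans (kq_ge0 k (gns_mul_seq r s)) _.
rewrite le_eqVlt; apply/orP; left; apply/eqP.
rewrite /kq !sesq_ksum !big_map mulr_sumr -sumrB; apply: eq_bigr => a _.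
rewrite !big_map mulr_sumr -sumrB; apply: eq_bigr => b _ /=.
rewrite mulrCA -mulrBr; congr (_ * _); rewrite /gns_fun /=.
have E d : Cb_star (d * b.2.1.2) * (d * a.2.1.2) =
    Cb_star d * d * (Cb_star b.2.1.2 * a.2.1.2).
  by apply: Cb_ext => x; rewrite !(Cb_mulE, Cb_starE) rmorphM; ring.
rewrite !E rs rr -hdotZl -bopZE.
rewrite -hdotBl -bopBE; set f := Cb_star b.2.1.2 * _.
have -> : (M ^+ 2 *: (1 : A) - Cb_star e * e) * f = M ^+ 2 *: f - Cb_star e * e * f.
  by apply: Cb_ext => x; rewrite !(Cb_mulE, Cb_subE, Cb_scaleE, Cb_1E); ring.
rewrite [_ - _ * f]addrC -scaleN1r cp_kernel_lin scaleN1r -[M ^+ 2 *: f]addr0.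
by rewrite cp_kernel_lin cp_kernel_zero addr0 addrC.
Qed.

Lemma gns_rep_mem e (g : H) : rkhs_fun g \o gns_mul (Cb_star e) \in rkhs_pred k.
Proof.
apply/asboolP => n; have [M M0 eM] := Cb_bounded (Cb_star e).
have e0 : 0 < eps n / (M + 1) by rewrite divr_gt0 ?invr_gt0// ltr_wpDl.
have [N Ne] := complex_archi e0.
exists (gns_mul_seq e (kapp g N)) => t.
rewrite ksum_gns_mul !sesq_gns_mul (le_trans (kappP _ _ _))//.
apply: (@le_trans _ _ (eps N * (M * knorm k t))).
  by rewrite ler_wpM2l ?eps_ge0// knorm_gns_mul.
rewrite mulrA ler_wpM2r ?knorm_ge0//.
apply: (@le_trans _ _ (eps N * (M + 1))); first by rewrite ler_wpM2l ?eps_ge0// lerDl.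
by rewrite -ler_pdivlMr ?ltr_wpDl// ltW.
Qed.

Definition gns_rep_fun e (g : H) : H := Rkhs (gns_rep_mem e g).

Lemma gns_rep_linear e : linear (gns_rep_fun e).
Proof. by move=> a g h; apply/val_inj/funext. Qed.

Lemma gns_rep_continuous e : continuous (gns_rep_fun e).
Proof.
have [M M0 eM] := Cb_bounded (Cb_star e).
apply: (lipschitz_continuous M0) => g h.
rewrite -(linear_subE (@gns_rep_linear e)); set f := g - h.
apply: rkhs_norm_le; first exact: mulr_ge0.
move=> t; rewrite sesq_gns_mul (le_trans (sesq_le _ _))//.
rewrite [M * _]mulrC -mulrA; apply: ler_wpM2l; first exact: (normr_ge0 f).
exact: knorm_gns_mul.
Qed.

Definition gns_rep_bop e : 'B(H, H) := mkbop (@gns_rep_linear e) (@gns_rep_continuous e).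

Lemma gns_rep_pt e p : gns_rep_bop e (rkhs_pt k p) = rkhs_pt k (gns_mul e p).
Proof.
apply/val_inj/funext => q; rewrite [RHS](rkhs_ptE k) gns_mulE -(rkhs_ptE k).
by [].
Qed.

Lemma gns_pt_lin x a d e y : rkhs_pt k (x, a *: d + e, y) =
  a *: rkhs_pt k (x, d, y) + rkhs_pt k (x, e, y).
Proof.
apply/val_inj/funext => q.
rewrite [LHS](rkhs_ptE k).
rewrite [RHS](_ : _ = a * rkhs_pt k (x, d, y) q + rkhs_pt k (x, e, y) q)//.
rewrite !(rkhs_ptE k) /= /gns_fun /=.
have -> : Cb_star q.1.2 * (a *: d + e) = a *: (Cb_star q.1.2 * d) + Cb_star q.1.2 * e.
  by apply: Cb_ext => z; rewrite !(Cb_mulE, Cb_addE, Cb_scaleE); ring.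
by rewrite cp_kernel_lin bopDE bopZE hdotPl.
Qed.

Lemma gns_rep_lin : linear gns_rep_bop.
Proof.
move=> a d e; apply: bopext => g; apply/val_inj/funext => p.
rewrite [LHS](_ : _ = g (p.1.1, Cb_star (a *: d + e) * p.1.2, p.2))//.
rewrite [RHS](_ : _ =
  a * g (p.1.1, Cb_star d * p.1.2, p.2) + g (p.1.1, Cb_star e * p.1.2, p.2))//.
rewrite -!rkhs_repro.
have -> : Cb_star (a *: d + e) * p.1.2 = a^* *: (Cb_star d * p.1.2) + Cb_star e * p.1.2.
  rewrite Cb_starP.
  by apply: Cb_ext => z; rewrite !(Cb_mulE, Cb_addE, Cb_scaleE); ring.
by rewrite gns_pt_lin hdotDr hdotZr conjCK.
Qed.

Lemma gns_rep1 : gns_rep_bop 1 = bid H.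
Proof.
apply: bopext => g; apply/val_inj/funext => -[[x d] y].
by rewrite /= /gns_mul /= Cb_star1 mul1r.
Qed.

Lemma gns_repM d e : gns_rep_bop (d * e) = gns_rep_bop d \oB gns_rep_bop e.
Proof.
apply: bopext => g; apply/val_inj/funext => -[[x f] y].
rewrite /= /gns_mul /= Cb_starM mulrA; congr (rkhs_fun g (_, _ * _, _)).
exact: Cb_mulC.
Qed.

Lemma gns_rep_star d : gns_rep_bop (Cb_star d) = (gns_rep_bop d)^†.
Proof.
apply: bopext => h; apply/val_inj/funext => q.
rewrite [RHS](_ : _ = hdot ((gns_rep_bop d)^† h) (rkhs_pt k q)); last first.
  by rewrite rkhs_repro.
rewrite adjPr gns_rep_pt rkhs_repro.
by rewrite /= Cb_starK.
Qed.

Definition gns_rep : star_rep X H :=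
  StarRep gns_rep_lin gns_rep1 gns_repM gns_rep_star.

Lemma gns_hdot x d y x' d' y' :
  hdot (rkhs_pt k (x, d, y)) (rkhs_pt k (x', d', y')) =
  hdot (D x' x (Cb_star d' * d) y) y'.
Proof. by rewrite rkhs_repro rkhs_ptE. Qed.

Definition gns_h_fun x (y : Y) : H := rkhs_pt k (x, 1, y).

Lemma gns_h_linear x : linear (gns_h_fun x).
Proof.
move=> a y z; apply/val_inj/funext => q.
rewrite [LHS](rkhs_ptE k).
rewrite [RHS](_ : _ = a * rkhs_pt k (x, 1, y) q + rkhs_pt k (x, 1, z) q)//.
by rewrite !(rkhs_ptE k) /= /gns_fun /= bop_add bop_scale hdotPl.
Qed.

Lemma gns_h_continuous x : continuous (gns_h_fun x).
Proof.
have [M M0 DM] := bop_bounded (D x x 1).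
(* The squared norm of the image of u is at most M |u|^2, and M <= (M + 1)^2 avoids a square
   root. *)
apply: (@lipschitz_continuous _ _ _ _ (M + 1)); first by rewrite addr_ge0.
move=> y z; rewrite -(linear_subE (@gns_h_linear x)); set u := y - z.
rewrite -ler_sqr ?nnegrE ?mulr_ge0 ?addr_ge0// -hdotxx gns_hdot Cb_star1 mulr1.
rewrite -[leLHS]ger0_norm; last first.
  have := hdot_ge0 (gns_h_fun x u); rewrite gns_hdot Cb_star1 mulr1; exact.
rewrite (le_trans (hdot_CS _ _))//.
rewrite (@le_trans _ _ (M * `|u| * `|u|)) ?ler_wpM2r//.
rewrite -mulrA -expr2 exprMn ler_wpM2r ?exprn_ge0//.
rewrite sqrrD expr1n mulr1 -subr_ge0 (_ : _ - M = M ^+ 2 + M + 1); last by ring.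
by rewrite !addr_ge0 ?exprn_ge0.
Qed.

Definition gns_h x : 'B(Y, H) := mkbop (@gns_h_linear x) (@gns_h_continuous x).

(** Here h x is the adjoint of the operator called [kol_h] in [kolmogorov], and the factorisation is
    stated as an equality of inner products, the form in which [partial_isometry_ex] uses it. *)
Theorem kolmogorov_ex :
  exists (X1 : hilbertType R) (rho : star_rep X X1) (h : T -> 'B(Y, X1)),
  forall x d y x' d' y', hdot (rho d (h x y)) (rho d' (h x' y')) =
    hdot (D x' x (Cb_star d' * d) y) y'.
Proof.
exists H, gns_rep, gns_h => x d y x' d' y'.
have E z e w : gns_rep e (gns_h z w) = rkhs_pt k (z, e, w).
  rewrite [LHS](gns_rep_pt e (z, 1, w)) /gns_mul /=; congr (rkhs_pt k (_, _, _)).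
  exact: mulr1.
by rewrite !E gns_hdot.
Qed.

End Kolmogorov.

(** * Transfer functions in the Schur-Agler class *)

Section StarRep.
Variables (R : realType) (X : topologicalType) (H : hilbertType R).
Variable rho : star_rep X H.
Local Notation A := (Cb R X).

Lemma star_rep_adj (d : A) u v : hdot (rho d u) v = hdot u (rho (Cb_star d) v).
Proof. by rewrite rep_star adjP. Qed.

Lemma star_repP (a : R[i]) (d e : A) u : rho (a *: d + e) u = a *: rho d u + rho e u.
Proof. by rewrite (rep_linear rho). Qed.

Lemma star_rep1 u : rho 1 u = u.
Proof. by rewrite rep1. Qed.

Lemma star_repM (d e : A) u : rho (d * e) u = rho d (rho e u).
Proof. by rewrite repM. Qed.

Lemma star_rep0 u : rho 0 u = 0.
Proof. by apply: double_eq0; have := star_repP 1 0 0 u; rewrite !scale1r addr0. Qed.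

Lemma star_repZ (a : R[i]) (d : A) u : rho (a *: d) u = a *: rho d u.
Proof. by have := star_repP a d 0 u; rewrite star_rep0 !addr0. Qed.

Lemma star_repB (d e : A) u : rho (d - e) u = rho d u - rho e u.
Proof. by have := star_repP (-1) e d u; rewrite !scaleN1r addrC => ->; rewrite addrC. Qed.

Definition operator_rep : form_rep R X :=
  @FormRep R X H (@hdot R H) (fun d => rho d) (@hdotPl R H) (@hdotC R H)
    (@hdot_ge0 R H) star_repP star_rep1 star_repM (fun d => @bop_linear _ _ _ (rho d))
    star_rep_adj.

(** The function c^2 - d^* d is nonnegative, so rho maps it to a positive operator. *)
Lemma star_rep_norm (d : A) (c : R[i]) : 0 <= c -> (forall x, `|d x| <= c) ->
  forall u, `|rho d u| <= c * `|u|.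
Proof.
move=> c0 dc u.
have pos x : 0 <= (c ^+ 2 *: (1 : A) - Cb_star d * d) x.
  rewrite Cb_subE Cb_scaleE Cb_1E Cb_mulE Cb_starE mulr1 mulrC -normCK subr_ge0.
  by rewrite ler_sqr ?nnegrE.
have := @fr_act_pos _ _ operator_rep _ u pos.
rewrite fr_actB fr_formDl /=.
rewrite star_repZ star_rep1.
rewrite -scaleN1r !hdotZl mulN1r star_repM -{1}(Cb_starK (Cb_star d)).
rewrite Cb_starK star_rep_adj Cb_starK subr_ge0 => h.
by rewrite -ler_sqr ?nnegrE ?mulr_ge0// exprMn -!hdotxx.
Qed.

End StarRep.

Section ScalarRep.
Variables (R : realType) (H : hilbertType R) (B : 'B(H, H)).
Hypothesis Bpos : bpos B.
Hypothesis Bsym : forall u v, hdot (B u) v = hdot u (B v).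
Local Notation A := (Cb R R[i]).

Lemma scalar_rep_formPl (a : R[i]) u v w :
  hdot (B (a *: u + v)) w = a * hdot (B u) w + hdot (B v) w.
Proof. by rewrite bop_add bop_scale hdotPl. Qed.

Lemma scalar_rep_formC u v : hdot (B u) v = (hdot (B v) u)^*.
Proof. by rewrite Bsym -hdotC. Qed.

Lemma scalar_rep_actP (a : R[i]) (d e : A) (u : H) :
  (a *: d + e) 0 *: u = a *: (d 0 *: u) + e 0 *: u.
Proof. by rewrite Cb_addE Cb_scaleE scalerDl scalerA. Qed.

Lemma scalar_rep_act1 (u : H) : (1 : A) 0 *: u = u.
Proof. by rewrite Cb_1E scale1r. Qed.

Lemma scalar_rep_actM (d e : A) (u : H) : (d * e) 0 *: u = d 0 *: (e 0 *: u).
Proof. by rewrite Cb_mulE scalerA. Qed.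

Lemma scalar_rep_actl (d : A) : linear (fun u : H => d 0 *: u).
Proof. by move=> a u v; rewrite scalerDr !scalerA mulrC. Qed.

Lemma scalar_rep_adj (d : A) (u v : H) :
  hdot (B (d 0 *: u)) v = hdot (B u) (Cb_star d 0 *: v).
Proof. by rewrite bop_scale hdotZl hdotZr Cb_starE conjCK. Qed.

(** The space [R[i]] and its point 0 are an arbitrary choice: [schur_product] applies this only to
    constant functions, where [rho_form_ge0] becomes Schur's theorem on entrywise products. *)
Definition scalar_rep : form_rep R R[i] :=
  FormRep scalar_rep_formPl scalar_rep_formC Bpos scalar_rep_actP
    scalar_rep_act1 scalar_rep_actM scalar_rep_actl scalar_rep_adj.

Lemma schur_product N (k : 'I_N -> 'I_N -> R[i]) (u : 'I_N -> H) :
  (forall p q, (k p q)^* = k q p) ->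
  (forall c : 'I_N -> R[i], 0 <= \sum_p \sum_q k p q * c q * (c p)^*) ->
  0 <= \sum_p \sum_q k p q * hdot (B (u q)) (u p).
Proof.
move=> ks kpos; pose F p q : A := k p q *: (1 : A).
have FE p q x : F p q x = k p q by rewrite Cb_scaleE Cb_1E mulr1.
have -> : \sum_p \sum_q k p q * hdot (B (u q)) (u p) = @rho_form _ _ scalar_rep N F u.
  apply: eq_bigr => p _; apply: eq_bigr => q _.
  by rewrite [RHS](_ : _ = hdot (B (F p q 0 *: u q)) (u p))// FE bop_scale hdotZl.
apply: rho_form_ge0 => [p q|x c]; first by apply: Cb_ext => x; rewrite Cb_starE !FE.
have := kpos c; congr (0 <= _); apply: eq_bigr => p _; apply: eq_bigr => q _.
by rewrite [RHS](_ : _ = F p q x * c q * (c p)^*)// FE.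
Qed.

End ScalarRep.

Section SchurAgler.
Variables (R : realType) (T : Type) (Psi : testFunctions R T).

Section AdmissibleKernel.
Variables (Y : hilbertType R) (k : T -> T -> 'B(Y, Y)).
Hypothesis kadm : admissible Psi k.

Lemma admissible_herm x y u v : hdot (k x y u) v = (hdot (k y x v) u)^*.
Proof.
have [_ [H [fn [[_ _ [K [Kk Krep _]]] _]]]] := kadm.
have E a b w z : hdot (k a b w) z = hdot (K b w) (K a z).
  by rewrite Krep Kk.
by rewrite !E -hdotC.
Qed.

(** The sum is |g|^2 - |h|^2, with h the adjoint of multiplication by psi applied to g. The adjoint
    need not be formed: f = psi h satisfies <f, g> = |h|^2, whence |h|^2 <= |f| |g| <= |h| |g|. *)
Lemma admissible_pos N (x : 'I_N -> T) (v : 'I_N -> Y) (c : 'I_N -> R[i]) psi :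
  tf_set Psi psi ->
  0 <= \sum_p \sum_q hdot (k (x p) (x q) (v q)) (v p) *
    (1 - psi (x p) * (psi (x q))^*) * c q * (c p)^*.
Proof.
have [_ [H [fn [[fnl _ [K [Kk Krep _]]] mult]]]] := kadm => Ppsi.
have E a b w z : hdot (k a b w) z = hdot (K b w) (K a z).
  by rewrite Krep Kk.
pose g := \sum_p c p *: K (x p) (v p).
pose h := \sum_p (psi (x p))^* *: (c p *: K (x p) (v p)).
have -> : \sum_p \sum_q hdot (k (x p) (x q) (v q)) (v p) *
    (1 - psi (x p) * (psi (x q))^*) * c q * (c p)^* = hdot g g - hdot h h.
  rewrite !hdot_sumr -sumrB; apply: eq_bigr => p _.
  rewrite !hdot_suml -sumrB; apply: eq_bigr => q _.
  by rewrite E !hdotZl !hdotZr conjCK; ring.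
rewrite subr_ge0 -ler_hnorm.
have [f fE fh] := mult _ Ppsi h.
have hh : hdot f g = hdot h h.
  rewrite !hdot_sumr; apply: eq_bigr => p _.
  by rewrite !hdotZr !Krep fE hdotZl conjCK; ring.
have [->|h0] := eqVneq h 0; first by rewrite normr0.
rewrite -(ler_pM2l (_ : 0 < `|h|)) ?normr_gt0// -expr2 -hdotxx -hh.
rewrite -[leLHS]ger0_norm; last by rewrite hh hdot_ge0.
by rewrite (le_trans (hdot_CS _ _))// ler_wpM2r.
Qed.

End AdmissibleKernel.

Section Transfer.
Variables (X M1 M2 : hilbertType R) (rho : star_rep (tf_space Psi) X).
Variables (S : 'B(hsum X M1, hsum X M2)) (t : T -> 'B(M1, M2)) (h : T -> M2 -> X).
Hypothesis Sle : forall w, `|S w| <= `|w|.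
Hypothesis St : forall x m,
  S^† ((rho (ev Psi x))^† (h x m), m) = (h x m, (t x)^† m).

(* I - t(x) t(y)^† is the sum of the kernel of rho (1 - E(x) E(y)^†) at h and of the
   positive kernel of I - S S^†; k multiplies both to positive kernels. *)
Lemma transfer_kernel_pos (k : T -> T -> 'B(M2, M2)) (s : seq (T * M2 * M2)) :
  admissible Psi k ->
  0 <= \sum_(a <- s) \sum_(b <- s)
    hdot ((bid M2 - t a.1.1 \oB (t b.1.1)^†) b.1.2) a.1.2 *
    hdot (k a.1.1 b.1.1 b.2) a.2.
Proof.
have tE a b w z : hdot ((bid M2 - t a \oB (t b)^†) w) z =
    hdot w z - hdot ((t b)^† w) ((t a)^† z).
  by rewrite bopBE hdotBl -(adjP (t a)).
move=> kadm; rewrite big_tnth.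
under eq_bigr do (rewrite big_tnth; under eq_bigr do rewrite tE).
set N := size s; set p_ := tnth _.
pose x i := (p_ i).1.1; pose u i := (p_ i).1.2; pose v i := (p_ i).2.
pose kk i j := hdot (k (x i) (x j) (v j)) (v i).
have ks i j : (kk i j)^* = kk j i by rewrite /kk [RHS](admissible_herm kadm).
pose E i := ev Psi (x i).
pose F i j : Cb R (tf_space Psi) := kk i j *: (1 - E i * Cb_star (E j)).
pose xi i : hsum X M2 := ((rho (E i))^† (h (x i) (u i)), u i).
have [B BE] : exists B : 'B(hsum X M2, hsum X M2),
    forall a b, hdot (B a) b = hdot a b - hdot (S^† a) (S^† b).
  by exists (bid _ - S \oB S^†) => a b; rewrite bopBE hdotBl -(adjP S).
(* Schur product of the scalar matrix kk with the Gram matrix of the defect I - S S^† at the vectors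
   xi. *)
have S1 : 0 <= \sum_i \sum_j kk i j * hdot (B (xi j)) (xi i).
  apply: schur_product => //.
  - move=> a; rewrite BE subr_ge0 -ler_hnorm; exact: norm_adj1.
  - by move=> a b; rewrite BE [RHS]hdotC BE rmorphB /= -!hdotC.
  - move=> c; have := kadm.1 N x (fun i => c i *: v i).
    congr (0 <= _); apply: eq_bigr => i _; apply: eq_bigr => j _.
    by rewrite bop_scale hdotZl hdotZr /kk; ring.
(* Pointwise in psi, F is positive by admissibility of k; complete positivity carries this over to
   rho. *)
have S2 : 0 <= \sum_i \sum_j hdot (rho (F i j) (h (x j) (u j))) (h (x i) (u i)).
  apply: (@rho_form_ge0 _ _ (operator_rep rho) N F (fun i => h (x i) (u i))).
    move=> i j; apply: Cb_ext => psi.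
    rewrite Cb_starE !Cb_scaleE !Cb_subE !Cb_mulE !Cb_starE Cb_1E.
    rewrite rmorphM rmorphB rmorphM /= conjC1 conjCK ks; congr (_ * (_ - _)).
    exact: mulrC.
  move=> psi c.
  have := admissible_pos kadm x v c (set_mem (valP (psi : tf_set Psi))).
  by congr (0 <= _); apply: eq_bigr => i _; apply: eq_bigr => j _.
(* By [St], the terms in h and in rho(E)^† h of the two sums cancel, which leaves I - t t^†. *)
apply: le_trans (addr_ge0 S1 S2) _; rewrite le_eqVlt; apply/orP; left; apply/eqP.
rewrite -big_split; apply: eq_bigr => i _; rewrite -big_split; apply: eq_bigr => j _ /=.
have -> : hdot (rho (F i j) (h (x j) (u j))) (h (x i) (u i)) =
    kk i j * (hdot (h (x j) (u j)) (h (x i) (u i)) -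
      hdot ((rho (E j))^† (h (x j) (u j))) ((rho (E i))^† (h (x i) (u i)))).
  rewrite star_repZ hdotZl star_repB hdotBl star_rep1 star_repM rep_star.
  by rewrite [X in _ * (_ - X) = _]adjP.
rewrite BE !St !hsumE /= -/(x i) -/(x j) -/(u i) -/(u j) -/(v i) -/(v j) -/(kk i j).
by ring.
Qed.

(* By transfer_kernel_pos on elementary tensors, then by density. *)
Lemma transfer_schur_agler : schur_agler Psi t.
Proof.
move=> k kadm W tn [tnl tnr tnd tnf] K Kt n x e.
pose tsum (s : seq (M2 * M2)) : W := \sum_(a <- s) tn a.1 a.2.
have dense (w : W) m : exists s, `|w - tsum s| <= m.+1%:R^-1.
  have tsub : subspace_pred [set w | exists s, w = tsum s].
    split; first by exists [::]; rewrite /tsum big_nil.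
    move=> a _ _ [s ->] [r ->].
    exists ([seq (a *: p.1, p.2) | p <- s] ++ r).
    rewrite /tsum big_cat big_map scaler_sumr; congr (_ + _).
    apply: eq_bigr => p _ /=.
    by have := tnl p.2 a p.1 0; rewrite addr0 => ->; rewrite (_ : tn 0 _ = 0) ?addr0//;
      apply: double_eq0; have := tnl p.2 1 0 0; rewrite !scale1r addr0.
  have cw : closure (lspan [set w | exists u v, w = tn u v]) w.
    have : csub_set (cspan [set w | exists u v, w = tn u v]) w by rewrite tnf.
    by [].
  have e0 : 0 < m.+1%:R^-1 :> R[i] by rewrite invr_gt0.
  have [y [ly]] := cw _ (nbhsx_ballx w _ e0).
  have [s ->] : [set w | exists s, w = tsum s] y.
    apply: ly; split => // _ [u [v ->]].
    by exists [:: (u, v)]; rewrite /tsum big_seq1.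
  by rewrite -ball_normE /= => /ltW ws; exists s.
pose app (m : nat) (i : 'I_n) := projT1 (cid (dense (e i) m)).
have appP m i : `|e i - tsum (app m i)| <= m.+1%:R^-1 by rewrite /app; case: cid.
(* Expanding the sums of tensors gives one triple (x i, u, v) for each elementary tensor of the i-th
   approximation. *)
have pos m : 0 <= \sum_(i < n) \sum_(j < n)
    hdot (K (x i) (x j) (tsum (app m j))) (tsum (app m i)).
  have := @transfer_kernel_pos k
    [seq (x i, p.1, p.2) | i <- enum 'I_n, p <- app m i] kadm.
  congr (0 <= _); rewrite big_allpairs_dep big_enum; apply: eq_bigr => i _.
  under eq_bigr do rewrite big_allpairs_dep big_enum.
  rewrite exchange_big; apply: eq_bigr => j _ /=.
  rewrite hdot_sumr; apply: eq_bigr => p _.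
  rewrite (big_morph (fun w => K (x i) (x j) w) (id1 := 0) (op1 := +%R)); first last.
  - exact: bop_zero.
  - exact: bop_add.
  by rewrite hdot_suml; apply: eq_bigr => q _; rewrite Kt tnd.
have bil (A : 'B(W, W)) (u v : W) : exists C : R[i], 0 <= C /\
    forall m u' v', `|u - u'| <= m.+1%:R^-1 -> `|v - v'| <= m.+1%:R^-1 ->
    `|hdot (A u) v - hdot (A u') v'| <= C * m.+1%:R^-1.
  have [M M0 AM] := bop_bounded A.
  (* The last M bounds the term that is quadratic in the error, as 1/(m+1) <= 1. *)
  exists (M * `|v| + M * `|u| + M); split; first by rewrite !addr_ge0 ?mulr_ge0.
  move=> m u' v' uu vv.
  have m0 : 0 <= m.+1%:R^-1 :> R[i] by rewrite invr_ge0.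
  have m1 : m.+1%:R^-1 <= 1 :> R[i] by rewrite invf_le1 ?ler1n.
  rewrite (_ : hdot (A u) v - hdot (A u') v' = hdot (A (u - u')) v
    + hdot (A u) (v - v') - hdot (A (u - u')) (v - v')); last first.
    by rewrite bop_sub !hdotBl !hdotBr; ring.
  rewrite 2!mulrDl (le_trans (ler_normB _ _))// lerD//.
    rewrite (le_trans (ler_normD _ _))// lerD//.
      rewrite (le_trans (hdot_CS _ _))// mulrAC ler_wpM2r// (le_trans (AM _))//.
      by rewrite ler_wpM2l.
    rewrite (le_trans (hdot_CS _ _))// ler_pM//; exact: AM.
  rewrite (le_trans (hdot_CS _ _))// ler_pM// (le_trans (AM _))//.
  by rewrite ler_piMr// (le_trans uu).
pose C i j := projT1 (cid (bil (K (x i) (x j)) (e j) (e i))).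
have C0 i j : 0 <= C i j by rewrite /C; case: cid => c [].
have CP i j m : `|hdot (K (x i) (x j) (e j)) (e i) -
    hdot (K (x i) (x j) (tsum (app m j))) (tsum (app m i))| <= C i j * m.+1%:R^-1.
  by have [_ cP] := projT2 (cid (bil (K (x i) (x j)) (e j) (e i))); apply: cP.
pose Cs := \sum_(i < n) \sum_(j < n) C i j.
have Cs0 : 0 <= Cs by apply: sumr_ge0 => i _; apply: sumr_ge0.
apply: ge0_approx => d d0.
have [m me] := complex_archi (divr_gt0 d0 (ltr_wpDl Cs0 ltr01)).
exists (\sum_(i < n) \sum_(j < n)
  hdot (K (x i) (x j) (tsum (app m j))) (tsum (app m i))) => //.
rewrite -sumrB (le_trans (ler_norm_sum _ _ _))//.
apply: (@le_trans _ _ (Cs * m.+1%:R^-1)); last first.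
  apply: (@le_trans _ _ ((Cs + 1) * m.+1%:R^-1)).
    by rewrite ler_wpM2r ?invr_ge0// lerDl.
  by rewrite mulrC -ler_pdivlMr ?ltr_wpDl// ltW.
rewrite mulr_suml ler_sum// => i _; rewrite -sumrB (le_trans (ler_norm_sum _ _ _))//.
by rewrite mulr_suml ler_sum.
Qed.

End Transfer.

End SchurAgler.

Lemma hsum_pairE (R : realType) (U V : hilbertType R) (p r : U) (q s : V) :
  hdot ((p, q) : hsum U V) (r, s) = hdot p r + hdot q s.
Proof. by []. Qed.

Lemma hproj_dot (R : realType) (U : hilbertType R) (W : csubspace U) (w : csub W) x :
  hdot w (hproj W x) = hdot (csub_val w) x.
Proof. by rewrite -adj_bincl -adjP. Qed.

(** * Feedback loops *)

Section BlockEntries.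
Variables (R : realType) (A1 A2 C1 C2 : hilbertType R).
Variable T : 'B(hsum A1 A2, hsum C1 C2).

Lemma b11E a : b11 T a = (T (a, 0)).1. Proof. by []. Qed.
Lemma b12E a : b12 T a = (T (0, a)).1. Proof. by []. Qed.
Lemma b21E a : b21 T a = (T (a, 0)).2. Proof. by []. Qed.
Lemma b22E a : b22 T a = (T (0, a)).2. Proof. by []. Qed.

Lemma hsum_split (U V : hilbertType R) (u : U) (v : V) :
  ((u, v) : hsum U V) = (u, 0) + (0, v).
Proof. by rewrite [RHS](_ : _ = (u + 0, 0 + v))// addr0 add0r. Qed.

Lemma blockE a b : T (a, b) = (b11 T a + b12 T b, b21 T a + b22 T b).
Proof.
rewrite hsum_split bop_add b11E b12E b21E b22E.
by case: (T (a, 0)) => ? ?; case: (T (0, b)).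
Qed.

End BlockEntries.

Section LinearFractional.
Variables (R : realType) (M1 M2 U Y : hilbertType R).
Variables (G : 'B(hsum M2 U, hsum M1 Y)) (t : 'B(M1, M2)) (f : 'B(U, Y)).

(** A right inverse of an injective operator is two-sided. The halves are supplied by
    [feedback_right_inverse] and [feedback_inj]. *)
Lemma binvertible_loop (Rinv : 'B(M2, M2)) :
  (forall m, Rinv m - t (b11 G (Rinv m)) = m) ->
  (forall m, m = t (b11 G m) -> m = 0) -> binvertible (bid M2 - t \oB b11 G).
Proof.
move=> RK inj; have TE m : (bid M2 - t \oB b11 G) m = m - t (b11 G m) by [].
exists Rinv; split; apply: bopext => m; rewrite bcompE TE ?RK//.
have := RK (m - t (b11 G m)); set k := Rinv _ => kE.
apply/eqP; rewrite -subr_eq0; apply/eqP/inj/eqP.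
by rewrite !bop_sub -subr_eq0 opprD addrACA -opprD kE subrr.
Qed.

Lemma linear_fractionalE :
  (forall m u, m = t (b11 G m + b12 G u) -> f u = b21 G m + b22 G u) ->
  binvertible (bid M2 - t \oB b11 G) ->
  f = b22 G + b21 G \oB binv (bid M2 - t \oB b11 G) \oB t \oB b12 G.
Proof.
move=> h inv; apply: bopext => u; rewrite bopDE addrC; apply: h.
set I := binv _; have TE m : (bid M2 - t \oB b11 G) m = m - t (b11 G m) by [].
have := congr1 (fun T : 'B(M2, M2) => T (t (b12 G u))) (binvP inv).2.
by rewrite bcompE TE -/I bop_add => /eqP; rewrite subr_eq addrC => /eqP.
Qed.

End LinearFractional.

Section TransferFunction.
Variables (R : realType) (A P Q : hilbertType R).
Variables (S : 'B(hsum A P, hsum A Q)) (E : 'B(A, A)) (c : R[i]).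
Hypotheses (c0 : 0 <= c) (c1 : c < 1).
Hypothesis Sle : forall w, `|S w| <= `|w|.
Hypothesis Ele : forall a, `|E a| <= c * `|a|.

(* transfer z = w holds exactly when S (E a, z) = (a, w) for some a. *)
Definition transfer : 'B(P, Q) :=
  b22 S + b21 S \oB binv (bid A - E \oB b11 S) \oB E \oB b12 S.

Lemma hsum_norm_inl (U V : hilbertType R) (u : U) : `|(u, 0) : hsum U V| = `|u|.
Proof.
by apply/eqP; rewrite eq_le !ler_hnorm !hsumE /= !hdot0l addr0 lexx.
Qed.

Lemma b11_le (U V W : hilbertType R) (B : 'B(hsum U V, hsum U W)) :
  (forall w, `|B w| <= `|w|) -> forall a, `|b11 B a| <= `|a|.
Proof.
move=> Ble a; rewrite -(hsum_norm_inl V a) (le_trans _ (Ble _))//.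
exact: (hsum_norm_fst (B (a, 0))).
Qed.

Lemma transfer_inv : is_binv (bid A - E \oB b11 S) (binv (bid A - E \oB b11 S)).
Proof.
apply/binvP/(binvertible_sub1 c1) => a; rewrite (le_trans (Ele _))//.
by rewrite ler_wpM2l// b11_le.
Qed.

Lemma transfer_ex z : exists a, S (E a, z) = (a, transfer z).
Proof.
pose l := binv (bid A - E \oB b11 S) (E (b12 S z)).
exists (b11 S l + b12 S z).
have -> : E (b11 S l + b12 S z) = l.
  have : (bid A - E \oB b11 S) l = E (b12 S z).
    by rewrite /l -bcompE transfer_inv.2.
  rewrite bopBE bop_add => <-.
  by rewrite [X in _ + X](_ : _ = l - E (b11 S l))// addrC subrK.
by rewrite blockE [transfer z](_ : _ = b22 S z + b21 S l)// [b22 S z + _]addrC.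
Qed.

Lemma transfer_fix a y : S (E a, 0) = (a, y) -> a = 0 /\ y = 0.
Proof.
move=> h; have a0 : a = 0.
  have := hsum_norm_fst (S (E a, 0)); rewrite h /= => h1.
  have h2 : `|a| <= c * `|a|.
    rewrite (le_trans h1)// -h (le_trans (Sle _))// hsum_norm_inl.
    exact: Ele.
  have [//|n0] := eqVneq a 0.
  have : (1 - c) * `|a| <= 0 by rewrite mulrBl mul1r subr_le0.
  by rewrite pmulr_rle0 ?subr_gt0// normr_le0 => /eqP.
split=> //; move: h; rewrite a0 bop_zero.
by rewrite (_ : S (0, 0) = 0); [case|exact: bop_zero].
Qed.

Lemma transfer_uniq a z w : S (E a, z) = (a, w) -> w = transfer z.
Proof.
move=> h; have [b hb] := transfer_ex z.
have : S (E (a - b), 0) = (a - b, w - transfer z).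
  rewrite (_ : (E (a - b), 0) = ((E a, z) : hsum A P) - (E b, z)); last first.
    by rewrite bop_sub [RHS](_ : _ = (E a - E b, z - z))// subrr.
  by rewrite bop_sub h hb.
by move=> /transfer_fix[_ /eqP]; rewrite subr_eq0 => /eqP.
Qed.

End TransferFunction.

Section TransferAdjoint.
Variables (R : realType) (A P Q : hilbertType R).
Variables (S : 'B(hsum A P, hsum A Q)) (E : 'B(A, A)) (c : R[i]).
Hypotheses (c0 : 0 <= c) (c1 : c < 1).
Hypothesis Sle : forall w, `|S w| <= `|w|.
Hypothesis Ele : forall a, `|E a| <= c * `|a|.

(** Pair the loop S (E a, z) = (a, .) with the adjoint loop S^† (E^† b, m) = (b, .): the state terms
    <a, E^† b> and <E a, b> cancel. *)
Lemma transfer_adj : transfer S^† E^† = (transfer S E)^†.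
Proof.
apply/esym/adj_eq => z m.
have [a ha] := transfer_ex c0 c1 Sle Ele z.
have [b hb] := transfer_ex c0 c1 (norm_adj1 Sle) (norm_adj c0 Ele) m.
have := adjP S (E a, z) (E^† b, m); rewrite ha hb !hsumE /= adjP => /addrI.
by [].
Qed.

End TransferAdjoint.

Section Feedback.
Variables (R : realType) (L X U Y : hilbertType R).
Variable J : 'B(L, X).
Hypothesis Jiso : forall l, J^† (J l) = l.

Definition Jperp := Defs.ortho (range J).
Local Notation X' := (csub Jperp).

Lemma Jperp_orth (b : X') l : hdot (csub_val b) (J l) = 0.
Proof. by apply: (csub_mem b); exists l. Qed.

Lemma Jadj_perp (b : X') : J^† (csub_val b) = 0.
Proof. by apply: hdot_inj => l; rewrite adjPr Jperp_orth hdot0l. Qed.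

Lemma Jperp_J l : hproj Jperp (J l) = 0.
Proof.
by apply: hproj_eq => b; rewrite subr0 hdotC Jperp_orth conjC0.
Qed.

Lemma Jdec x : x = J (J^† x) + csub_val (hproj Jperp x).
Proof.
apply/eqP; rewrite addrC -subr_eq; apply/eqP.
have Px : csub_set Jperp (x - J (J^† x)).
  by move=> _ [l _ <-]; rewrite hdotBl -[hdot (J _) _]adjPr Jiso adjPr subrr.
have [b bE] := csub_lift Px.
rewrite -bE; congr csub_val; apply/esym/hproj_eq => w.
by rewrite bE opprB addrC subrK hdotC Jperp_orth conjC0.
Qed.

Section Inclusion.
Variables (C : hilbertType R) (N : csubspace (hsum L C)).
Local Notation M := (csub (Defs.ortho (csub_set N))).

Definition Jsum : 'B(hsum L C, hsum X C) := bpair (J \oB bfst L C) (bsnd L C).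

Lemma Jsum_adj c y : Jsum^† (c, y) = (J^† c, y).
Proof.
by apply: hdot_injr => w; rewrite -adjP !hsumE /= adjP.
Qed.

Lemma Jsum_iso w : Jsum^† (Jsum w) = w.
Proof. by rewrite [Jsum w](_ : _ = (J w.1, w.2))// Jsum_adj Jiso; case: w. Qed.

(** An isometry onto the orthogonal complement of the copy of N in X (+) C: that complement consists
    of X' and of the copy of M. *)
Definition Jinc : 'B(hsum X' M, hsum X C) :=
  Jsum \oB bincl _ \oB bsnd _ _ + binl X C \oB bincl _ \oB bfst _ _.

Lemma JincE b m : Jinc (b, m) = Jsum (csub_val m) + (csub_val b, 0).
Proof. by []. Qed.

Lemma Jinc_adj x : Jinc^† x = (hproj Jperp x.1, hproj _ (Jsum^† x)).
Proof.
apply: hdot_injr => -[b m]; rewrite -adjP JincE hdotDl addrC.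
rewrite [hdot (Jsum _) _]adjP [X in X + _](_ : _ = hdot (csub_val b) x.1); last first.
  by rewrite hsumE /= hdot0l addr0.
rewrite [RHS](_ : _ = hdot b (hproj Jperp x.1) + hdot m (hproj _ (Jsum^† x)))//.
by rewrite !hproj_dot.
Qed.

Lemma Jsum_adj_inc w : Jsum^† (Jinc w) = csub_val w.2.
Proof.
case: w => b m; rewrite JincE bop_add Jsum_iso Jsum_adj Jadj_perp.
by rewrite [X in _ + X](_ : _ = 0)// addr0.
Qed.

Lemma Jinc_iso w : Jinc^† (Jinc w) = w.
Proof.
rewrite Jinc_adj Jsum_adj_inc hproj_id; case: w => b m; congr (_, _).
rewrite JincE [_.1](_ : _ = J (csub_val m).1 + csub_val b)// bop_add Jperp_J add0r.
exact: hproj_id.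
Qed.

Lemma csub_ortho_dec (w : hsum L C) :
  w = csub_val (hproj N w) + csub_val (hproj (Defs.ortho (csub_set N)) w).
Proof.
apply/eqP; rewrite addrC -subr_eq; apply/eqP.
have Px : csub_set (Defs.ortho (csub_set N)) (w - csub_val (hproj N w)).
  by move=> v Nv; have [n <-] := csub_lift Nv; exact: hprojP.
have [b bE] := csub_lift Px.
rewrite -bE; congr csub_val; apply/esym/hproj_eq => v.
rewrite bE opprB addrC subrK hdotC; have := csub_mem v => ->; first by rewrite conjC0.
exact: csub_mem.
Qed.

Lemma Jinc_dec x : x = Jsum (csub_val (hproj N (Jsum^† x))) + Jinc (Jinc^† x).
Proof.
case: x => c y; rewrite Jinc_adj JincE addrA -bop_add -csub_ortho_dec Jsum_adj.
rewrite [RHS](_ : _ = (J (J^† c) + csub_val (hproj Jperp c), y + 0))//.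
by rewrite addr0 -Jdec.
Qed.

Lemma Jinc_orth (n : csub N) w : hdot (Jinc w) (Jsum (csub_val n)) = 0.
Proof.
rewrite -[LHS]adjPr Jsum_adj_inc.
by have h := csub_mem w.2; exact: (h _ (csub_mem n)).
Qed.

Lemma Jinc_le w : `|Jinc w| <= `|w|.
Proof. by rewrite ler_hnorm -[hdot (Jinc _) _]adjPr Jinc_iso lexx. Qed.

End Inclusion.

Variables (N1 : csubspace (hsum L U)) (N2 : csubspace (hsum L Y)).
Local Notation M1 := (csub (Defs.ortho (csub_set N1))).
Local Notation M2 := (csub (Defs.ortho (csub_set N2))).
Variable V : 'B(csub N2, csub N1).
Hypothesis Vun : unitary V.

Definition colligation : 'B(hsum L (hsum M1 Y), hsum L (hsum M2 U)) :=
  regroup M2 N1 \oB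
  bpair (V \oB bfst _ _) (bpair (bsnd _ _ \oB bsnd _ _) (bfst _ _ \oB bsnd _ _)) \oB
  (regroup M1 N2)^†.

Lemma regroup_adj (A C M : hilbertType R) (N : csubspace (hsum A C)) a k c :
  (regroup M N)^† (a, (k, c)) =
  (hproj N (a, c), (hproj (Defs.ortho (csub_set N)) (a, c), k)).
Proof.
apply: hdot_injr => -[n [m k']]; rewrite -adjP.
rewrite [regroup M N _](_ : _ =
  ((csub_val n + csub_val m).1, (k', (csub_val n + csub_val m).2)))//.
rewrite !hsum_pairE !hproj_dot !hsumE /= !hdotDl; ring.
Qed.

Lemma colligation_adj l m2 u : colligation^† (l, (m2, u)) =
  let s := csub_val (V^† (hproj N1 (l, u))) + csub_val m2 in
  (s.1, (hproj (Defs.ortho (csub_set N1)) (l, u), s.2)).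
Proof.
rewrite /colligation adj_comp adj_comp adjK !bcompE regroup_adj.
set q := bpair _ _; have -> n m k : q^† (n, (m, k)) = (V^† n, (k, m)).
  apply: hdot_injr => -[a [b d]]; rewrite -adjP /q !hsumE /= adjP.
  by congr (_ + _); rewrite addrC.
by [].
Qed.

Variable S : 'B(hsum X U, hsum X Y).
Hypothesis Sle : forall w, `|S w| <= `|w|.
Hypothesis SV : forall n2, S (Jsum U (csub_val (V n2))) = Jsum Y (csub_val n2).
Hypothesis SVadj : forall n2, S^† (Jsum Y (csub_val n2)) = Jsum U (csub_val (V n2)).

(* Under SV, S is the direct sum of the inverse of V and of this contraction. *)
Definition residual : 'B(hsum X' M1, hsum X' M2) := (Jinc N2)^† \oB S \oB Jinc N1.

Lemma residual_le w : `|residual w| <= `|w|.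
Proof.
have adj_le v : `|(Jinc N2)^† v| <= `|v| by apply: norm_adj1; exact: Jinc_le.
have rE : residual w = (Jinc N2)^† (S (Jinc N1 w)).
  exact: erefl.
rewrite rE.
exact: le_trans (adj_le _) (le_trans (Sle _) (Jinc_le w)).
Qed.

(** By [SVadj], S maps the complement of the copy of N_1 into that of N_2, so the compression in
    [residual] loses nothing. *)
Lemma residualE w : S (Jinc N1 w) = Jinc N2 (residual w).
Proof.
rewrite {1}(Jinc_dec N2 (S (Jinc N1 w))) (hproj_eq (p := 0)); last first.
  by move=> n2; rewrite subr0 adjPr adjP SVadj Jinc_orth.
by rewrite bop_zero add0r.
Qed.

Lemma colligation_adj_le w : `|colligation^† w| <= `|w|.
Proof.
case: w => l [m2 u]; rewrite colligation_adj.
set n1 := hproj N1 (l, u); set m1 := hproj (Defs.ortho (csub_set N1)) (l, u).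
rewrite ler_hnorm le_eqVlt; apply/orP; left; apply/eqP.
set v := V^† n1.
have vv : hdot v v = hdot n1 n1 by rewrite adjPr -[V _](bcompE V V^†) Vun.2.
have vm : hdot (csub_val v) (csub_val m2) = 0.
  by rewrite hdotC; have h := csub_mem m2; rewrite (h _ (csub_mem v)) conjC0.
have nm : hdot (csub_val n1) (csub_val m1) = 0.
  by rewrite hdotC; have h := csub_mem m1; rewrite (h _ (csub_mem n1)) conjC0.
rewrite [RHS](_ : _ = hdot m2 m2 + hdot ((l, u) : hsum L U) (l, u)); last first.
  by rewrite !hsum_pairE addrCA.
rewrite (csub_ortho_dec N1 (l, u)) -/n1 -/m1.
rewrite [LHS](_ : _ = hdot m1 m1 +
    hdot (csub_val v + csub_val m2) (csub_val v + csub_val m2)); last first.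
  by rewrite hsum_pairE hsum_pairE [in RHS]hsumE addrCA.
rewrite !hdotDl !hdotDr vm nm [hdot (csub_val m2) (csub_val v)]hdotC vm.
rewrite [hdot (csub_val m1) (csub_val n1)]hdotC nm conjC0 -!csubE vv.
by ring.
Qed.

Variables (E : 'B(L, L)) (EX : 'B(X, X)) (c : R[i]).
Hypotheses (c0 : 0 <= c) (c1 : c < 1).
Hypothesis Ele : forall l, `|E l| <= c * `|l|.
Hypothesis EXle : forall x, `|EX x| <= c * `|x|.
Hypothesis JE : forall l, J (E l) = EX (J l).
Hypothesis JEadj : forall x, J^† (EX x) = E (J^† x).

(** The projection only adjusts the codomain: by [JEadj] the subspace X' is invariant under EX, see
    [compressE]. *)
Definition compress : 'B(X', X') := hproj Jperp \oB EX \oB bincl Jperp.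

Lemma compressE b : csub_val (compress b) = EX (csub_val b).
Proof.
have Eb : csub_set Jperp (EX (csub_val b)).
  by move=> _ [l _ <-]; rewrite -adjPr JEadj Jadj_perp bop_zero hdot0l.
have [e eE] := csub_lift Eb.
by rewrite /compress !bcompE [bincl _ b](_ : _ = csub_val b)// -eE hproj_id.
Qed.

Lemma compress_le b : `|compress b| <= c * `|b|.
Proof. by rewrite [leLHS](_ : _ = `|csub_val (compress b)|)// compressE; exact: EXle. Qed.

Local Notation G := (transfer colligation^† E).
Local Notation t := (transfer residual compress).
Local Notation f := (transfer S EX).

Lemma EX_split a b u : ((EX (J a + csub_val b), u) : hsum X U) =
  Jsum U (csub_val (hproj N1 (E a, u))) +
  Jinc N1 (compress b, hproj (Defs.ortho (csub_set N1)) (E a, u)).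
Proof.
rewrite JincE addrA -bop_add -csub_ortho_dec.
rewrite [RHS](_ : _ = (J (E a) + csub_val (compress b), u + 0))//.
by rewrite addr0 bop_add JE compressE.
Qed.

(* Closing the loop between colligation^† and residual gives back S; the vector m is
   the defect in the equation m2 = t m1. *)
Lemma feedback_loop m2 u m a b m1 y :
  colligation^† (E a, (m2, u)) = (a, (m1, y)) ->
  residual (compress b, m1) = (b, m2 - m) ->
  S (EX (J a + csub_val b), u) = (J a + csub_val b, y) - Jsum Y (csub_val m).
Proof.
rewrite colligation_adj EX_split bop_add residualE.
set n1 := hproj N1 _; set k1 := hproj (Defs.ortho _) _ => -[sa <- sy] ->.
have <- : V (V^† n1) = n1 by rewrite -[V _](bcompE V V^†) Vun.2.
rewrite SV JincE addrA -bop_add [csub_val (m2 - m)](_ : _ = csub_val m2 - csub_val m)//.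
rewrite addrA bop_sub addrAC; congr (_ - _).
rewrite [RHS](_ : _ = Jsum Y (a, y) + (csub_val b, 0)); last first.
  by rewrite [RHS](_ : _ = (J a + csub_val b, y + 0))// addr0.
by have -> : (a, y) = csub_val (V^† n1) + csub_val m2 by rewrite -sa -sy.
Qed.

Let G_ex := transfer_ex c0 c1 colligation_adj_le Ele.
Let t_ex := transfer_ex c0 c1 residual_le compress_le.

(** A solution of m2 = t G_11 m2 closes the loop of S with input 0, so the state J a + b and the
    output vanish. With a = 0 the colligation merely splits m2 into its two coordinates, and both
    are then 0. *)
Lemma feedback_inj m2 : m2 = t (b11 G m2) -> m2 = 0.
Proof.
move=> m2E; have [a aE] := G_ex (m2, 0).
have [b bE] := t_ex (G (m2, 0)).1.
have aE' : colligation^† (E a, (m2, 0)) = (a, ((G (m2, 0)).1, (G (m2, 0)).2)).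
  by rewrite aE -surjective_pairing.
have bE' : residual (compress b, (G (m2, 0)).1) = (b, m2 - 0).
  by rewrite bE subr0 [in RHS]m2E.
have := feedback_loop aE' bE'.
rewrite [csub_val 0](_ : _ = 0)// bop_zero subr0.
move=> /(transfer_fix c1 Sle EXle)[cz yz].
have az : a = 0.
  have := congr1 J^† cz; rewrite bop_add Jiso Jadj_perp addr0 bop_zero; exact.
move: aE'; rewrite colligation_adj az bop_zero yz.
rewrite [(0, 0)](_ : _ = 0)// !bop_zero => h.
have s1 : (csub_val m2).1 = 0 by rewrite -[LHS]add0r; exact: (congr1 fst h).
have s2 : (csub_val m2).2 = 0 by rewrite -[LHS]add0r; exact: (congr1 (fun w => w.2.2) h).
by apply: hdot_eq0; rewrite csubE hsumE s1 s2 !hdot0l addr0.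
Qed.

(** [feedback_loop] read backwards: prescribing the defect m and the input 0 leaves an equation for
    the state in X alone. Its solution is Z m, and m2 is recovered from it. *)
Lemma feedback_right_inverse : exists Rinv : 'B(M2, M2),
  forall m, Rinv m - t (b11 G (Rinv m)) = m.
Proof.
pose Cinv := binv (bid X - EX \oB b11 S).
have [_ CK] := transfer_inv c0 c1 Sle EXle.
(* The inverse of I - S_11 EX, expressed through that of I - EX S_11. *)
pose C := bid X + b11 S \oB Cinv \oB EX.
have CE x : C x = b11 S (EX (C x)) + x.
  have : EX (C x) = Cinv (EX x).
    have : (bid X - EX \oB b11 S) (Cinv (EX x)) = EX x by rewrite -bcompE CK.
    rewrite bopBE => h.
    rewrite /C bopDE bop_add -[X in X + _]h.
    by rewrite [X in _ + X](_ : _ = EX (b11 S (Cinv (EX x))))// subrK.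
  by move=> ->; rewrite {1}/C bopDE addrC.
pose Z := C \oB J \oB bfst _ _ \oB bincl (Defs.ortho (csub_set N2)).
(* The second output of [residual] must be m2 - m. Its inputs are read off the state Z m: the X'
   part gives b, the L part a, and the M_1 component of (E a, 0) is m1. *)
pose Rinv : 'B(M2, M2) := bid _ + bsnd _ _ \oB residual \oB bpair
  (compress \oB hproj Jperp \oB Z)
  (hproj (Defs.ortho (csub_set N1)) \oB binl L U \oB E \oB J^† \oB Z).
exists Rinv => m.
have ZE : Z m = b11 S (EX (Z m)) + J (csub_val m).1 by exact: CE.
pose a := J^† (Z m); pose b := hproj Jperp (Z m).
pose m1 := hproj (Defs.ortho (csub_set N1)) (E a, 0).
pose n1 := hproj N1 (E a, 0).
pose y := (S (EX (Z m), 0)).2 + (csub_val m).2.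
have RE : Rinv m = m + (residual (compress b, m1)).2 by [].
have Zab : Z m = J a + csub_val b by exact: Jdec.
have loop : Jsum Y (csub_val (V^† n1)) + Jinc N2 (residual (compress b, m1)) =
    (Z m, y) - Jsum Y (csub_val m).
  rewrite -residualE -SV -[V _](bcompE V V^†) Vun.2 -bop_add -EX_split -Zab.
  rewrite [RHS](_ : _ = (Z m - J (csub_val m).1, y - (csub_val m).2))//.
  have -> : Z m - J (csub_val m).1 = (S (EX (Z m), 0)).1.
    by apply/eqP; rewrite subr_eq; apply/eqP; exact: ZE.
  by rewrite /y addrK -surjective_pairing.
(* The adjoint of [Jsum] extracts the L (+) Y part, which is the loop of the colligation. *)
have loopL : csub_val (V^† n1) + csub_val (Rinv m) = (a, y).
  have := congr1 (Jsum Y)^† loop.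
  rewrite bop_add bop_sub !Jsum_iso Jsum_adj_inc Jsum_adj => h.
  rewrite RE [csub_val (m + _)](_ : _ =
    csub_val m + csub_val (residual (compress b, m1)).2)//.
  by rewrite addrCA h addrC subrK.
(* The projection of the state onto X' gives the loop of [residual]. *)
have loopP : residual (compress b, m1) = (b, Rinv m - m).
  have -> : Rinv m - m = (residual (compress b, m1)).2 by rewrite RE [m + _]addrC addrK.
  rewrite [LHS]surjective_pairing; congr (_, _).
  have := congr1 (fun w => hproj Jperp w.1) loop.
  case: (residual _) => b' m' /=.
  rewrite -[X in X = _]/(hproj Jperp ((Jsum Y (csub_val (V^† n1)) + Jinc N2 (b', m')).1)).
  rewrite JincE [(_ + (_ + _)).1](_ : _ =
    J (csub_val (V^† n1)).1 + (J (csub_val m').1 + csub_val b'))//.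
  rewrite 2!bop_add !Jperp_J !add0r hproj_id => ->.
  by rewrite -[LHS]/(hproj Jperp (Z m - J (csub_val m).1)) bop_sub Jperp_J subr0.
have Gu : colligation^† (E a, (Rinv m, 0)) = (a, (m1, y)).
  by rewrite colligation_adj -/n1 loopL.
have -> : b11 G (Rinv m) = m1.
  by rewrite b11E -(transfer_uniq c0 c1 colligation_adj_le Ele Gu).
have /(transfer_uniq c0 c1 residual_le compress_le) <- := loopP.
by rewrite opprB addrC subrK.
Qed.

Theorem feedback : binvertible (bid M2 - t \oB b11 G) /\
  f = b22 G + b21 G \oB binv (bid M2 - t \oB b11 G) \oB t \oB b12 G.
Proof.
have inv : binvertible (bid M2 - t \oB b11 G).
  have [Rinv RK] := feedback_right_inverse.
  exact: binvertible_loop RK feedback_inj.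
split=> //; apply: linear_fractionalE => // m2 u m2E.
have [a aE] := G_ex (m2, u).
have [b bE] := t_ex (b11 G m2 + b12 G u).
rewrite (blockE G) in aE.
rewrite -m2E -[X in _ = (_, X)]subr0 in bE.
have := feedback_loop aE bE.
rewrite [csub_val 0](_ : _ = 0)// bop_zero subr0.
by move=> /(transfer_uniq c0 c1 Sle EXle) <-.
Qed.

End Feedback.

(** * The interpolation problem *)

Section BlockAdjoints.
Variables (R : realType) (A1 A2 C1 C2 : hilbertType R).
Variable T : 'B(hsum A1 A2, hsum C1 C2).

Lemma b11_adj : (b11 T)^† = b11 T^†.
Proof. by rewrite /b11 2!adj_comp adj_bfst adj_binl; exact: bopext. Qed.
Lemma b12_adj : (b12 T)^† = b21 T^†.
Proof. by rewrite /b12 2!adj_comp adj_bfst adj_binr; exact: bopext. Qed.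
Lemma b21_adj : (b21 T)^† = b12 T^†.
Proof. by rewrite /b21 2!adj_comp adj_bsnd adj_binl; exact: bopext. Qed.
Lemma b22_adj : (b22 T)^† = b22 T^†.
Proof. by rewrite /b22 2!adj_comp adj_bsnd adj_binr; exact: bopext. Qed.

End BlockAdjoints.

Lemma csub_inj (R : realType) (V : hilbertType R) (W : csubspace V) :
  injective (@csub_val R V W).
Proof. exact: val_inj. Qed.

Lemma csub_dense_eq (R : realType) (V Z : hilbertType R) (S : set V) (W : csubspace V)
    (A B : 'B(csub W, Z)) :
  S `<=` csub_set W -> csub_set W `<=` csub_set (cspan S) ->
  (forall w : csub W, S (csub_val w) -> A w = B w) -> forall w, A w = B w.
Proof.
move=> SW WS AB w; apply: hdot_injr => x; apply/eqP; rewrite -subr_eq0 -hdotBr.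
rewrite -bopBE hdotC adjP -hdotC.
suff -> : (A - B)^† x = 0 by rewrite hdot0l.
apply: (csub_fullP WS) => v Sv.
have [s sE] := csub_lift (SW _ Sv).
by rewrite -sE -csubE adjPr bopBE AB ?subrr ?hdot0r// sE.
Qed.

(** This c, which may depend on x, is the contraction constant of all state operators at x. *)
Lemma ev_bound (R : realType) (T : Type) (Psi : testFunctions R T) (x : T) :
  exists c : R[i], [/\ 0 <= c, c < 1 & forall psi, `|ev Psi x psi| <= c].
Proof.
have [r r1 rs] : exists2 r : R, r < 1 &
    (ereal_sup [set (complex.Re `|psi x|)%:E | psi in tf_set Psi] <= r%:E)%E.
  have := tf_sup Psi x; case: (ereal_sup _) => [r| |] //.
    by rewrite lte_fin => r1; exists r.
  (* The supremum is -oo only for an empty set of test functions. *)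
  by exists 0; rewrite ?ltr01 ?leNye.
exists (Num.max r 0)%:C%C; split.
- by rewrite ler0c le_max lexx orbT.
- by rewrite -[1]/(1%:C%C) ltcR gt_max r1 ltr01.
move=> psi; have n0 := normr_ge0 (ev Psi x psi).
rewrite -[leLHS]RRe_real ?ger0_real// lecR le_max; apply/orP; left.
rewrite -lee_fin; apply: le_trans rs; apply: ereal_sup_ubound.
by exists (tf_fun psi) => //; exact: set_mem (valP (psi : tf_set Psi)).
Qed.

Section CompressedRep.
Variables (R : realType) (X0 : topologicalType) (L X : hilbertType R).
Variables (J : 'B(L, X)) (rho : star_rep X0 X) (mu : Cb R X0 -> 'B(L, L)).
Hypothesis JEadj : forall d x, J^† (rho d x) = mu d (J^† x).
Local Notation cr d := (compress J (rho d)).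

Lemma compress_rep_linear : linear (fun d => cr d).
Proof.
move=> a d e; apply: bopext => b; apply: csub_inj.
rewrite [RHS](_ : _ = a *: csub_val (cr d b) + csub_val (cr e b))//.
by rewrite !(compressE (JEadj _)) star_repP.
Qed.

Lemma compress_rep1 : cr 1 = bid _.
Proof.
by apply: bopext => b; apply: csub_inj; rewrite (compressE (JEadj _)) star_rep1.
Qed.

Lemma compress_repM d e : cr (d * e) = cr d \oB cr e.
Proof.
apply: bopext => b; apply: csub_inj.
by rewrite bcompE !(compressE (JEadj _)) star_repM.
Qed.

Lemma compress_rep_star d : cr (Cb_star d) = (cr d)^†.
Proof.
apply/esym/adj_eq => x y.
by rewrite !csubE !(compressE (JEadj _)) star_rep_adj.
Qed.

(** [transfer_schur_agler] needs the state operators of t to come from a representation on X'. *)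
Definition compress_rep : star_rep X0 (csub (Jperp J)) :=
  StarRep compress_rep_linear compress_rep1 compress_repM compress_rep_star.

End CompressedRep.

Section Interpolation.
Variables (R : realType) (T : Type) (Psi : testFunctions R T).
Variables (U Y : hilbertType R) (n : nat) (z : 'I_n -> T) (B : 'I_n -> 'B(U, Y)).
Variable (Gam : range z -> range z -> Cb R (tf_space Psi) -> 'B(Y, Y)).
Variable (K : kolmogorov Gam).
Local Notation A := (Cb R (tf_space Psi)).
Local Notation ev := (ev Psi).

Lemma muL_star (d : A) : (muL K d)^† = muL K (Cb_star d).
Proof. by apply: adj_eq => x y; rewrite !csubE; exact: star_rep_adj. Qed.

Lemma muL1 w : muL K 1 w = w.
Proof. by apply: csub_inj; exact: star_rep1. Qed.

Lemma muL_gram i j (d e : A) y w :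
  hdot (muL K d (hL K i y)) (muL K e (hL K j w)) =
  hdot (Gam (node z j) (node z i) (Cb_star e * d) y) w.
Proof.
rewrite (kol_eq K) !bcompE star_repM [RHS]adjP star_rep_adj Cb_starK.
by rewrite csubE.
Qed.

(** The factorisation of the defect rearranged into an equality of Gram entries. It serves both for
    V, from the data B, and for the map attached to f. *)
Lemma unitary_gram (X : topologicalType) (H : hilbertType R) (rho : star_rep X H)
    (hy hw : H) (y w : Y) (d e : Cb R X) (u v : U) :
  hdot (rho (1 - e * Cb_star d) hy) hw = hdot y w - hdot u v ->
  hdot ((rho d)^† hy) ((rho e)^† hw) + hdot y w = hdot hy hw + hdot u v.
Proof.
rewrite star_repB star_rep1 star_repM hdotBl rep_star [hdot (rho e _) _]adjP.
by move=> /eqP; rewrite subr_eq => /eqP ->; ring.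
Qed.

Lemma defect_hdot (V W : 'B(U, Y)) y w :
  hdot ((bid Y - V \oB W^†) y) w = hdot y w - hdot (W^† y) (V^† w).
Proof. by rewrite bopBE hdotBl -(adjP V). Qed.

(** The generators are taken as elements of [N2] and [N1] themselves. They span both spaces, so the
    partial isometry and its adjoint are inverse to each other. *)
Lemma Vop_prop : cp_interpolation B Gam ->
  unitary (Vop B K) /\ forall i y (p : csub (N2 K)),
    csub_val p = gen2 K i y -> csub_val (Vop B K p) = gen1 B K i y.
Proof.
move=> cpi.
suff ex : exists V : 'B(csub (N2 K), csub (N1 B K)), [set V | unitary V /\
    forall i y (p : csub (N2 K)), csub_val p = gen2 K i y ->
      csub_val (V p) = gen1 B K i y] V.
  exact: (xgetPex 0 ex).
have g2 (q : 'I_n * Y) : csub_set (N2 K) (gen2 K q.1 q.2).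
  by apply: sub_cspan; exists q.1, q.2.
have g1 (q : 'I_n * Y) : csub_set (N1 B K) (gen1 B K q.1 q.2).
  by apply: sub_cspan; exists q.1, q.2.
pose p2 q := CSub (mem_set (g2 q)); pose p1 q := CSub (mem_set (g1 q)).
have gram q r : hdot (p2 q) (p2 r) = hdot (p1 q) (p1 r).
  rewrite 2!csubE !hsum_pairE !csubE.
  rewrite !muL_star [csub_val (muL K _ _)](_ : _ =
    (kol_rep K (ev (z q.1)))^† ((kol_h K (node z q.1))^† q.2)); last first.
    by rewrite -rep_star.
  rewrite [csub_val (muL K _ _)](_ : _ =
    (kol_rep K (ev (z r.1)))^† ((kol_h K (node z r.1))^† r.2)); last first.
    by rewrite -rep_star.
  apply: unitary_gram.
  rewrite -[LHS](adjPr (kol_h K (node z r.1))^†) adjK.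
  have := congr1 (fun S : 'B(Y, Y) => hdot (S q.2) r.2) (cpi r.1 q.1).
  by rewrite defect_hdot (kol_eq K) => ->.
have [V0 [V0p V0q _]] := partial_isometry_ex gram.
exists V0; split; last first.
  move=> i y p pE; have -> : p = p2 (i, y) by exact: csub_inj.
  by rewrite V0p.
split; apply: bopext.
  apply: (@csub_dense_eq _ _ _ [set p | exists i y, p = gen2 K i y]) => //.
    exact: sub_cspan.
  move=> w [i [y wE]]; have -> : w = p2 (i, y) by exact: csub_inj.
  by rewrite bcompE V0p V0q.
apply: (@csub_dense_eq _ _ _ [set p | exists i y, p = gen1 B K i y]) => //.
  exact: sub_cspan.
move=> w [i [y wE]]; have -> : w = p1 (i, y) by exact: csub_inj.
by rewrite bcompE V0q V0p.
Qed.

Lemma QopE : Qop B K = colligation (Vop B K).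
Proof. by rewrite /Qop /Qsum /colligation /M1 /M2. Qed.

Lemma GfunE x : Gfun B K x = transfer (colligation (Vop B K))^† (muL K (ev x)).
Proof.
rewrite /Gfun QopE; move: (colligation _) (muL _ _) => C E.
by rewrite /transfer b11_adj b12_adj b21_adj b22_adj.
Qed.

Variable f : T -> 'B(U, Y).
Hypothesis fz : forall i, f (z i) = B i.
Hypothesis cpi : cp_interpolation B Gam.
Hypothesis aff : affiliated Gam f.

Theorem affiliated_linear_fractional :
  exists t : T -> 'B(csub (M1 B K), csub (M2 K)),
    schur_agler Psi t /\
    forall x,
      binvertible (bid (csub (M2 K)) - t x \oB b11 (Gfun B K x)) /\
      f x = b22 (Gfun B K x) +
            b21 (Gfun B K x) \oB binv (bid (csub (M2 K)) - t x \oB b11 (Gfun B K x))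
              \oB t x \oB b12 (Gfun B K x).
Proof.
have [D [Dcp DI DG]] := aff.
have [X [rho [h hP]]] := kolmogorov_ex Dcp.
have hD x x' d y w : hdot (rho d (h x y)) (h x' w) = hdot (D x' x d y) w.
  by rewrite -[h x' w](star_rep1 rho) hP Cb_star1 mul1r.
pose p (q : T * Y) : hsum X Y := ((rho (ev q.1))^† (h q.1 q.2), q.2).
pose p' (q : T * Y) : hsum X U := (h q.1 q.2, (f q.1)^† q.2).
have gramf q r : hdot (p q) (p r) = hdot (p' q) (p' r).
  rewrite !hsum_pairE; apply: unitary_gram.
  by rewrite hD -DI defect_hdot.
have [T0 [T0p T0q T0le]] := partial_isometry_ex gramf.
pose q1 (q : 'I_n * A * Y) : csub (L1 K) := muL K q.1.2 (hL K q.1.1 q.2).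
pose q2 (q : 'I_n * A * Y) : X := rho q.1.2 (h (z q.1.1) q.2).
(* This is where the extension of Gam by D enters: at the nodes both Gram matrices are given by the
   same maps. *)
have gramJ q r : hdot (q1 q) (q1 r) = hdot (q2 q) (q2 r).
  by rewrite muL_gram hP DG.
have [J [Jp Jq _]] := partial_isometry_ex gramJ.
have L1_ind (Z : hilbertType R) (S1 S2 : 'B(csub (L1 K), Z)) :
    (forall q, S1 (q1 q) = S2 (q1 q)) -> forall w, S1 w = S2 w.
  move=> S12; apply: (@csub_dense_eq _ _ _ (@L1_gen _ _ _ _ _ z Gam K)) => //.
    exact: sub_cspan.
  move=> w [i [d [y wE]]].
  by have -> : w = q1 (i, d, y) by exact: csub_inj.
have Jiso l : J^† (J l) = l.
  by apply: (L1_ind _ (J^† \oB J) (bid _)) => q; rewrite bcompE Jp Jq.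
have JE d l : J (muL K d l) = rho d (J l).
  apply: (L1_ind _ (J \oB muL K d) (rho d \oB J)) => q; rewrite !bcompE Jp.
  have -> : muL K d (q1 q) = q1 (q.1.1, d * q.1.2, q.2).
    by apply: csub_inj; apply/esym; exact: star_repM.
  by rewrite Jp /q2 /= star_repM.
have JEadj d x : J^† (rho d x) = muL K d (J^† x).
  apply: hdot_inj => l; rewrite adjPr star_rep_adj -JE -adjPr -[in RHS](Cb_starK d).
  by rewrite -(muL_star (Cb_star d)) [RHS]adjPr.
have JhL i y : J (hL K i y) = h (z i) y.
  by rewrite -[hL K i y]muL1 -[h (z i) y](star_rep1 rho); exact: (Jp (i, 1, y)).
have [Vun Vgen] := Vop_prop cpi.
(* At the nodes, the vectors p and p' are the images under J (+) 1 of the generators of N_2 and N_1;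
   hence [T0] extends V. *)
have pgen i y : Jsum J Y (gen2 K i y) = p (z i, y).
  rewrite [LHS](_ : _ = (J ((muL K (ev (z i)))^† (hL K i y)), y))// muL_star JE JhL.
  by rewrite rep_star.
have p'gen i y : Jsum J U (gen1 B K i y) = p' (z i, y).
  by rewrite [LHS](_ : _ = (J (hL K i y), (B i)^† y))// JhL /p' /= fz.
have T0V n2 : T0 (Jsum J Y (csub_val n2)) = Jsum J U (csub_val (Vop B K n2)).
  move: n2; apply: (@csub_dense_eq _ _ _ [set p | exists i y, p = gen2 K i y] _
    (T0 \oB Jsum J Y \oB bincl (N2 K)) (Jsum J U \oB bincl (N1 B K) \oB Vop B K)) => //.
    exact: sub_cspan.
  move=> w [i [y wE]].
  rewrite [LHS](_ : _ = T0 (Jsum J Y (csub_val w)))//.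
  rewrite [RHS](_ : _ = Jsum J U (csub_val (Vop B K w)))//.
  by rewrite (Vgen i y)// wE pgen p'gen T0p.
have SV n2 : T0^† (Jsum J U (csub_val (Vop B K n2))) = Jsum J Y (csub_val n2).
  move: n2; apply: (@csub_dense_eq _ _ _ [set p | exists i y, p = gen2 K i y] _
    (T0^† \oB Jsum J U \oB bincl (N1 B K) \oB Vop B K) (Jsum J Y \oB bincl (N2 K))) => //.
    exact: sub_cspan.
  move=> w [i [y wE]].
  rewrite [RHS](_ : _ = Jsum J Y (csub_val w))//.
  rewrite [LHS](_ : _ = T0^† (Jsum J U (csub_val (Vop B K w))))//.
  by rewrite (Vgen i y)// wE pgen p'gen T0q.
have Sle := norm_adj1 T0le.
have SVadj n2 : T0^†^† (Jsum J Y (csub_val n2)) = Jsum J U (csub_val (Vop B K n2)).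
  by rewrite adjK T0V.
have evle x := ev_bound Psi x.
(* The equation T0 (p (x, y)) = p' (x, y) is a loop with state h x y and output f(x)^† y, so T0
   realises the adjoint of f. *)
have fE x : f x = transfer T0^† (rho (ev x)).
  have [c [c0 c1 ec]] := evle x.
  have rle := star_rep_norm rho c0 ec.
  rewrite -[LHS]adjK -[RHS]adjK -(transfer_adj c0 c1 Sle rle); congr adj.
  apply: bopext => y.
  apply: (transfer_uniq (a := h x y) c0 c1 (norm_adj1 Sle) (norm_adj c0 rle)).
  by rewrite adjK; exact: (T0p (x, y)).
pose S' := residual J (N1 B K) (N2 K) T0^†.
have S'le : forall w, `|S' w| <= `|w| by exact: (residual_le Jiso).
exists (fun x => transfer S' (compress J (rho (ev x)))); split; last first.
  move=> x; have [c [c0 c1 ec]] := evle x.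
  rewrite GfunE fE.
  apply: (feedback Jiso Vun Sle SV SVadj c0 c1 _ _ (JE (ev x)) (JEadj (ev x))).
    move=> l; exact: (star_rep_norm (kol_rep K) c0 ec).
  exact: star_rep_norm.
pose rho' := compress_rep JEadj.
(* The vectors required by [transfer_schur_agler] are the states of the adjoint loop of S'. *)
have tadj x m : exists a, S'^† ((rho' (ev x))^† a, m) =
    (a, (transfer S' (compress J (rho (ev x))))^† m).
  have [c [c0 c1 ec]] := evle x.
  have rle := star_rep_norm rho' c0 ec.
  have [a aE] := transfer_ex c0 c1 (norm_adj1 S'le) (norm_adj c0 rle) m.
  by exists a; rewrite aE (transfer_adj c0 c1 S'le rle).
exact: (@transfer_schur_agler _ _ _ _ _ _ rho' S' _
  (fun x m => projT1 (cid (tadj x m))) S'le (fun x m => projT2 (cid (tadj x m)))).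
Qed.

End Interpolation.

Theorem theorem6 (R : realType) (m : nat) (Omega : set 'rV[R[i]]_m)
    (Psi : testFunctions R Omega) (U Y : hilbertType R)
    (n : nat) (z : 'I_n -> Omega) (B : 'I_n -> 'B(U, Y))
    (f : Omega -> 'B(U, Y))
    (Gam : range z -> range z -> Cb R (tf_space Psi) -> 'B(Y, Y))
    (K : kolmogorov Gam) :
  (0 < m)%N -> open Omega -> connected Omega ->
  (forall psi, tf_set Psi psi -> holomorphic psi) ->
  (0 < n)%N ->
  schur_agler Psi f ->
  (forall i, f (z i) = B i) ->
  cp_kernel Gam ->
  cp_interpolation B Gam ->
  affiliated Gam f ->
  exists t : Omega -> 'B(csub (M1 B K), csub (M2 K)),
    schur_agler Psi t /\
    forall x : Omega,
      binvertible (bid (csub (M2 K)) - t x \oB b11 (Gfun B K x)) /\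
      f x = b22 (Gfun B K x) +
            b21 (Gfun B K x) \oB binv (bid (csub (M2 K)) - t x \oB b11 (Gfun B K x))
              \oB t x \oB b12 (Gfun B K x).
Proof.
by move=> _ _ _ _ _ _ fz _ cpi aff; exact: affiliated_linear_fractional.
Qed.
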